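(* Let $p\ge 1$. Let $G$ be a transitively closed DAG. Then $W_{G,p}$ is a metric on $\mathcal{P}_p^G(\mathcal{X})$. Conversely, if $G$ is a DAG which is not transitively closed, then there is a choice of $(\mathcal{X},d_{\mathcal{X}})$ (with $\mathcal X=\prod_{v\in V}\mathcal X_v$ a product of Polish spaces indexed by the vertices of $G$) for which $W_{G,p}$ does not satisfy the triangle inequality on $\mathcal{P}_p^G(\mathcal{X})$.
   Context: Directed graphs $G=(V,E)$ have a finite vertex set $V$ and edge set $E\subseteq\{(i,j)\in V\times V: i\neq j\}$; $\mathrm{pa}_i=\{j:(j,i)\in E\}$ is the set of parents of $i$, $\mathrm{an}_i$ is the set of ancestors of $i$ (vertices from which there is a directed path of length at least one to $i$), and $\mathrm{dsc}_i=\{j: i\in\mathrm{an}_j\}$. $G$ is a DAG (directed acyclic graph) if $i\notin\mathrm{an}_i$ for all $i$. $G$ is transitively closed if $i\in\mathrm{pa}_j$ and $j\in\mathrm{pa}_k$ imply $i\in\mathrm{pa}_k$. To each $v\in V$ are associated Polish spaces $\mathcal X_v,\mathcal Y_v$; $\mathcal X=\prod_{v\in V}\mathcal X_v$ and, for $A\subseteq V$, $\mathcal X_A=\prod_{v\in A}\mathcal X_v$, and $X_A$ denotes the projection of a random variable $X$ in $\mathcal X$ onto $\mathcal X_A$ (similarly for $\mathcal Y$). $\mathcal P(\Omega)$ is the set of Borel probability measures on a Polish space $\Omega$, and $d_\Omega$ denotes its metric (complete, inducing the topology; on $\mathcal X$ the topology is the product topology). $\mathcal P_p(\Omega)$ is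 the set of $\mu\in\mathcal P(\Omega)$ with $\int d_\Omega(x,x_0)^p\,d\mu(x)<\infty$ for some $x_0$. $\Pi(\mu,\nu)$ is the set of couplings of $\mu$ and $\nu$. For a DAG $G$, $\mu\in\mathcal P(\mathcal X)$ is $G$-compatible if, for $X\sim\mu$ and every $i\in V$, $X_i$ is conditionally independent of $X_{V\setminus(\mathrm{dsc}_i\cup\{i\})}$ given $X_{\mathrm{pa}_i}$. $\mathcal P^G(\mathcal X)$ is the set of $G$-compatible measures and $\mathcal P_p^G(\mathcal X)=\mathcal P^G(\mathcal X)\cap\mathcal P_p(\mathcal X)$. For $\mu\in\mathcal P^G(\mathcal X)$, $\nu\in\mathcal P^G(\mathcal Y)$: let $G^c$ be the DAG with vertex set $\{i,i':i\in V\}$ ($i'$ a copy of $i$) and edge set $\{(i,j),(i,j'),(i',j'):(i,j)\in E\}\cup\{(i,i'):i\in V\}$, with $\mathcal X_i$ associated to $i$ and $\mathcal Y_i$ to $i'$. The set of $G$-causal couplings is $\Pi_G^c(\mu,\nu)=\Pi(\mu,\nu)\cap\mathcal P^{G^c}(\mathcal X\times\mathcal Y)$. A coupling $\pi\in\Pi(\mu,\nu)$ is $G$-anticausal if its pushforward under $(x,y)\mapsto(y,x)$ lies in $\Pi_G^c(\nu,\mu)$. The set of $G$-bicausal couplings $\Pi_G^{bc}(\mu,\nu)$ consists of the couplings that are both $G$-causal and $G$-anticausal. For $\mu,\nu\in\mathcal P_p^G(\mathcal X)$, $W_{G,p}(\mu,\nu)^p=\inf_{\pi\in\Pi_G^{bc}(\mu,\nu)}\int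 d_{\mathcal X}(x,y)^p\,d\pi(x,y)$. *)

(* Defs.v *)
From HB Require Import structures.
From mathcomp Require Import all_boot all_order all_algebra.
From mathcomp Require Import all_classical all_reals all_analysis.
From mathcomp Require Import giry.

Set Implicit Arguments.
Unset Strict Implicit.
Unset Printing Implicit Defensive.

Import Order.TTheory GRing.Theory Num.Theory.
Import numFieldNormedType.Exports.

Local Open Scope classical_set_scope.
Local Open Scope ring_scope.

Record digraph (V : finType) := Digraph {
  edge :> rel V;
  edge_irr : irreflexive edge }.

Section Digraphs.
Variables (V : finType) (G : digraph V).

Definition pa (i : V) : {set V} := [set j | G j i].

(* [connect] allows paths of length zero, hence the explicit first edge. *)
Definition an (i : V) : {set V} :=
  [set j | [exists k, G j k && connect G k i]].

Definition dsc (i : V) : {set V} := [set j | i \in an j].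

Definition is_dag : Prop := forall i, i \notin an i.

Definition transitively_closed : Prop :=
  forall i j k, i \in pa j -> j \in pa k -> i \in pa k.

(* The graph G^c: [inl i] is the vertex i and [inr i] is its copy i'. *)
Definition causal_edge : rel (V + V) := fun a b =>
  match a, b with
  | inl i, inl j => G i j
  | inl i, inr j => G i j || (i == j)
  | inr i, inr j => G i j
  | inr _, inl _ => false
  end.

Lemma causal_edge_irr : irreflexive causal_edge.
Proof. by case=> i /=; exact: edge_irr. Qed.

Definition causal_graph : digraph (V + V)%type := Digraph causal_edge_irr.

End Digraphs.

Section Polish.
Variable R : realType.

Definition complete_metric (T : topologicalType) (d : T -> T -> R) : Prop :=
  [/\ [/\ forall x y, 0 <= d x y,
          forall x y, d x y = 0 <-> x = y,
          forall x y, d x y = d y x &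
          forall x y z, d x z <= d x y + d y z],
      forall x : T, nbhs x = nbhs_ball_ (fun x e => [set y | d x y < e]) x &
      forall u : nat -> T,
        (forall e : R, 0 < e -> exists N, forall m n,
           (N <= m)%N -> (N <= n)%N -> d (u m) (u n) < e) ->
        exists l : T, u n @[n --> \oo] --> l].

Definition polish (T : topologicalType) : Prop :=
  (exists2 D : set T, countable D & dense D) /\
  exists d : T -> T -> R, complete_metric d.

End Polish.

Definition borel (T : ptopologicalType) : measurableType (sigma_display open) :=
  g_sigma_algebraType (@open T).

HB.instance Definition _ (I : Type) (S : I -> ptopologicalType) :=
  Pointed.copy (prod_topology S) (forall i, S i).

Definition prod_space (I : Type) (S : I -> ptopologicalType)
    : ptopologicalType :=
  prod_topology S.

Section ConditionalIndependence.
Context d (Omega : measurableType d) (R : realType) (P : probability Omega R).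

(* f is a version of the conditional probability P(A | F), for a
   sub-sigma-algebra F. *)
Definition is_cond_prob (F : set (set Omega)) (A : set Omega) (f : Omega -> R)
    : Prop :=
  [/\ g_sigma_algebra_preimage f `<=` F,
      P.-integrable setT (EFin \o f) &
      forall C, F C -> (\int[P]_(w in C) (f w)%:E = P (A `&` C))%E].

(* P(A /\ B | F3) = P(A | F3) P(B | F3) almost surely, for all A in F1 and
   B in F2. Versions exist and are almost surely unique, so quantifying
   existentially or universally over them is the same. *)
Definition cond_indep_sigma (F1 F2 F3 : set (set Omega)) : Prop :=
  forall A B, F1 A -> F2 B ->
  exists f g h : Omega -> R,
    [/\ is_cond_prob F3 A f, is_cond_prob F3 B g,
        is_cond_prob F3 (A `&` B) h &
        {ae P, forall w, h w = f w * g w}].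

Definition cond_indep d1 d2 d3 (T1 : measurableType d1)
    (T2 : measurableType d2) (T3 : measurableType d3)
    (X : Omega -> T1) (Y : Omega -> T2) (Z : Omega -> T3) : Prop :=
  cond_indep_sigma (g_sigma_algebra_preimage X) (g_sigma_algebra_preimage Y)
    (g_sigma_algebra_preimage Z).

End ConditionalIndependence.

Section Compatibility.
Context d (Omega : measurableType d) (R : realType) (P : probability Omega R).
Variables (V : finType) (S : V -> ptopologicalType).
Variable X : forall v, Omega -> S v.

Definition subvec (A : {set V}) (w : Omega)
    : borel (prod_space (fun v : {v : V | v \in A} => S (val v))) :=
  fun v => X (val v) w.
Arguments subvec A w : clear implicits.

(* The law of the random vector (X_v)_v under P is G-compatible. *)
Definition compatible (G : digraph V) : Prop :=
  forall i, cond_indep P (X i : Omega -> borel (S i))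
    (subvec (~: (dsc G i :|: [set i]))) (subvec (pa G i)).

End Compatibility.

Section Couplings.
Context d1 d2 (T1 : measurableType d1) (T2 : measurableType d2) (R : realType).

HB.instance Definition _ := isMeasurableFun.Build _ _ _ _
  (@fst T1 T2) measurable_fst.
HB.instance Definition _ := isMeasurableFun.Build _ _ _ _
  (@snd T1 T2) measurable_snd.
HB.instance Definition _ := isMeasurableFun.Build _ _ _ _
  (@unstable.swap T1 T2) (@measurable_swap _ _ T1 T2).

(* Couplings are measures on the product sigma-algebra. When T1 and T2 are
   Polish spaces with their Borel sigma-algebras, this is the Borel
   sigma-algebra of the product topology. *)
Definition couplings (mu : probability T1 R) (nu : probability T2 R)
    : set (probability (T1 * T2)%type R) :=
  [set pi | measure_eq (distribution pi (@fst T1 T2)) mu /\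
            measure_eq (distribution pi (@snd T1 T2)) nu].

Definition swap_law (pi : probability (T1 * T2)%type R)
    : probability (T2 * T1)%type R :=
  distribution pi (@unstable.swap T1 T2).

End Couplings.

Section CausalTransport.
Context (R : realType) (V : finType) (G : digraph V).
Implicit Types S X Y : V -> ptopologicalType.

Definition PG S : set (probability (borel (prod_space S)) R) :=
  [set mu | compatible mu (fun v (x : borel (prod_space S)) => x v) G].

Definition pair_space X Y (a : V + V) : ptopologicalType :=
  match a with inl i => X i | inr i => Y i end.

Definition pair_coord X Y (a : V + V)
    : borel (prod_space X) * borel (prod_space Y) -> pair_space X Y a :=
  match a with inl i => fun xy => xy.1 i | inr i => fun xy => xy.2 i end.

Definition causal_couplings X Y
    (mu : probability (borel (prod_space X)) R)
    (nu : probability (borel (prod_space Y)) R) :=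
  couplings mu nu `&`
  [set pi : probability
              (borel (prod_space X) * borel (prod_space Y))%type R
     | compatible pi (@pair_coord X Y) (causal_graph G)].

Definition anticausal_couplings X Y
    (mu : probability (borel (prod_space X)) R)
    (nu : probability (borel (prod_space Y)) R) :=
  couplings mu nu `&` [set pi | causal_couplings nu mu (swap_law pi)].

Definition bicausal_couplings X Y
    (mu : probability (borel (prod_space X)) R)
    (nu : probability (borel (prod_space Y)) R) :=
  causal_couplings mu nu `&` anticausal_couplings mu nu.

Variables (X : V -> ptopologicalType).
Variables (dX : prod_space X -> prod_space X -> R) (p : R).

Definition PpG : set (probability (borel (prod_space X)) R) :=
  @PG X `&`
  [set mu : probability (borel (prod_space X)) R
     | exists x0, (\int[mu]_x (dX x x0 `^ p)%:E < +oo)%E].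

Definition WG (mu nu : probability (borel (prod_space X)) R) : \bar R :=
  (ereal_inf [set \int[pi]_xy (dX xy.1 xy.2 `^ p)%:E
             | pi in @bicausal_couplings X X mu nu] `^ p^-1)%E.

End CausalTransport.

Section Metrics.
Context d (T : measurableType d) (R : realType).
Variables (A : set (probability T R)).
Variable D : probability T R -> probability T R -> \bar R.
Local Open Scope ereal_scope.

Definition triangle_inequality_on : Prop :=
  forall mu nu la, A mu -> A nu -> A la -> D mu la <= D mu nu + D nu la.

(* Two measures are identified when they agree on measurable sets
   ([measure_eq]): Leibniz equality would also compare the irrelevant values
   of the underlying set functions on non-measurable sets. *)
Definition metric_on : Prop :=
  [/\ forall mu nu, A mu -> A nu -> 0 <= D mu nu < +oo,
      forall mu nu, A mu -> A nu -> (D mu nu = 0 <-> measure_eq mu nu),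
      forall mu nu, A mu -> A nu -> D mu nu = D nu mu &
      triangle_inequality_on].

End Metrics.

(* Main.v *)
Require Import Defs.
From HB Require Import structures.
From mathcomp Require Import all_boot all_order all_algebra.
From mathcomp Require Import all_classical all_reals all_analysis.
From mathcomp Require Import measurable_realfun giry ring lra.

(* Only the triangle inequality is not routine. Given bicausal couplings of (mu, nu) and (nu, la),
   glue them to a triple (x, y, z) with x and z independent given y. The law of (x, z) need not
   be bicausal, since x_v and z_v may share information through the past of y. Instead, the
   triple is resampled coordinate by coordinate along a topological order, the pairs (x_v, z_v)
   with a noise xi and each y_v with a separate noise u, and u is frozen. As G is transitively
   closed, y_v is then a function of the pairs (x_w, z_w) with w = v or w a parent of v, so that
   (x_v, z_v) is independent of the past given the pairs at the parents of v; hence for almost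
   every u the law of (x, z) given u is a bicausal coupling of mu and la. Some u has cost at most
   the average cost E d(x, z)^p, and Minkowski's inequality concludes.

   If i -> j -> k without i -> k, take all spaces equal to nat and two fair coins a, b: mu, nu and
   la are the laws of (a, 2, b), (a, a, b) and (a, 3, a xor b) at (i, j, k), the other coordinates
   being 0, and the distance is a truncated graph distance for which the obvious couplings of
   (mu, nu) and (nu, la) have cost 1. Under a bicausal coupling of mu and la, (x_k, z_k) is
   independent of (x_i, z_i) since the coordinates at the parents of k are constant; so with
   probability at least 1/2 the distance is 3 instead of 2, and the cost is at least
   (2^p + 3^p)/2 > 2^p. *)

Set Implicit Arguments.
Unset Strict Implicit.
Unset Printing Implicit Defensive.

Import Order.TTheory GRing.Theory Num.Theory.
Import numFieldNormedType.Exports.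
Local Open Scope classical_set_scope.
Local Open Scope ring_scope.

(** * Laws and conditional probabilities *)

Section Law.
Context d d' (Om : measurableType d) (T : measurableType d') (R : realType).
Context (P : probability Om R) (X : Om -> T) (mX : measurable_fun setT X).

(** Resampling must preserve the laws of x and z although u is frozen. It does because, in the glued
    triple, x_v depends on the past of (x, y, z) only through x at the parents of v, and likewise
    for z_v: the x-component of the kernel of the pair is the kernel of mu, whatever the past of y.
    This is also why the pair at v is drawn before y_v: in the other order, freezing the noise of
    y_v would condition x_v on y_v and change the law of x.

    The agreement of kernels holds only off a null set of pasts, which the law given one particular
    u might charge. The cost is therefore made infinite on that set: a u whose cost is at most the
    finite average avoids it, so one choice secures both the marginals and the cost.

    Conditional independence is used in a one-sided form, [predicts], for which contraction and
    symmetry follow from the uniqueness of conditional probabilities. Kernels appear only as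
    measurable functions of a point and a uniform noise; Polish spaces are coded by real numbers so
    that quantile transforms provide them. *)

Definition law : probability T R :=
  distribution P (HB.pack X (isMeasurableFun.Build _ _ _ _ X mX) : {mfun Om >-> T}).

Lemma lawE A : law A = P (X @^-1` A). Proof. by []. Qed.

Lemma measurable_preimage A : measurable A -> measurable (X @^-1` A).
Proof. by move=> mA; rewrite -[_ @^-1` _]setTI; exact: mX. Qed.

Lemma ge0_integral_law (f : T -> \bar R) D : measurable D ->
  measurable_fun D f -> (forall y, 0 <= f y)%E ->
  (\int[law]_(y in D) f y = \int[P]_(x in X @^-1` D) f (X x))%E.
Proof. by move=> mD mf f0; rewrite ge0_integral_pushforward. Qed.

End Law.
Arguments law {d d' Om T R} P {X} mX.

Lemma measurable_lt_set d (T : measurableType d) (R : realType) (f g : T -> R) :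
  measurable_fun setT f -> measurable_fun setT g -> measurable [set x | f x < g x].
Proof.
move=> mf mg; rewrite (_ : [set _ | _] = (fun x => f x < g x) @^-1` [set true]).
  by apply: measurable_preimage => //; exact: measurable_fun_ltr.
by apply/seteqP; split.
Qed.

Section CondProb.
Context d (Om : measurableType d) (R : realType) (P : probability Om R).
Local Open Scope ereal_scope.

Lemma integral_mrestr (E D : set Om) (mE : measurable E) (h : Om -> \bar R) :
  measurable_fun D h -> (forall x, 0 <= h x) -> measurable D ->
  \int[mrestr P mE]_(o in D) h o = \int[P]_(o in D `&` E) h o.
Proof.
move=> mh h0 mD.
rewrite (@ge0_negligible_integral _ _ _ _ _ (~` E))//; last 2 first.
- exact: measurableC.
- by rewrite /= /mrestr setICl measure0.
rewrite setDE setCK; apply: eq_measure_integral => A mA AD.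
by rewrite /= /mrestr setIidl// => x /AD[].
Qed.

(** The function [f] is the Radon-Nikodym density, with respect to the law of [w], of the image
    under [w] of [P] restricted to [E]. The weight [h] allows one conditional probability to be
    integrated against another. *)
Lemma exists_condprob d' (W : measurableType d') (w : Om -> W) (E : set Om) :
  measurable_fun setT w -> measurable E ->
  exists f : W -> R, [/\ measurable_fun setT f, (forall x, (0 <= f x)%R) &
    forall (h : W -> \bar R) (D : set W), measurable_fun setT h ->
      (forall x, 0 <= h x) -> measurable D ->
      \int[P]_(o in w @^-1` D) (h (w o) * (f (w o))%:E) =
      \int[P]_(o in w @^-1` D `&` E) h (w o)].
Proof.
move=> mw mE.
pose mu : {sigma_finite_measure set W -> \bar R} := law P mw.
pose PE : {finite_measure set Om -> \bar R} := mrestr P mE.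
pose nu0 : {measure set W -> \bar R} := pushforward PE w.
have nufin : fin_num_fun (nu0 mw).
  move=> A mA; apply: fin_num_measure; rewrite -[_ @^-1` _]setTI; exact/mw.
pose nu1 : {finite_measure set W -> \bar R} :=
  HB.pack (pushforward PE w) (Measure.on (nu0 mw))
    (Measure_isFinite.Build _ _ _ (nu0 mw) nufin).
pose nu := nu1 mw.
have numu : nu `<< mu.
  apply/null_content_dominatesP => A mA muA0; apply/eqP.
  rewrite eq_le measure_ge0 andbT -muA0.
  rewrite /nu/= /pushforward /mu lawE /mrestr.
  apply: le_measure; rewrite ?inE; [apply: measurableI => //| |exact: subIsetl];
    by rewrite -[_ @^-1` _]setTI; exact/mw.
have mf : measurable_fun setT (fine \o Radon_Nikodym_SigmaFinite.f nu mu).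
  apply: measurableT_comp => //.
  by have /integrableP[] := Radon_Nikodym_SigmaFinite.f_integrable numu.
exists (fine \o Radon_Nikodym_SigmaFinite.f nu mu); split => //.
  by move=> x /=; apply: fine_ge0; exact: Radon_Nikodym_SigmaFinite.f_ge0.
move=> h D mh h0 mD.
have mwD : measurable (w @^-1` D) by rewrite -[_ @^-1` _]setTI; exact/mw.
transitivity (\int[mu]_(x in D) (h x * Radon_Nikodym_SigmaFinite.f nu mu x)).
  rewrite [RHS]ge0_integral_law//.
  - apply: eq_integral => x _ /=.
    by rewrite fineK//; exact: Radon_Nikodym_SigmaFinite.f_fin_num.
  - apply: emeasurable_funM; apply: measurable_funTS => //.
    by have /integrableP[] := Radon_Nikodym_SigmaFinite.f_integrable numu.
  - by move=> y; apply: mule_ge0 => //; exact: Radon_Nikodym_SigmaFinite.f_ge0.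
rewrite Radon_Nikodym_SigmaFinite.change_of_variables//; last first.
  exact: measurable_funTS.
rewrite [LHS](ge0_integral_pushforward _ PE)//; last exact: measurable_funTS.
apply: integral_mrestr => //; last by move=> x /=; exact: h0.
by apply: measurable_funTS; exact: measurableT_comp.
Qed.

End CondProb.

(** Measurability for a bare set system, so that several sigma-algebras on one space are compared by
    inclusion, without a change of type. *)
Definition sig_fun (Om : Type) d (T : measurableType d) (F : set (set Om)) (f : Om -> T) :=
  forall B, measurable B -> F (f @^-1` B).

Section SubAlgebra.
Context d (Om : measurableType d) (R : realType) (P : probability Om R).
Local Open Scope ereal_scope.
Implicit Types (F : set (set Om)).

Definition sub_alg F := sigma_algebra setT F /\ F `<=` measurable.

Lemma measurable_sub_alg F : sub_alg F ->
  @measurable _ (g_sigma_algebraType F) = F.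
Proof. by move=> [sF _]; rewrite /measurable/=; exact: smallest_id. Qed.

Lemma measurable_fun_sub_alg F d' (T : measurableType d') (f : Om -> T) : sub_alg F ->
  measurable_fun (setT : set (g_sigma_algebraType F)) f <-> sig_fun F f.
Proof.
move=> sF; split => mf.
  move=> B mB; have := mf measurableT B mB.
  by rewrite (measurable_sub_alg sF) setTI.
by move=> _ B mB; rewrite setTI (measurable_sub_alg sF); exact: mf.
Qed.

Lemma sub_algI F A B : sub_alg F -> F A -> F B -> F (A `&` B).
Proof.
move=> sF; rewrite -(measurable_sub_alg sF); exact: measurableI.
Qed.

Lemma sub_algT F : sub_alg F -> F setT.
Proof. by move=> sF; rewrite -(measurable_sub_alg sF). Qed.

Lemma sig_fun_measurable F d' (T : measurableType d') (f : Om -> T) : sub_alg F ->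
  sig_fun F f -> measurable_fun setT f.
Proof. by move=> [_ Fm] mf _ B mB; rewrite setTI; apply/Fm/mf. Qed.

Lemma sig_fun_sub F F' d' (T : measurableType d') (f : Om -> T) :
  F `<=` F' -> sig_fun F f -> sig_fun F' f.
Proof. by move=> FF' mf B mB; apply/FF'/mf. Qed.

Lemma sub_alg_id F : sub_alg F ->
  measurable_fun setT (id : Om -> g_sigma_algebraType F).
Proof.
by move=> sF _ B; rewrite (measurable_sub_alg sF) setTI preimage_id; exact: sF.2.
Qed.

Lemma exists_condexp F (E : set Om) : sub_alg F -> measurable E ->
  exists f : Om -> R, [/\ sig_fun F f, (forall x, (0 <= f x)%R) &
    forall (h : Om -> R) (D : set Om), sig_fun F h ->
      (forall x, 0 <= h x)%R -> F D ->
      \int[P]_(o in D) (h o * f o)%:E = \int[P]_(o in D `&` E) (h o)%:E].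
Proof.
move=> sF mE.
have [f [mf f0 fE]] := exists_condprob P (sub_alg_id sF) mE.
exists f; split => //; first exact/measurable_fun_sub_alg.
move=> h D mh h0 FD; have := fE (EFin \o h) D.
rewrite (measurable_sub_alg sF) preimage_id; apply => //.
by apply/measurable_EFinP/measurable_fun_sub_alg.
Qed.

(** The identity, seen as a map to the space equipped with [F], pushes [P] to a measure whose
    measurable sets are those of [F]; there, equal integrals over all of them give equality almost
    everywhere. *)
Lemma condexp_unique F (f g : Om -> R) : sub_alg F -> sig_fun F f -> sig_fun F g ->
  P.-integrable setT (EFin \o f) -> P.-integrable setT (EFin \o g) ->
  (forall D, F D -> \int[P]_(o in D) (f o)%:E = \int[P]_(o in D) (g o)%:E) ->
  {ae P, forall o, f o = g o}.
Proof.
move=> sF mf mg fi gi fg.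
have mid := sub_alg_id sF.
pose mu := law P mid.
have mE (h : Om -> R) : sig_fun F h ->
    measurable_fun (setT : set (g_sigma_algebraType F)) (EFin \o h).
  by move=> mh; apply/measurable_EFinP/measurable_fun_sub_alg.
have intE (h : Om -> R) D : sig_fun F h -> P.-integrable setT (EFin \o h) -> F D ->
    \int[mu]_(o in D) (h o)%:E = \int[P]_(o in D) (h o)%:E.
  move=> mh hi FD; apply: (integral_pushforward mid (mE _ mh)).
    by apply: integrableS hi => //; exact: sF.2.
  by rewrite (measurable_sub_alg sF).
have fi' : mu.-integrable setT (EFin \o f).
  by apply: integrable_pushforward => //; exact: mE.
have [N [mN muN0 fgN]] : ae_eq mu setT (EFin \o f) (EFin \o g).
  apply: integral_ae_eq => //; first exact: mE.
  move=> D _; rewrite (measurable_sub_alg sF) => FD.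
  by rewrite !intE// fg.
exists N; split => //; first by rewrite (measurable_sub_alg sF) in mN; exact: sF.2.
move=> o /= nfg; apply: fgN => /= /(_ I) -[]; exact: nfg.
Qed.

(** The maximum of [f] and [g] has the same integrals as [g]: where it exceeds [g] it equals [f],
    whose integrals are not larger. By uniqueness it is almost surely [g]. *)
Lemma condexp_le F (f g : Om -> R) : sub_alg F -> sig_fun F f -> sig_fun F g ->
  (forall o, 0 <= f o)%R -> (forall o, 0 <= g o)%R ->
  P.-integrable setT (EFin \o f) -> P.-integrable setT (EFin \o g) ->
  (forall D, F D -> \int[P]_(o in D) (f o)%:E <= \int[P]_(o in D) (g o)%:E) ->
  {ae P, forall o, (f o <= g o)%R}.
Proof.
move=> sF mf mg f0 g0 fi gi fg.
have mf' : measurable_fun setT f := sig_fun_measurable sF mf.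
have mg' : measurable_fun setT g := sig_fun_measurable sF mg.
pose m o := Num.max (f o) (g o).
have mm : sig_fun F m.
  by apply/measurable_fun_sub_alg => //; apply: measurable_maxr; exact/measurable_fun_sub_alg.
have mm' : measurable_fun setT m := sig_fun_measurable sF mm.
pose A := [set o | (g o < f o)%R].
have FA : F A.
  rewrite -(measurable_sub_alg sF).
  by apply: (@measurable_lt_set _ (g_sigma_algebraType F)); exact/measurable_fun_sub_alg.
have mA : measurable A by apply: sF.2.
have mi : P.-integrable setT (EFin \o m).
  apply: (@le_integrable _ _ _ _ _ _ _ (EFin \o (f \+ g)%R)) => //.
  - by apply/measurable_EFinP.
  - move=> o _ /=; rewrite lee_fin !ger0_norm ?addr_ge0//.
      by rewrite /m ge_max lerDl lerDr f0 g0.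
    by rewrite /m le_max f0.
  - exact: (integrableD measurableT fi gi).
have : {ae P, forall o, m o = g o}.
  apply: (condexp_unique sF) => // D FD.
  have mD := sF.2 _ FD.
  have split_int (h : Om -> R) : measurable_fun setT h -> (forall o, 0 <= h o)%R ->
      \int[P]_(o in D) (h o)%:E =
      \int[P]_(o in D `&` A) (h o)%:E + \int[P]_(o in D `\` A) (h o)%:E.
    move=> mh h0; rewrite -ge0_integral_setU//.
    - by rewrite setDE -setIUr setUCr setIT.
    - exact: measurableI.
    - exact: measurableD.
    - by apply/measurable_EFinP; exact: measurable_funTS.
    - by move=> x _; rewrite lee_fin.
    - by apply/disj_setPS => x [[_ Ax] [_ nAx]].
  have m0 o : (0 <= m o)%R by rewrite /m le_max f0.
  apply/eqP; rewrite eq_le; apply/andP; split.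
    rewrite !split_int//; apply: leeD.
      apply: le_trans (fg _ _); last exact: sub_algI.
      rewrite le_eqVlt; apply/orP; left; apply/eqP.
      apply: eq_integral => o; rewrite inE => -[_ /ltW].
      by rewrite /m; move=> /max_idPl ->.
    rewrite le_eqVlt; apply/orP; left; apply/eqP.
    apply: eq_integral => o; rewrite inE => -[_] /negP.
    by rewrite /m -leNgt => /max_idPr ->.
  apply: ge0_le_integral => //.
  - by move=> x _; rewrite lee_fin.
  - by apply: measurable_funTS; apply/measurable_EFinP.
  - by apply: measurable_funTS; apply/measurable_EFinP.
  - by move=> x _; rewrite lee_fin le_max lexx orbT.
apply: filterS => o; rewrite /m => <-; by rewrite le_max lexx.
Qed.

End SubAlgebra.

(** * Conditional independence *)

Section Prediction.
Context d (Om : measurableType d) (R : realType) (P : probability Om R).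
Local Open Scope ereal_scope.
Implicit Types (F G H : set (set Om)).

Definition join F G := <<s F `|` G >>.

Lemma join_sub_alg F G : F `<=` measurable -> G `<=` measurable ->
  sub_alg (join F G).
Proof.
move=> Fm Gm; split; first exact: smallest_sigma_algebra.
apply: smallest_sub; first exact: sigma_algebra_measurable.
by move=> A []; [exact: Fm|exact: Gm].
Qed.

Lemma join_subl F G : F `<=` join F G.
Proof. by move=> A FA; apply: sub_sigma_algebra; left. Qed.

Lemma join_subr F G : G `<=` join F G.
Proof. by move=> A FA; apply: sub_sigma_algebra; right. Qed.

Lemma density_dynkin G (E : set Om) (f : Om -> R) : setI_closed G ->
  G `<=` measurable -> G setT -> measurable E -> measurable_fun setT f ->
  (forall o, 0 <= f o)%R ->
  (forall D, G D -> P (E `&` D) = \int[P]_(o in D) (f o)%:E) ->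
  forall D, <<s G >> D -> P (E `&` D) = \int[P]_(o in D) (f o)%:E.
Proof.
move=> GI Gm GT mE mf f0 Gf.
suff: <<s G >> `<=` [set D | measurable D /\ P (E `&` D) = \int[P]_(o in D) (f o)%:E].
  by move=> h D /h[].
have meF : measurable_fun setT (EFin \o f) by apply/measurable_EFinP.
have e0 o : 0 <= (f o)%:E by rewrite lee_fin.
apply: lambda_system_subset => //; last by move=> D GD; split; [exact: Gm|exact: Gf].
apply/dynkin_lambda_system; split.
- by split => //; exact: Gf.
- move=> D [mD eD]; split; first exact: measurableC.
  have fin : P (E `&` D) \is a fin_num.
    by apply: fin_num_measure; exact: measurableI.
  have : P (E `&` D) + P (E `&` ~` D) =
      \int[P]_(o in D) (f o)%:E + \int[P]_(o in ~` D) (f o)%:E.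
    rewrite -ge0_integral_setU//; [|exact: measurableC| |exact/disj_setPCl].
    + rewrite setUv -Gf// setIT -measureU.
      * by rewrite -setIUr setUv setIT.
      * exact: measurableI.
      * by apply: measurableI => //; exact: measurableC.
      * by rewrite setIACA setICr setI0.
    + exact: measurable_funTS.
  by rewrite -eD => /(congr1 (fun x => x - P (E `&` D))); rewrite addeAC subee// add0e addeAC subee// add0e.
- move=> B tB mB; split; first by apply: bigcup_measurable => k _; exact: (mB k).1.
  rewrite setI_bigcupr measure_semi_bigcup//.
  + rewrite ge0_integral_bigcup//; last 2 first.
    * by move=> k; exact: (mB k).1.
    * exact: measurable_funTS.
    by apply: eq_eseriesr => k _; exact: (mB k).2.
  + by move=> k; apply: measurableI => //; exact: (mB k).1.
  + exact: trivIset_setIl.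
  + by apply: bigcup_measurable => k _; apply: measurableI => //; exact: (mB k).1.
Qed.

(* Given the information in [G], every event of [F] has a conditional
   probability that is [H]-measurable. *)
Definition predicts F G H := forall E, F E -> exists f : Om -> R,
  [/\ sig_fun H f, (forall o, 0 <= f o)%R &
   forall D, G D -> P (E `&` D) = \int[P]_(o in D) (f o)%:E].

(** Decomposition and weak union both come from this monotonicity: [H] may grow at no price, as it
    is not asked to lie inside [G]. *)
Lemma predicts_weaken F G H F' G' H' : F' `<=` F -> G' `<=` G -> H `<=` H' ->
  predicts F G H -> predicts F' G' H'.
Proof.
move=> sF sG sH FGH E /sF/FGH[f [mf f0 fE]]; exists f; split => //.
  exact: sig_fun_sub mf.
by move=> D /sG/fE.
Qed.

Lemma predicts_incl F G H : sub_alg H -> G `<=` measurable -> F `<=` H ->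
  predicts F G H.
Proof.
move=> sH Gm FH E /FH HE; exists (\1_E); split => //.
- apply/(measurable_fun_sub_alg _ sH).
  by apply: measurable_indic; rewrite (measurable_sub_alg sH).
- move=> D GD; rewrite integral_indic//; [exact: Gm|exact: sH.2].
Qed.

Lemma condprob_integrable (f : Om -> R) E G : G setT -> measurable_fun setT f ->
  (forall o, 0 <= f o)%R -> 
  (forall D, G D -> P (E `&` D) = \int[P]_(o in D) (f o)%:E) ->
  measurable E ->
  P.-integrable setT (EFin \o f).
Proof.
move=> GT mf f0 fE mE; apply/integrableP; split; first exact/measurable_EFinP.
under eq_integral do rewrite /= ger0_norm//.
rewrite -fE// setIT; apply: (le_lt_trans (probability_le1 P mE)); exact: ltry.
Qed.

(** The contraction axiom: the two conditional probabilities are both [G]-measurable with the same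
    integrals over [G], so they agree almost surely and the [H]-measurable one also serves for
    [G']. *)
Lemma predicts_contract F G H G' H' : sub_alg G -> F `<=` measurable ->
  G' `<=` measurable ->
  H `<=` G -> H' `<=` G -> G `<=` G' ->
  predicts F G H -> predicts F G' H' -> predicts F G' H.
Proof.
move=> sG Fm G'm HG H'G GG' p1 p2 E FE.
have [f [mf f0 fE]] := p1 _ FE; have [g [mg g0 gE]] := p2 _ FE.
exists f; split => // D G'D; rewrite gE//.
have mE := Fm _ FE.
have sgf : sig_fun G f by exact: sig_fun_sub mf.
have sgg : sig_fun G g by exact: sig_fun_sub mg.
have mf' := sig_fun_measurable sG sgf.
have mg' := sig_fun_measurable sG sgg.
have GT := sub_algT sG.
have gf : {ae P, forall o, g o = f o}.
  apply: (condexp_unique sG) => //.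
  - by apply: (condprob_integrable (GG' _ GT)) gE _.
  - by apply: (condprob_integrable GT) fE _.
  - by move=> C GC; rewrite -gE ?fE//; exact: GG'.
apply: ae_eq_integral; first exact: G'm.
- by apply: measurable_funTS; apply/measurable_EFinP.
- by apply: measurable_funTS; apply/measurable_EFinP.
- by apply: filterS gf => o /= -> _.
Qed.

(** The intersections of a set of [F] with a set of [G] form a pi-system that generates the join. *)
Lemma join_ind F G (E : set Om) (f : Om -> R) : sub_alg F -> sub_alg G ->
  measurable E -> measurable_fun setT f -> (forall o, 0 <= f o)%R ->
  (forall A B, F A -> G B -> P (E `&` (A `&` B)) = \int[P]_(o in A `&` B) (f o)%:E) ->
  forall D, join F G D -> P (E `&` D) = \int[P]_(o in D) (f o)%:E.
Proof.
move=> sF sG mE mf f0 fE D jD.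
pose K := [set C | exists A B, [/\ F A, G B & C = A `&` B]].
apply: (@density_dynkin K) => //.
- move=> _ _ [A [B [FA GB ->]]] [A' [B' [FA' GB' ->]]].
  by exists (A `&` A'), (B `&` B'); rewrite setIACA; split => //; exact: sub_algI.
- move=> _ [A [B [FA GB ->]]]; apply: measurableI; [exact: sF.2|exact: sG.2].
- by exists setT, setT; rewrite setIT; split => //; exact: sub_algT.
- by move=> _ [A [B [FA GB ->]]]; exact: fE.
- move: D jD; apply: smallest_sub; first exact: smallest_sigma_algebra.
  move=> A [FA|GA]; apply: sub_sigma_algebra.
    by exists A, setT; rewrite setIT; split => //; exact: sub_algT.
  by exists setT, A; rewrite setTI; split => //; exact: sub_algT.
Qed.

(** With f and g the conditional probabilities of A and E given [H], both sides of the required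
    identity are the integral of f g over C. *)
Lemma predicts_sym F G H : sub_alg F -> sub_alg G -> sub_alg H ->
  predicts F (join G H) H -> predicts G (join F H) H.
Proof.
move=> sF sG sH p1 E GE.
have mE : measurable E := sG.2 _ GE.
have [g [mg g0 gE]] := exists_condexp P sH mE.
have mg' := sig_fun_measurable sH mg.
exists g; split => //; apply: join_ind => // A C FA HC.
have [f [mf f0 fE]] := p1 _ FA.
have mf' := sig_fun_measurable sH mf.
have mA := sF.2 _ FA; have mC := sH.2 _ HC.
have HT := sub_algT sH.
have fE' D : H D -> P (A `&` D) = \int[P]_(o in D) (f o)%:E.
  by move=> HD; apply: fE; exact: join_subr.
(* [g] integrates against [A] as against [f], and [f] against [E] as against [g]. *)
have [f' [mf2 f'0 f'E]] := exists_condexp P sH mA.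
have mf2' := sig_fun_measurable sH mf2.
have f'E1 D : H D -> P (A `&` D) = \int[P]_(o in D) (f' o)%:E.
  move=> HD; have := f'E (cst 1%R) D.
  under eq_integral do rewrite /= mul1r.
  move=> ->//; last exact/(measurable_fun_sub_alg _ sH).
  rewrite [RHS](_ : _ = \int[P]_(o in D `&` A) cst 1 o)//.
  rewrite integral_cst; last by apply: measurableI => //; exact: sH.2.
  by rewrite mul1e setIC.
have ff' : {ae P, forall o, f' o = f o}.
  apply: (condexp_unique sH) => //.
  - exact: (condprob_integrable HT) f'E1 _.
  - exact: (condprob_integrable HT) fE' _.
  - by move=> D HD; rewrite -f'E1// fE'.
rewrite [A `&` C]setIC -f'E//.
transitivity (\int[P]_(o in C) (f o * g o)%:E).
  rewrite gE// -fE; first by rewrite setIC setIAC setIC.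
  by apply: (sub_algI (join_sub_alg sG.2 sH.2)); [exact: join_subr|exact: join_subl].
apply: ae_eq_integral => //.
- by apply: measurable_funTS; apply/measurable_EFinP/measurable_funM.
- by apply: measurable_funTS; apply/measurable_EFinP/measurable_funM.
- by apply: filterS ff' => o /= -> _; rewrite mulrC.
Qed.

End Prediction.

Section Prediction2.
Context d (Om : measurableType d) (R : realType) (P : probability Om R).
Local Open Scope ereal_scope.
Implicit Types (F G H : set (set Om)).

Lemma exists_condprob_sub H E : sub_alg H -> measurable E ->
  exists f : Om -> R, [/\ sig_fun H f, (forall x, (0 <= f x)%R),
    (forall D, H D -> P (E `&` D) = \int[P]_(o in D) (f o)%:E) &
    forall (h : Om -> R) (D : set Om), sig_fun H h ->
      (forall x, 0 <= h x)%R -> H D ->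
      \int[P]_(o in D) (h o * f o)%:E = \int[P]_(o in D `&` E) (h o)%:E].
Proof.
move=> sH mE; have [f [mf f0 fE]] := exists_condexp P sH mE.
exists f; split => // D HD; have := fE (cst 1%R) D.
under eq_integral do rewrite /= mul1r.
move=> ->//; last exact/(measurable_fun_sub_alg _ sH).
rewrite [RHS](_ : _ = \int[P]_(o in D `&` E) cst 1 o)//.
rewrite integral_cst; last by apply: measurableI => //; exact: sH.2.
by rewrite mul1e setIC.
Qed.

Lemma condprob_unique G E (f g : Om -> R) : sub_alg G -> measurable E ->
  sig_fun G f -> sig_fun G g -> (forall o, 0 <= f o)%R -> (forall o, 0 <= g o)%R ->
  (forall D, G D -> P (E `&` D) = \int[P]_(o in D) (f o)%:E) ->
  (forall D, G D -> P (E `&` D) = \int[P]_(o in D) (g o)%:E) ->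
  {ae P, forall o, f o = g o}.
Proof.
move=> sG mE mf mg f0 g0 fE gE.
have mf' := sig_fun_measurable sG mf.
have mg' := sig_fun_measurable sG mg.
apply: (condexp_unique sG) => //.
- exact: (condprob_integrable (sub_algT sG)) fE _.
- exact: (condprob_integrable (sub_algT sG)) gE _.
- by move=> D GD; rewrite -fE// gE.
Qed.

Lemma ae_eq_integral_real (D : set Om) (f g : Om -> R) : measurable D ->
  measurable_fun setT f -> measurable_fun setT g -> {ae P, forall o, f o = g o} ->
  \int[P]_(o in D) (f o)%:E = \int[P]_(o in D) (g o)%:E.
Proof.
move=> mD mf mg fg; apply: ae_eq_integral => //.
- by apply: measurable_funTS; apply/measurable_EFinP.
- by apply: measurable_funTS; apply/measurable_EFinP.
- by apply: filterS fg => o /= -> _.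
Qed.

(** Integrating the product formula over [H] amounts to integrating the conditional probability of A
    over the sets B and C intersected. Conversely, f g is itself a version of the conditional
    probability of the intersection. *)
Lemma cond_indep_predicts F G H : sub_alg F -> sub_alg G -> sub_alg H ->
  cond_indep_sigma P F G H <-> predicts P F (join G H) H.
Proof.
move=> sF sG sH; split => [ci A FA|pr A B FA GB].
- have mA := sF.2 _ FA.
  have [f0 [mf0 f00 f0E f0P]] := exists_condprob_sub sH mA.
  have mf0' := sig_fun_measurable sH mf0.
  exists f0; split => //; apply: join_ind => // B C GB HC.
  have mB := sG.2 _ GB; have mC := sH.2 _ HC.
  have [g0 [mg0 g00 g0E g0P]] := exists_condprob_sub sH mB.
  have mg0' := sig_fun_measurable sH mg0.
  have [f [g [h [[mf fi fE] [mg gi gE] [mh hi hE] hfg]]]] := ci _ _ FA GB.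
  have sigP (k : Om -> R) : g_sigma_algebra_preimage k `<=` H -> sig_fun H k.
    by move=> kH Y mY; apply: kH; exists Y => //; rewrite setTI.
  have ff0 : {ae P, forall o, f o = f0 o}.
    apply: (condexp_unique sH) => //; first exact: sigP.
    - exact: (condprob_integrable (sub_algT sH)) f0E _.
    - by move=> D HD; rewrite fE// f0E.
  have gg0 : {ae P, forall o, g o = g0 o}.
    apply: (condexp_unique sH) => //; first exact: sigP.
    - exact: (condprob_integrable (sub_algT sH)) g0E _.
    - by move=> D HD; rewrite gE// g0E.
  rewrite setIA -hE// [B `&` C]setIC -g0P//.
  apply: ae_eq_integral_real => //.
  + exact: (sig_fun_measurable sH (sigP _ mh)).
  + exact: measurable_funM.
  + by move: hfg; apply: filterS2 (filterI ff0 gg0) => o [-> ->] ->.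
- have mA := sF.2 _ FA; have mB := sG.2 _ GB.
  have [f [mf f0 fE]] := pr _ FA.
  have mf' := sig_fun_measurable sH mf.
  have [g [mg g0 gE gP]] := exists_condprob_sub sH mB.
  have mg' := sig_fun_measurable sH mg.
  have fE' D : H D -> P (A `&` D) = \int[P]_(o in D) (f o)%:E.
    by move=> HD; apply: fE; exact: join_subr.
  have sigP (k : Om -> R) : sig_fun H k -> g_sigma_algebra_preimage k `<=` H.
    by move=> mk _ [Y mY <-]; rewrite setTI; exact: mk.
  have mfg : sig_fun H (fun o => f o * g o)%R.
    apply/(measurable_fun_sub_alg _ sH).
    by apply: (@measurable_funM _ (g_sigma_algebraType H)); apply/(measurable_fun_sub_alg _ sH).
  have fgE D : H D -> P ((A `&` B) `&` D) = \int[P]_(o in D) (f o * g o)%:E.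
    move=> HD; rewrite gP// -fE; first by rewrite -setIA [B `&` D]setIC.
    by apply: (sub_algI (join_sub_alg sG.2 sH.2)); [exact: join_subr|exact: join_subl].
  exists f, g, (fun o => f o * g o)%R; split.
  + split; [exact: sigP| |by move=> D HD; rewrite fE'].
    exact: (condprob_integrable (sub_algT sH)) fE' _.
  + split; [exact: sigP| |by move=> D HD; rewrite gE].
    exact: (condprob_integrable (sub_algT sH)) gE _.
  + split; [exact: sigP| |by move=> D HD; rewrite fgE].
    apply: (condprob_integrable (sub_algT sH) _ _ fgE).
    * exact: measurable_funM.
    * by move=> o; exact: mulr_ge0.
    * exact: measurableI.
  + exact: aeW.
Qed.

End Prediction2.

Section Pullback.
Context d d' (Om : measurableType d) (Om' : measurableType d') (R : realType).
Context (P : probability Om R) (g : Om -> Om') (mg : measurable_fun setT g).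
Local Open Scope ereal_scope.
Implicit Types (F G H : set (set Om')).

Definition pre F := preimage_set_system setT g F.

Lemma preP F A : F A -> pre F (g @^-1` A).
Proof. by exists A => //; rewrite setTI. Qed.

Lemma pre_sub_alg F : sub_alg F -> sub_alg (pre F).
Proof.
move=> sF; split; first exact: sigma_algebra_preimage sF.1.
by move=> _ [A FA <-]; apply: mg => //; exact: sF.2.
Qed.

Lemma pre_sub F G : F `<=` G -> pre F `<=` pre G.
Proof. by move=> FG _ [A /FG GA <-]; exists A. Qed.

Lemma sig_fun_pre F (f : Om' -> R) : sig_fun F f -> sig_fun (pre F) (f \o g).
Proof. by move=> mf B mB; rewrite comp_preimage; apply/preP/mf. Qed.

Lemma integral_law_real (D : set Om') (f : Om' -> R) : measurable D ->
  measurable_fun setT f -> (forall o, 0 <= f o)%R ->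
  \int[law P mg]_(o in D) (f o)%:E = \int[P]_(o in g @^-1` D) (f (g o))%:E.
Proof.
move=> mD mf f0; apply: ge0_integral_law => //.
by apply: measurable_funTS; apply/measurable_EFinP.
Qed.

(** From right to left, a version found on [Om] is compared with the pull-back of one computed under
    the law on [Om']: they agree almost surely, by uniqueness given [pre H]. *)
Lemma predicts_pullback F G H : sub_alg F -> sub_alg G -> sub_alg H -> H `<=` G ->
  predicts (law P mg) F G H <-> predicts P (pre F) (pre G) (pre H).
Proof.
move=> sF sG sH HG; split => [p1 _ [E FE <-]|p1 E FE].
- have [f [mf f0 fE]] := p1 _ FE.
  have mf' := sig_fun_measurable sH mf.
  exists (f \o g); split => [| |_ [D GD <-]]; [exact: sig_fun_pre|by move=> o; exact: f0|].
  rewrite !setTI -preimage_setI; have := fE _ GD.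
  by rewrite integral_law_real//; exact: sG.2.
- have mE := sF.2 _ FE.
  have [f [mf f0 fE _]] := exists_condprob_sub (law P mg) sH mE.
  have mf' := sig_fun_measurable sH mf.
  have [h [mh h0 hE]] := p1 _ (preP FE).
  have sph := pre_sub_alg sH.
  exists f; split => // D GD; have mD := sG.2 _ GD.
  rewrite lawE preimage_setI hE; last exact: preP.
  rewrite integral_law_real//; apply: ae_eq_integral_real.
  + exact: measurable_preimage.
  + exact: sig_fun_measurable sph mh.
  + exact: measurableT_comp.
  + apply: (condprob_unique sph (E := g @^-1` E)) => //.
    * exact: measurable_preimage.
    * exact: sig_fun_pre.
    * by move=> C HC; apply: hE; exact: pre_sub HC.
    * move=> _ [C HC <-]; rewrite setTI -preimage_setI; have := fE _ HC.
      by rewrite integral_law_real//; exact: sH.2.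
Qed.

End Pullback.

(** * Coordinates *)

Section Coords.
Context d (Om : measurableType d) (I : Type) (S : I -> ptopologicalType).
Variable X : forall i, Om -> S i.
Implicit Types A B C D : set I.

Definition coord_gen A : set (set Om) :=
  [set E | exists i (B : set (borel (S i))), [/\ A i, measurable B & E = X i @^-1` B]].

(** Given by generators rather than as the preimage of the Borel sets of a product, so that unions
    of index sets become joins without any topology; [subvecE] reconciles the two. *)
Definition coords A : set (set Om) := <<s coord_gen A >>.

Lemma coords_mono A B : A `<=` B -> coords A `<=` coords B.
Proof.
move=> AB; apply: sub_smallest2r; first exact: smallest_sigma_algebra.
by move=> E [i [C [Ai mC ->]]]; exists i, C; split => //; exact: AB.
Qed.

Lemma coords_coord A i : A i -> sig_fun (coords A) (X i : Om -> borel (S i)).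
Proof. by move=> Ai B mB; apply: sub_sigma_algebra; exists i, B. Qed.

Lemma coords_min A H : sub_alg H ->
  (forall i, A i -> sig_fun H (X i : Om -> borel (S i))) -> coords A `<=` H.
Proof.
move=> [sH _] AH; apply: smallest_sub => // _ [i [B [Ai mB ->]]]; exact: AH.
Qed.

Lemma coordsU A B : coords (A `|` B) = join (coords A) (coords B).
Proof.
apply/seteqP; split; last first.
  apply: smallest_sub; first exact: smallest_sigma_algebra.
  by move=> E [] /coords_mono; apply; [exact: subsetUl|exact: subsetUr].
apply: smallest_sub; first exact: smallest_sigma_algebra.
move=> _ [i [C [[Ai|Bi] mC ->]]].
- by apply: join_subl; apply: coords_coord.
- by apply: join_subr; apply: coords_coord.
Qed.

Hypothesis mX : forall i, measurable_fun setT (X i : Om -> borel (S i)).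

Lemma coords_sub_alg A : sub_alg (coords A).
Proof.
split; first exact: smallest_sigma_algebra.
apply: smallest_sub; first exact: sigma_algebra_measurable.
by move=> _ [i [B [Ai mB ->]]]; rewrite -[_ @^-1` _]setTI; exact: mX.
Qed.

Lemma coords1 i : coords [set i] =
  g_sigma_algebra_preimage (X i : Om -> borel (S i)).
Proof.
apply/seteqP; split.
  apply: smallest_sub.
    by apply: sigma_algebra_preimage; exact: sigma_algebra_measurable.
  by move=> _ [j [B [ji mB ->]]]; rewrite /= in ji; subst j; exists B => //; rewrite setTI.
by move=> _ [B mB <-]; rewrite setTI; apply: coords_coord.
Qed.

Section CI.
Context (R : realType) (P : probability Om R).

(* The coordinates in [A] and [B] are independent given those in [C]. *)
Definition ci A B C := predicts P (coords A) (coords (B `|` C)) (coords C).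

Lemma ci_weaken A' B' C' A B C : ci A B C -> A' `<=` A -> B' `<=` B `|` C ->
  C `<=` C' -> C' `<=` B `|` C -> ci A' B' C'.
Proof.
move=> h AA BB CC CBC; apply: (predicts_weaken _ _ _ h); apply: coords_mono => //.
by rewrite subUset.
Qed.

(** Contraction: the larger information predicts [A] through [C'], which is part of what [C] already
    summarizes. *)
Lemma ci_trans A B C B' C' B'' : ci A B C -> ci A B' C' -> C' `<=` B `|` C ->
  B `|` C `<=` B' `|` C' -> B'' `|` C `<=` B' `|` C' -> ci A B'' C.
Proof.
move=> h h' CBC BCBC B''C.
have sub := coords_sub_alg.
suff : predicts P (coords A) (coords (B' `|` C')) (coords C).
  by apply: predicts_weaken => //; exact: coords_mono.
apply: (predicts_contract (sub _) _ _ _ _ _ h h').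
- exact: (sub _).2.
- exact: (sub _).2.
- by apply: coords_mono; exact: subsetUr.
- exact: coords_mono.
- exact: coords_mono.
Qed.

Lemma ci_sym A B C : ci A B C -> ci B A C.
Proof.
by rewrite /ci !coordsU; apply: predicts_sym; exact: coords_sub_alg.
Qed.

Lemma ci_incl A B C : A `<=` C -> ci A B C.
Proof.
move=> AC; apply: predicts_incl; first exact: coords_sub_alg.
  exact: (coords_sub_alg _).2.
exact: coords_mono.
Qed.

(** The chain rule; by symmetry it is contraction for the prediction of [B], from [D] and then from
    [A]. *)
Lemma ci_Ul A B C D : ci A B (C `|` D) -> ci D B C -> ci (A `|` D) B C.
Proof.
move=> /ci_sym h /ci_sym h'; apply: ci_sym; apply: (ci_trans h' h).
- by rewrite setUC.
- by move=> x [Dx|Cx]; right; [right|left].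
- by move=> x [[Ax|Dx]|Cx]; [left|right; right|right; left].
Qed.

End CI.
End Coords.

Section CoordsMaps.
Context d d' (Om : measurableType d) (Om' : measurableType d').
Context (I : Type) (S : I -> ptopologicalType).
Variable X : forall i, Om' -> S i.

Lemma coords_comp (g : Om -> Om') A :
  coords (fun i => X i \o g) A = pre g (coords X A).
Proof.
rewrite /coords -[RHS](@g_sigma_preimageE _ _ setT).
congr <<s _, _ >>; apply/seteqP; split => [_ [i [B [Ai mB ->]]]|_ [_ [i [B [Ai mB ->]]] <-]].
  by exists (X i @^-1` B); rewrite ?setTI//; exists i, B.
by exists i, B; rewrite setTI.
Qed.

Lemma coords_reindex (J : Type) (phi : J -> I) A :
  coords (fun j => X (phi j)) A = coords X (phi @` A).
Proof.
congr <<s _, _ >>; apply/seteqP; split => [_ [j [B [Aj mB ->]]]|_ [i [B [[j Aj ji] mB ->]]]].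
  by exists (phi j), B; split => //; exists j.
by subst i; exists j, B.
Qed.

Lemma ci_pullback (R : realType) (P : probability Om R) (g : Om -> Om')
    (mg : measurable_fun setT g) A B C :
  (forall i, measurable_fun setT (X i : Om' -> borel (S i))) ->
  ci X (law P mg) A B C <-> ci (fun i => X i \o g) P A B C.
Proof.
move=> mX; rewrite /ci !coords_comp; apply: predicts_pullback => //;
  try exact: coords_sub_alg.
by apply: coords_mono; exact: subsetUr.
Qed.

End CoordsMaps.

(** * Countable bases and Borel sets of finite products *)

Section Countability.
Variable R : realType.

Definition countable_base (T : topologicalType) (U : nat -> set T) :=
  (forall n, open (U n)) /\
  forall (O : set T) x, open O -> O x -> exists n, U n x /\ U n `<=` O.

Section Metric.
Context (T : ptopologicalType) (e : T -> T -> R) (ce : complete_metric e).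

Let e0 x y : 0 <= e x y. Proof. by case: ce => -[]. Qed.
Lemma metric_xx x : e x x = 0. Proof. by case: ce => -[_ h _ _] _ _; exact/h. Qed.
Let eC x y : e x y = e y x. Proof. by case: ce => -[]. Qed.
Let eD x y z : e x z <= e x y + e y z. Proof. by case: ce => -[]. Qed.

Lemma metric_nbhsP x (A : set T) :
  nbhs x A <-> exists2 r, 0 < r & [set y | e x y < r] `<=` A.
Proof.
have [_ -> _] := ce; rewrite /nbhs_ball_ /filter_from/=; split.
  by case=> r r0 h; exists r.
by case=> r r0 h; exists r.
Qed.

Lemma open_metric_ball x r : open [set y | e x y < r].
Proof.
rewrite openE => y /= exy; apply/metric_nbhsP; exists (r - e x y).
  by rewrite subr_gt0.
by move=> z /=; rewrite ltrBrDl; apply: le_lt_trans.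
Qed.

Lemma dense_seq (D : set T) : countable D -> dense D ->
  exists q : nat -> T, forall x r, 0 < r -> exists n, e x (q n) < r.
Proof.
move=> cD dD.
have [x0 [_ Dx0]] : setT `&` D !=set0 by apply: dD; [exists point|exact: openT].
have [D0|[q]] : D = set0 \/ $| {surjfun [set: nat] >-> D} |.
- exact/pfcard_geP.
- by rewrite D0 in Dx0.
exists q => x r r0; have : [set y | e x y < r] `&` D !=set0.
  apply: dD; first by exists x => /=; rewrite metric_xx.
  exact: open_metric_ball.
move=> [y [/= exy Dy]]; have [n _ qn] := @surj _ _ _ _ q y Dy.
by exists n; rewrite qn.
Qed.

(** Balls of radius 1/(m+1) around dense points, listed by the code of (k, m); numbers that code no
    pair give the empty set. *)
Definition metric_base (q : nat -> T) (n : nat) : set T :=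
  if (unpickle n : option (nat * nat)) is Some (k, m)
  then [set y | e (q k) y < m.+1%:R^-1] else set0.

Lemma metric_countable_base (q : nat -> T) :
  (forall x r, 0 < r -> exists n, e x (q n) < r) ->
  countable_base (metric_base q).
Proof.
move=> qd; rewrite /metric_base.
split=> [n|O x oO Ox].
  by case: unpickle => [[k m]|]; [exact: open_metric_ball|exact: open0].
have /metric_nbhsP[r r0 rO] : nbhs x O by exact: open_nbhs_nbhs.
have [m mr] : exists m : nat, (m.+1%:R^-1 : R) < r / 2.
  have /cvgrPdist_lt/(_ (r / 2)) := @cvg_harmonic R.
  have -> : 0 < r / 2 by rewrite divr_gt0.
  move=> /(_ isT)[m _ /(_ m (leqnn m))] /=; rewrite sub0r normrN ger0_norm ?invr_ge0//.
  by exists m.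
have [k xk] := qd x m.+1%:R^-1 (ltac:(by rewrite invr_gt0)).
exists (pickle (k, m)); rewrite pickleK; split => /=; first by rewrite eC.
move=> y /= ky; apply: rO => /=; apply: le_lt_trans (eD _ (q k) _) _.
by rewrite [ltRHS](splitr r); apply: ltrD; [exact: lt_trans xk mr|exact: lt_trans ky mr].
Qed.

End Metric.

Lemma polish_countable_base (T : ptopologicalType) : polish R T ->
  exists U : nat -> set T, countable_base U.
Proof.
move=> [[D cD dD] [e ce]]; have [q qd] := dense_seq ce cD dD.
by exists (metric_base e q); exact: metric_countable_base qd.
Qed.

End Countability.

Section Product.
Context (I : finType) (S : I -> ptopologicalType).

Lemma measurable_coord i : measurable_fun setT
  ((fun x => x i) : borel (prod_space S) -> borel (S i)).
Proof.
apply: (@measurability _ _ _ (borel (S i)) _ _ (@open (S i))) => // _ [W oW <-].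
rewrite setTI; apply: sub_sigma_algebra.
by apply: open_comp => // x _; exact: (@proj_continuous _ S i).
Qed.

Hypothesis US : forall i, exists U : nat -> set (S i), countable_base U.

(** The product topology is a supremum of initial topologies, so it suffices that the sets
    containing a box around [x] form a filter to which the cylinders belong. *)
Lemma nbhs_prod_box (x : prod_space S) (A : set (prod_space S)) : nbhs x A ->
  exists V : forall i, set (S i), (forall i, nbhs (x i) (V i)) /\
    [set y | forall i, V i (y i)] `<=` A.
Proof.
pose F := [set A : set (prod_space S) | exists V : forall i, set (S i),
  (forall i, nbhs (x i) (V i)) /\ [set y | forall i, V i (y i)] `<=` A].
have FF : Filter F.
  split.
  - by exists (fun=> setT); split => // i; exact: filterT.
  - move=> B C [V [nV VB]] [W [nW WC]]; exists (fun i => V i `&` W i).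
    split=> [i|y Vy]; first exact: filterI.
    by split; [apply: VB => i; exact: (Vy i).1|apply: WC => i; exact: (Vy i).2].
  - by move=> B C BC [V [nV VB]]; exists V; split => //; exact: subset_trans BC.
suff : nbhs x `<=` F by apply.
apply/cvg_sup => i B [W [[C oC CW] Wx] WB].
(* The box with side C at [i] and the whole space elsewhere; the cast moves z to the type of the
   coordinate [i]. *)
exists (fun j => [set z | forall ij : i = j, C (ecast k (S k) (esym ij) z)]).
split=> [j|y /(_ i)/(_ erefl) Cy]; last by apply: WB; rewrite -CW.
have [ij|ij] := pselect (i = j); last by apply: filterE => z.
subst j; apply: (@filterS _ _ _ C).
  by move=> z Cz ij; rewrite (_ : ij = erefl)//; exact: Prop_irrelevance.
by apply: open_nbhs_nbhs; split => //; move: Wx; rewrite -CW.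
Qed.

(** An open set is the union of the basic boxes inside it, and since [I] is finite these boxes are
    indexed by a countable type. *)
Lemma open_prod_coords (O : set (prod_space S)) : open O ->
  coords (fun i (x : borel (prod_space S)) => x i) setT O.
Proof.
pose U i := sval (cid (US i)).
have Ub i : countable_base (U i) := svalP (cid (US i)).
move=> oO.
pose box (f : {ffun I -> nat}) := [set x : prod_space S | forall i, U i (f i) (x i)].
have -> : O = \bigcup_(f in [set f | box f `<=` O]) box f.
  apply/seteqP; split => [x Ox|x [f fO fx]]; last exact: fO.
  have /nbhs_prod_box[V [nV VO]] : nbhs x O by exact: open_nbhs_nbhs.
  have /choice[n nP] : forall i, exists n, U i n (x i) /\ U i n `<=` V i.
    move=> i; have := nV i; rewrite nbhsE => -[W [oW Wx] WV].
    have [n [Ux UW]] := (Ub i).2 W _ oW Wx.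
    by exists n; split => //; exact: subset_trans WV.
  exists (finfun n); last by move=> i; rewrite ffunE; exact: (nP i).1.
  by move=> y /= yb; apply: VO => i; apply: (nP i).2; have := yb i; rewrite ffunE.
pose M := borel (prod_space S).
have sub := coords_sub_alg (fun i => @measurable_coord i) setT.
rewrite -(measurable_sub_alg sub) bigcup_mkcond.
apply: countable_bigcupT_measurable => // f; case: ifP => // _.
have -> : box f = \bigcap_(i in [set: I]) [set x | U i (f i) (x i)].
  by apply/seteqP; split => [x xb i _|x xb i]; [exact: xb|exact: (xb i Logic.I)].
apply: fin_bigcap_measurable => // i _.
rewrite (measurable_sub_alg sub).
apply: (coords_coord (X := fun i (x : M) => x i) (i := i) _ (B := U i (f i))) => //.
by apply: sub_sigma_algebra; exact: (Ub i).1.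
Qed.

Lemma borel_prodE : @measurable _ (borel (prod_space S)) =
  coords (fun i (x : borel (prod_space S)) => x i) setT.
Proof.
have sub := coords_sub_alg (fun i => @measurable_coord i) setT.
apply/seteqP; split; last exact: sub.2.
apply: smallest_sub; [exact: sub.1|exact: open_prod_coords].
Qed.

Lemma measurable_to_prod d (Om : measurableType d) (f : Om -> prod_space S) :
  (forall i, measurable_fun setT ((fun o => f o i) : Om -> borel (S i))) ->
  measurable_fun setT (f : Om -> borel (prod_space S)).
Proof.
move=> mf; apply: (measurability (coord_gen (fun i (x : borel (prod_space S)) => x i) setT)).
  exact: borel_prodE.
move=> _ [_ [i [B [_ mB ->]]] <-]; exact: mf.
Qed.

End Product.

(** * Markov properties *)

Section CompatibleCi.
Context d (Om : measurableType d) (R : realType) (P : probability Om R).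
Context (V : finType) (S : V -> ptopologicalType).
Variable X : forall v, Om -> S v.
Hypothesis mX : forall i, measurable_fun setT (X i : Om -> borel (S i)).
Hypothesis US : forall i, exists U : nat -> set (S i), countable_base U.

Lemma subvecE (A : {set V}) :
  g_sigma_algebra_preimage (@subvec _ _ _ _ X A) = coords X [set` A].
Proof.
rewrite /g_sigma_algebra_preimage borel_prodE; last by move=> v; exact: US.
rewrite -[LHS](coords_comp _ (@subvec _ _ _ _ X A)).
rewrite [LHS](_ : _ = coords (fun v : {v : V | v \in A} => X (val v)) setT)//.
rewrite (coords_reindex X (fun v : {v : V | v \in A} => val v)).
congr coords; apply/seteqP; split => [_ [v _ <-]|v vA]; first exact: (valP v).
by exists (exist _ v vA).
Qed.

Lemma compatibleP (G : digraph V) : compatible P X G <->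
  forall i, ci X P [set i] [set` ~: (dsc G i :|: [set i]%SET)] [set` pa G i].
Proof.
rewrite /compatible /cond_indep.
have sub := coords_sub_alg mX.
by split => h i; have := h i; rewrite !subvecE -coords1 cond_indep_predicts// /ci coordsU.
Qed.

End CompatibleCi.

Section Rank.
Context (V : finType) (G : digraph V).

(** Injectivity makes the order total, so that vertices can be added one at a time. *)
Definition topological_rank (r : V -> nat) :=
  injective r /\ forall i j, G i j -> (r i < r j)%N.

(** Along an edge of a DAG the set of ancestors grows strictly. Its cardinal is scaled by the number
    of vertices, and the enumeration rank breaks ties without disturbing the order. *)
Lemma exists_rank : is_dag G -> exists r, topological_rank r.
Proof.
move=> dag; exists (fun v => (#|an G v| * #|V| + enum_rank v)%N); split.
  move=> u v /(congr1 (modn^~ #|V|)).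
  by rewrite !modnMDl !modn_small// => /ord_inj/enum_rank_inj.
move=> i j Gij.
have ij : (#|an G i| < #|an G j|)%N.
  apply: proper_card; apply/properP; split.
    apply/fintype.subsetP => k; rewrite !inE => /existsP[l /andP[Gkl cli]].
    apply/existsP; exists l; rewrite Gkl/=.
    by apply: connect_trans cli _; exact: connect1.
  exists i; last exact: dag.
  by rewrite inE; apply/existsP; exists j; rewrite Gij connect0.
apply: (@leq_trans (#|an G i| * #|V| + #|V|)); first by rewrite ltn_add2l.
by rewrite addnC -mulSn; apply: leq_trans (leq_addr _ _); rewrite leq_mul2r ij orbT.
Qed.

Lemma edge_dsc i j : G i j -> j \in dsc G i.
Proof. by move=> Gij; rewrite !inE; apply/existsP; exists j; rewrite Gij connect0. Qed.

Lemma dsc_edge i l k : G l k -> l \in dsc G i -> k \in dsc G i.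
Proof.
move=> Glk; rewrite !inE => /existsP[m /andP[Gim cml]].
apply/existsP; exists m; rewrite Gim/=; apply: connect_trans cml _; exact: connect1.
Qed.

Variables (r : V -> nat) (rk : topological_rank r).

Lemma dsc_rank i j : j \in dsc G i -> (r i < r j)%N.
Proof.
rewrite !inE => /existsP[k /andP[Gik /connectP[p pp ->]]].
apply: (leq_trans (rk.2 _ _ Gik)).
elim: p k pp {Gik} => //= l p IH k /andP[Gkl pp].
exact: leq_trans (ltnW (rk.2 _ _ Gkl)) (IH _ pp).
Qed.

(* The non-descendants of [i], as in the definition of compatibility. *)
Definition nd i : set V := [set` ~: (dsc G i :|: [set i]%SET)].

Lemma ndP i j : nd i j <-> (j \notin dsc G i) /\ j <> i.
Proof.
rewrite /nd /mkset !inE negb_or; split=> [/andP[-> /eqP]|[->]]//.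
by move=> /eqP ->.
Qed.

Lemma nd_rank i j : (r j < r i)%N -> nd i j.
Proof.
move=> ji; apply/ndP; split; last by move=> ij; rewrite ij ltnn in ji.
by apply/negP => /dsc_rank; rewrite ltnNge (ltnW ji).
Qed.

Lemma nd_pa i k l : nd i k -> l \in pa G k -> nd i l.
Proof.
move=> /ndP[ki ki']; rewrite inE => Glk; apply/ndP; split.
  by apply: contra ki; exact: dsc_edge.
by move=> li; rewrite li in Glk; move/negP: ki; apply; exact: edge_dsc.
Qed.

Lemma pa_rank i l : l \in pa G i -> (r l < r i)%N.
Proof. by rewrite inE; exact: rk.2. Qed.

Section LocalMarkov.
Context d (Om : measurableType d) (R : realType) (P : probability Om R).
Context (S : V -> ptopologicalType) (X : forall v, Om -> S v).
Hypothesis mX : forall i, measurable_fun setT (X i : Om -> borel (S i)).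

(* The ordered Markov property implies the local one: the non-descendants of [i]
   that come after [i] are added one at a time. *)
Lemma local_markov :
  (forall i, ci X P [set i] [set j | (r j < r i)%N] [set` pa G i]) ->
  forall i, ci X P [set i] (nd i) [set` pa G i].
Proof.
move=> om i.
pose B n := [set j | nd i j /\ ((r j < r i)%N \/ (r j < n)%N)].
have paB n : [set` pa G i] `<=` B n.
  by move=> j /= /pa_rank ji; split; [exact: nd_rank|left].
suff hB n : ci X P [set i] (B n) [set` pa G i].
  apply: (ci_weaken (hB (\max_j (r j)).+1)) => //.
  - by move=> j ij; left; split => //; right; rewrite ltnS; exact: leq_bigmax.
elim: n => [|n IH].
  apply: (ci_weaken (om i)) => //.
  - by move=> j [_ [ji|//]]; left.
have [[k [rkn ndk ki]]|nok] := pselect (exists k, [/\ r k = n, nd i k & (r i < r k)%N]);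
    last first.
  apply: (ci_weaken IH) => //.
  move=> j [ndj [ji|]]; first by left; split => //; left.
  rewrite ltnS leq_eqVlt => /orP[/eqP jn|jn]; last by left; split => //; right.
  left; split => //; left; rewrite ltnNge; apply/negP => ij; apply: nok.
  exists j; split => //; rewrite ltn_neqAle ij andbT.
  by apply/eqP => /rk.1 eij; move/ndP: ndj => [_ []].
have Bk j : B n j -> (r j < r k)%N.
  by move=> [_ [ji|]]; [exact: ltn_trans ki|rewrite rkn].
have pak : [set` pa G k] `<=` B n.
  move=> j /= jk; split; first exact: nd_pa jk.
  by right; rewrite -rkn; exact: pa_rank.
(* The ordered property is used at [k], not at [i]: both [i] and [B n] precede [k], and the parents
   of [k] lie in [B n]. *)
have hk : ci X P [set i] [set k] (B n).
  apply: ci_sym => //; apply: (ci_weaken (om k)) => //.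
  - by move=> j ->; left.
  - by move=> j /Bk; left.
apply: (ci_trans mX IH hk).
- by move=> j; left.
- by move=> j [Bj|/paB]; right.
- move=> j [[ndj [ji|]]|/paB]; [by right; split => //; left| |by right].
  rewrite ltnS leq_eqVlt => /orP[/eqP jn|jn]; last by right; split => //; right.
  by left; apply: rk.1; rewrite jn rkn.
Qed.

End LocalMarkov.
End Rank.

(** * Compatibility with the causal graph in ordered form *)

Section Two.
Context (I J : Type).

Definition two (A : set I) (B : set J) : set (I + J) :=
  fun a => match a with inl i => A i | inr j => B j end.

End Two.

Section Causal.
Context (V : finType) (G : digraph V) (r : V -> nat) (rk : topological_rank G r).

Definition before n : set V := [set j | (r j < n)%N].

(** The copy of a vertex comes immediately after it and before every later vertex, as the edges from
    i to i' require. *)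
Definition causal_rank (a : V + V) : nat :=
  match a with inl i => (r i).*2 | inr i => (r i).*2.+1 end.

Lemma causal_rankP : topological_rank (causal_graph G) causal_rank.
Proof.
split.
  move=> [i|i] [j|j] /=.
  - by move=> /double_inj/rk.1 ->.
  - by move=> /(congr1 odd); rewrite /= !odd_double.
  - by move=> /(congr1 odd); rewrite /= !odd_double.
  - by move=> [/double_inj/rk.1 ->].
move=> [i|i] [j|j] //=.
- by move=> /rk.2; rewrite ltn_double.
- by case/orP => [/rk.2|/eqP ->]; rewrite ltnS ?leq_double//; exact: ltnW.
- by move=> /rk.2; rewrite ltnS ltn_double.
Qed.

Lemma causal_dsc_inr i j : inl j \notin dsc (causal_graph G) (inr i).
Proof.
rewrite !inE; apply/negP => /existsP[[k|k] /andP[//= _ /connectP[p]]].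
elim: p k => //= -[l|l] p IH k //= /andP[_]; exact: IH.
Qed.

Section CausalCi.
Context d (Om : measurableType d) (R : realType) (P : probability Om R).
Context (X Y : V -> ptopologicalType).
Variable Z : forall a, Om -> pair_space X Y a.
Hypothesis mZ : forall a, measurable_fun setT (Z a : Om -> borel (pair_space X Y a)).
Hypothesis US : forall a, exists U : nat -> set (pair_space X Y a), countable_base U.

Lemma causal_compatibleI :
  (forall i, ci Z P [set inl i] (two (before (r i)) (before (r i))) (two [set` pa G i] set0)) ->
  (forall i, ci Z P [set inr i] (two (before (r i)) (before (r i)))
     (two ([set i] `|` [set` pa G i]) [set` pa G i])) ->
  compatible P Z (causal_graph G).
Proof.
move=> h1 h2; apply/compatibleP => //.
apply: (local_markov causal_rankP mZ) => -[i|i].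
- apply: (ci_weaken (h1 i)) => //.
  + move=> [j|j] /=; rewrite ?ltn_double ?ltnS.
      by left.
    by rewrite ltn_Sdouble; left.
  + by move=> [j|j] /=; rewrite ?inE.
  + by move=> [j|j] /=; rewrite inE//=; right; rewrite /= inE.
- apply: (ci_weaken (h2 i)) => //.
  + move=> [j|j] /=; rewrite ?ltnS ?ltn_double ?leq_double; last by left.
    rewrite leq_eqVlt => /orP[/eqP/rk.1 ->|]; last by left.
    by right; left.
  + by move=> [j|j] /=; rewrite ?inE//= => -[->|]; rewrite ?inE ?eqxx ?orbT// => ->.
  + move=> [j|j] /=; rewrite inE/=; last by right; rewrite /= inE.
    by case/orP => [h|/eqP ->]; right; [right; rewrite /= inE|left].
Qed.

(** For a copy i' more is obtained than the ordered property: no vertex of the first copy of [V]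
    descends from i', so its whole first component, future included, may stand on the other side. *)
Lemma causal_compatibleE : compatible P Z (causal_graph G) ->
  (forall i, ci Z P [set inl i] (two (before (r i)) (before (r i))) (two [set` pa G i] set0)) /\
  (forall i, ci Z P [set inr i] (two setT (before (r i)))
     (two ([set i] `|` [set` pa G i]) [set` pa G i])).
Proof.
move=> /(compatibleP P mZ US) h; split => i.
- apply: (ci_weaken (h (inl i))) => //.
  + move=> a ai; left; apply: (nd_rank causal_rankP).
    by case: a ai => j ji; rewrite /= ?ltn_Sdouble ?ltn_double.
  + by move=> [j|j] /=; rewrite ?inE.
  + move=> [j|j] //=; rewrite inE => Gji; right; rewrite /= inE//=.
- apply: (ci_weaken (h (inr i))) => //.
  + move=> [j|j] ji; left; apply/ndP.
      by split => //; exact: causal_dsc_inr.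
    by apply/(ndP (causal_graph G)); apply: (nd_rank causal_rankP); rewrite /= ltnS ltn_double.
  + by move=> [j|j] /=; rewrite ?inE//= => /orP[|/eqP ->]; rewrite ?inE ?eqxx; [right|left].
  + move=> [j|j] /=; last by rewrite inE => Gji; right; rewrite /= inE.
    move=> [->|]; last by rewrite inE => Gji; right; rewrite /= inE/= Gji.
    by right; rewrite /= inE/= eqxx orbT.
Qed.

End CausalCi.
End Causal.

(** * Noise outsourcing *)

Section Uniform.
Context (R : realType).
Local Open Scope ereal_scope.

Let measurable_idR : measurable_fun setT (id : measurableTypeR R -> R).
Proof. by []. Qed.

(** The uniform law on [0, 1], carried by the identity from [measurableTypeR R] to [R] itself. *)
Definition unif : probability R R := law (uniform_prob (@ltr01 R)) measurable_idR.

Lemma unif_lt (c : R) : (0 <= c <= 1)%R -> unif [set u | (u < c)%R] = c%:E.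
Proof.
move=> /andP[c0 c1].
have mc : measurable [set u : R | (u < c)%R] by exact: measurable_lt_set.
rewrite /unif lawE preimage_id.
have mc' : measurable ([set u : R | (u < c)%R] : set (measurableTypeR R)) by [].
transitivity (\int[lebesgue_measure]_(x in [set u : R | (u < c)%R])
    (uniform_pdf 0 1 x)%:E); first by [].
rewrite integral_uniform_pdf (eq_integral (cst 1)); last first.
  by move=> x; rewrite inE => -[_]; rewrite /= in_itv/= /uniform_pdf => ->; rewrite subr0 invr1.
rewrite integral_cst ?mul1e; last exact: measurableI.
rewrite (_ : _ `&` _ = [set` `[0%R, c[]).
  transitivity (lebesgue_measure ([set` `[0%R, c[] : set R)); first by [].
  rewrite lebesgue_measure_itv/= lte_fin; case: ltP => [|cle0]; first by rewrite sube0.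
  by congr EFin; apply/eqP; rewrite eq_le c0.
apply/seteqP; split => x /=; rewrite !in_itv/=.
  by move=> [xc /andP[-> _]].
by move=> /andP[-> xc]; rewrite xc (le_trans (ltW xc)).
Qed.

End Uniform.

Section NoiseReal.
Context d d' (Om : measurableType d) (W : measurableType d') (R : realType).
Context (P : probability Om R) (w : Om -> W) (s : Om -> R).
Hypotheses (mw : measurable_fun setT w) (ms : measurable_fun setT s).
Hypothesis s01 : forall o, 0 <= s o <= 1.
Local Open Scope ereal_scope.

(* [T w] is the quantile transform of the conditional law of [s] given [w]. *)
Lemma noise_real : exists T : W * R -> R, measurable_fun setT T /\
  forall D C, measurable D -> measurable C ->
  P (w @^-1` D `&` s @^-1` C) =
    \int[P]_(o in w @^-1` D) unif R [set u | C (T (w o, u))].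
Proof.
have mE t : measurable [set o | (s o < t)%R] by exact: measurable_lt_set.
have /choice[F FP] : forall t : R, exists f : W -> R,
    [/\ measurable_fun setT f, (forall x, (0 <= f x)%R) &
     forall D, measurable D ->
     P (w @^-1` D `&` [set o | (s o < t)%R]) = \int[P]_(o in w @^-1` D) (f (w o))%:E].
  move=> t; have [f [mf f0 fE]] := exists_condprob P mw (mE t).
  exists f; split => // D mD; have := fE (cst 1) D; rewrite /= integral_cst; last first.
    by apply: measurableI => //; exact: measurable_preimage.
  rewrite mul1e => <- //.
  by apply: eq_integral => o _; rewrite mul1e.
have mF t : measurable_fun setT (F t) by case: (FP t).
have F0 t x : (0 <= F t x)%R by case: (FP t).
have FE t D : measurable D -> P (w @^-1` D `&` [set o | (s o < t)%R]) =
    \int[P]_(o in w @^-1` D) (F t (w o))%:E by case: (FP t) => _ _; exact.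
(* [F q] is a version of the conditional probability that s is less than q. The quantile at u is the
   infimum of the rationals q with u < F q; clipping q to [0, 1], with default 1, keeps it in [0, 1]
   even where [F] fails to be a distribution function. *)
pose h (n : nat) (x : W * R) : R :=
  if (unpickle n : option rat) is Some q then
    if (x.2 < F (ratr q) x.1)%R then Num.min 1%R (Num.max 0%R (ratr q : R)) else 1%R else 1%R.
pose T (x : W * R) : R := inf (range (h ^~ x)).
have h0 n x : (0 <= h n x)%R.
  by rewrite /h; case: unpickle => // q; case: ifP => // _; rewrite le_min ler01 le_max lexx.
have Tlt x t : (T x < t)%R <-> exists n, (h n x < t)%R.
  split=> [|[n hn]].
    move=> /inf_lt; case=> [|_ [n _ <-] hn]; last by exists n.
    by exists (h 0%N x), 0%N.
  apply: le_lt_trans hn; apply: ge_inf; last by exists n.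
  by exists 0%R => _ [m _ <-]; exact: h0.
have mh n : measurable_fun setT (h n).
  rewrite /h; case: (unpickle n : option rat) => [q|]; last exact: measurable_cst.
  apply: measurable_fun_ifT => //.
  apply: measurable_fun_ltr => //; exact: measurableT_comp.
have mT : measurable_fun setT T.
  apply: (measurability (@RGenInftyO.G R)); first exact: RGenInftyO.measurableE.
  move=> _ [_ [t ->] <-]; rewrite setTI.
  rewrite (_ : _ @^-1` _ = \bigcup_n [set x | (h n x < t)%R]).
    by apply: bigcupT_measurable => n; exact: measurable_lt_set.
  apply/seteqP; split => x /=; rewrite in_itv/=.
    by move=> /Tlt[n hn]; exists n.
  by move=> [n _ hn]; apply/Tlt; exists n.
have Tray x t : (0 < t <= 1)%R -> (T x < t)%R <->
    exists q : rat, (ratr q < t)%R /\ (x.2 < F (ratr q) x.1)%R.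
  move=> /andP[t0 t1]; split.
    move=> /Tlt[n]; rewrite /h; case: (unpickle n : option rat) => [q|]; last first.
      by rewrite ltNge t1.
    case: ifP => [h1|_]; last by rewrite ltNge t1.
    by rewrite gt_min ltNge t1/= gt_max => /andP[_ qt]; exists q.
  move=> [q [qt xF]]; apply/Tlt; exists (pickle q); by rewrite /h pickleK xF gt_min gt_max t0 qt orbT.
have h1 n x : (h n x <= 1)%R.
  by rewrite /h; case: unpickle => // q; case: ifP => // _; rewrite ge_min lexx.
have T0 x : (0 <= T x)%R.
  by apply: lb_le_inf; [exists (h 0%N x), 0%N|move=> _ [n _ <-]; exact: h0].
have T1 x : (T x <= 1)%R.
  apply: (le_trans _ (h1 0%N x)); apply: ge_inf; last by exists 0%N.
  by exists 0%R => _ [m _ <-]; exact: h0.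
exists T; split => // D C mD.
have mD' : measurable (w @^-1` D) by exact: measurable_preimage.
pose mu : {finite_measure set Om -> \bar R} := mrestr P mD'.
pose g (x : Om * R) := T (w x.1, x.2).
have mg : measurable_fun setT g.
  apply: (measurableT_comp mT); apply/measurable_fun_pairP; split => //=.
  exact: (measurableT_comp mw).
have mgC C' : measurable C' -> measurable (g @^-1` C') by exact: measurable_preimage.
pose m1 : {measure set R -> \bar R} := pushforward mu s.
pose m2 : {measure set R -> \bar R} := pushforward (mu \x unif R) g.
have m2E C' : measurable C' ->
    m2 mg C' = \int[P]_(o in w @^-1` D) unif R [set u | C' (T (w o, u))].
  move=> mC'.
  transitivity (\int[mrestr P mD']_o (unif R \o xsection (g @^-1` C')) o); first by [].
  rewrite integral_mrestr//; last first.
    by apply: measurable_fun_xsection; exact: mgC.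
  rewrite setTI; apply: eq_integral => o _; congr (unif R _).
  by apply/seteqP; split => u /=; rewrite /xsection/= inE.
move=> mC; rewrite -m2E// setIC -[LHS]/(m1 ms C).
(* Both sides are measures in [C], so they need only be compared on the open left rays. *)
have gen : @measurable _ R = <<s @RGenInftyO.G R >> by exact: RGenInftyO.measurableE.
apply: (measure_unique (@RGenInftyO.G R) (fun n => [set` `]-oo, n%:R[])) => //.
- move=> _ _ [x ->] [y ->]; exists (Num.min x y).
  by apply/seteqP; split => z /=; rewrite !in_itv/= lt_min => /andP.
- by move=> n; exists n%:R.
- apply/seteqP; split => // x _; exists (Num.truncn `|x|).+1 => //=.
  rewrite in_itv/=; apply: (le_lt_trans (ler_norm _)).
  by have /andP[] := truncn_itv (normr_ge0 x).
- move=> _ [t ->]; rewrite m2E// -[LHS]/(P _).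
  rewrite (_ : s @^-1` _ = [set o | (s o < t)%R]); last first.
    by apply/seteqP; split => o /=; rewrite in_itv.
  under eq_integral => o _ do under eq_set => u do rewrite /= in_itv/=.
  rewrite setIC.
  have [t0|t0] := leP t 0%R.
    rewrite (_ : [set o | (s o < t)%R] = set0) ?setI0 ?measure0; last first.
      apply/seteqP; split => // o /= sot; have /andP[so0 _] := s01 o.
      by move: (le_lt_trans so0 sot); rewrite ltNge t0.
    rewrite integral0_eq// => o _.
    rewrite (_ : [set u | _] = set0) ?measure0//; apply/seteqP; split => // u /= Tt.
    by move: (le_lt_trans (T0 _) Tt); rewrite ltNge t0.
  have [t1|t1] := ltP 1%R t.
    rewrite (_ : [set o | (s o < t)%R] = setT) ?setIT; last first.
      apply/seteqP; split => // o _ /=; have /andP[_ so1] := s01 o.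
      exact: le_lt_trans t1.
    rewrite (eq_integral (cst 1)) ?integral_cst ?mul1e// => o _.
    rewrite (_ : [set u | _] = setT) ?probability_setT//; apply/seteqP; split => // u _ /=.
    exact: le_lt_trans t1.
  have t01 : (0 < t <= 1)%R by rewrite t0.
  have mFw r : measurable_fun setT (F r \o w) by exact: measurableT_comp.
  have smw : sub_alg (pre w measurable).
    by apply: pre_sub_alg => //; split => //; exact: sigma_algebra_measurable.
  have sFw r : sig_fun (pre w measurable) (F r \o w).
    by move=> B mB; rewrite comp_preimage; apply: preP; exact: measurable_preimage.
  (* Used with the constant 1 and with [F t]: almost surely [F] is at most 1 and nondecreasing along
     the rationals below t. *)
  have Fle r (k : W -> R) : sig_fun (pre w measurable) (k \o w) ->
      (forall x, 0 <= k x)%R -> P.-integrable setT (EFin \o (k \o w)) ->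
      (forall D', measurable D' -> P (w @^-1` D' `&` [set o | (s o < r)%R]) <=
        \int[P]_(o in w @^-1` D') (k (w o))%:E) ->
      {ae P, forall o, (F r (w o) <= k (w o))%R}.
    move=> sk k0 ik kE.
    apply: (condexp_le (f := F r \o w) (g := k \o w) smw) => //.
    - by move=> o; exact: F0.
    - by move=> o; exact: k0.
    - apply: (condprob_integrable (G := pre w measurable) _ _ _ _ (mE r)) => //.
      + exact: sub_algT.
      + by move=> o; exact: F0.
      + by move=> _ [D' mDD <-]; rewrite setTI setIC FE.
    - by move=> _ [D' mDD <-]; rewrite setTI -FE//; exact: kE.
  have Fi r : P.-integrable setT (EFin \o (F r \o w)).
    apply: (condprob_integrable (G := pre w measurable) _ _ _ _ (mE r)) => //.
    + exact: sub_algT.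
    + by move=> o; exact: F0.
    + by move=> _ [D' mDD <-]; rewrite setTI setIC FE.
  have mTt o : measurable [set u | (T (w o, u) < t)%R].
    apply: measurable_lt_set => //; apply: measurableT_comp => //.
  have mUT : measurable_fun (w @^-1` D) (fun o => unif R [set u | (T (w o, u) < t)%R]).
    apply: measurable_funTS.
    have mA : measurable (g @^-1` [set x | (x < t)%R]).
      by apply: mgC; exact: measurable_lt_set.
    rewrite [X in measurable_fun _ X](_ : _ = unif R \o xsection (g @^-1` [set x | (x < t)%R])).
      exact: measurable_fun_xsection.
    apply/funext => o /=; congr (unif R _).
    by apply/seteqP; split => u /=; rewrite /xsection/= inE.
  apply/eqP; rewrite eq_le; apply/andP; split.
    (* For q < t, every u below F q gives a quantile below t; the bound for t follows by letting q
       increase to t. *)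
    have low (q : rat) : (ratr q < t)%R -> P (w @^-1` D `&` [set o | (s o < ratr q)%R]) <=
        \int[P]_(o in w @^-1` D) unif R [set u | (T (w o, u) < t)%R].
      move=> qt; rewrite FE//; apply: ae_ge0_le_integral => //.
      + by move=> o _; rewrite lee_fin.
      + apply/measurable_EFinP; exact: (measurable_funTS (mFw _)).
      + have := Fle (ratr q) (cst 1%R) _ _ _ _.
        have s1 : sig_fun (pre w measurable) (cst 1%R \o w : Om -> R).
          move=> B mB; rewrite comp_preimage; apply: preP.
          by rewrite -[_ @^-1` _]setTI; exact: measurable_cst.
        move=> /(_ s1) h'; apply: filterS (h' _ _ _) => //.
        * move=> o /= F1 _; rewrite -(@unif_lt R (F (ratr q) (w o))) ?F0//.
          apply: le_measure; rewrite ?inE//; first exact: measurable_lt_set.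
          by move=> u /= uF; apply/(Tray _ _ t01); exists q.
        * exact: finite_measure_integrable_cst.
        * move=> D' mDD'; rewrite [leRHS](_ : _ = \int[P]_(o in w @^-1` D') cst 1 o)//.
          rewrite integral_cst ?mul1e; last exact: measurable_preimage.
          apply: le_measure; rewrite ?inE//; last exact: measurable_preimage.
          by apply: measurableI => //; exact: measurable_preimage.
    pose A (k : nat) := w @^-1` D `&` [set o | (s o < t - k.+1%:R^-1)%R].
    have mA k : measurable (A k) by exact: measurableI.
    have -> : w @^-1` D `&` [set o | (s o < t)%R] = \bigcup_k A k.
      rewrite -setI_bigcupr; congr setI; apply/seteqP; split => o /=.
        rewrite -subr_gt0 => st.
        have /cvgrPdist_lt/(_ _ st)[m _ /(_ m (leqnn m))] := @cvg_harmonic R.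
        rewrite /= sub0r normrN ger0_norm ?invr_ge0// ltrBrDr -ltrBrDl => mst.
        by exists m.
      by move=> [k _ /=] /lt_le_trans; apply; rewrite gerBl invr_ge0.
    have /cvg_lim <- // : P (A k) @[k --> \oo] --> P (\bigcup_k A k).
      apply: nondecreasing_cvg_mu => //; first exact: bigcupT_measurable.
      move=> k l kl; apply/subsetPset; apply: setIS => o /= /lt_le_trans; apply.
      by rewrite lerB// lef_pV2 ?posrE// ler_nat.
    apply: lime_le.
      apply: ereal_nondecreasing_is_cvgn => k l kl.
      apply: le_measure; rewrite ?inE//.
      apply: setIS => o /= /lt_le_trans; apply.
      by rewrite lerB// lef_pV2 ?posrE// ler_nat.
    apply: nearW => k.
    have [q _ /andP[kq qt]] : exists2 q : rat, true & (t - k.+1%:R^-1 < ratr q < t)%R.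
      have [q] := @rat_in_itvoo R (t - k.+1%:R^-1)%R t (ltac:(by rewrite gtrBl invr_gt0)).
      by rewrite in_itv/= => h'; exists q.
    apply: le_trans (low q qt); apply: le_measure; rewrite ?inE//; first exact: measurableI.
    by apply: setIS => o /= /lt_trans; apply.
  rewrite FE//; apply: ae_ge0_le_integral => //.
  + by move=> o _; rewrite lee_fin.
  + apply/measurable_EFinP; exact: (measurable_funTS (mFw _)).
  (* Conversely, where F q is at most F t for all rationals q < t, a quantile below t forces u < F
     t. *)
  + have : {ae P, forall o, forall n : nat,
        if (unpickle n : option rat) is Some q then (ratr q < t)%R -> (F (ratr q) (w o) <= F t (w o))%R else True}.
      apply: ae_foralln => n; case: (unpickle n : option rat) => [q|]; last exact: aeW.
      have [qt|qt] := ltP (ratr q) t; last exact: aeW.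
      have := Fle (ratr q) (F t) (sFw t) (F0 t) (Fi t) _; move=> h'.
      apply: filterS (h' _) => [//|D' mDD']; rewrite -FE//.
      apply: le_measure; rewrite ?inE.
      * by apply: measurableI => //; exact: measurable_preimage.
      * by apply: measurableI => //; exact: measurable_preimage.
      * by apply: setIS => o /= /lt_trans; apply.
    apply: filterS => o ho _.
    apply: (@le_trans _ _ (unif R [set u | (u < F t (w o))%R])).
      apply: le_measure; rewrite ?inE//.
        exact: measurable_lt_set.
      move=> u /= /(Tray _ _ t01)[q [qt uF]].
      have := ho (pickle q); rewrite pickleK => /(_ qt).
      exact: lt_le_trans.
    have [F1|F1] := leP (F t (w o)) 1%R; first by rewrite unif_lt// F0.
    apply: (@le_trans _ _ 1); first exact: probability_le1 (measurable_lt_set _ _).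
    by rewrite lee_fin ltW.
- move=> n; apply: (@le_lt_trans _ _ 1); last exact: ltry.
  by apply: probability_le1; apply: measurableI => //; exact: measurable_preimage.
Qed.

End NoiseReal.

(** * Coding of bit sequences by real numbers *)

Section Ternary.
Variable R : realType.
Implicit Types (b : nat -> bool).

(** Base 3 with the digits 0 and 2 only, as in the Cantor set, so that the digits can be read back
    without ambiguity. *)
Fixpoint ternary_sum n b : R :=
  if n is m.+1 then (2 * (b 0%N)%:R + ternary_sum m (b \o S)) / 3 else 0.

Lemma ternary_sum_ge0 n b : 0 <= ternary_sum n b.
Proof.
elim: n b => //= n IH b; rewrite divr_ge0//.
by have := IH (b \o S); case: (b 0%N) => /=; lra.
Qed.

Lemma ternary_sum_le1 n b : ternary_sum n b <= 1.
Proof.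
elim: n b => //= n IH b; rewrite ler_pdivrMr// mul1r.
by have := IH (b \o S); case: (b 0%N) => /=; lra.
Qed.

Lemma ternary_sum_nd b : nondecreasing_seq (ternary_sum ^~ b).
Proof.
apply/nondecreasing_seqP => n; elim: n b => [|n IH] b.
  exact: (ternary_sum_ge0 1 b).
rewrite -[leLHS]/((2 * (b 0%N)%:R + ternary_sum n (b \o S)) / 3).
rewrite -[leRHS]/((2 * (b 0%N)%:R + ternary_sum n.+1 (b \o S)) / 3).
by rewrite ler_pM2r ?invr_gt0// lerD2l.
Qed.

Lemma ternary_cvg b : cvgn (ternary_sum ^~ b).
Proof.
apply: nondecreasing_is_cvgn; first exact: ternary_sum_nd.
by exists 1 => _ [n _ <-]; exact: ternary_sum_le1.
Qed.

Definition ternary b : R := limn (ternary_sum ^~ b).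

Lemma ternary01 b : 0 <= ternary b <= 1.
Proof.
apply/andP; split.
  by apply: limr_ge; [exact: ternary_cvg|apply: nearW => n; exact: ternary_sum_ge0].
by apply: limr_le; [exact: ternary_cvg|apply: nearW => n; exact: ternary_sum_le1].
Qed.

Lemma ternaryS b : ternary b = (2 * (b 0%N)%:R + ternary (b \o S)) / 3.
Proof.
apply: cvg_lim => //; rewrite -cvg_shiftS/=.
by apply: cvgMr_tmp; apply: cvgD; [exact: cvg_cst|exact: ternary_cvg].
Qed.

(** Deletes the leading digit of a Cantor number; the threshold 1/2 lies in the gap between 1/3 and
    2/3. *)
Definition ternary_shift (x : R) : R := 3 * x - (if 1 / 2 <= x then 2 else 0).

Definition ternary_digit n (x : R) : bool := 1 / 2 <= iter n ternary_shift x.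

Lemma ternary_digitK n b : ternary_digit n (ternary b) = b n.
Proof.
have b0 c : (1 / 2 <= ternary c) = c 0%N.
  have := ternary01 (c \o S); rewrite [ternary c]ternaryS.
  by case: (c 0%N) => /= h; apply/idP; lra.
rewrite /ternary_digit; elim: n b => [|n IH] b; first exact: b0.
rewrite iterSr (_ : ternary_shift _ = ternary (b \o S)) ?IH//.
by rewrite /ternary_shift b0 [in LHS]ternaryS; case: (b 0%N) => /=; field.
Qed.

Lemma measurable_ternary_digit n : measurable [set x | ternary_digit n x].
Proof.
have mi : measurable_fun setT (iter n ternary_shift).
  elim: n => [|n IH]; first exact: measurable_id.
  rewrite [X in measurable_fun _ X](_ : _ = ternary_shift \o iter n ternary_shift)//.
  apply: measurableT_comp => //; apply: measurable_funB; first exact: measurable_funM.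
  by apply: measurable_fun_ifT => //; exact: measurable_fun_ler.
rewrite (_ : [set x | _] = (fun x => 1 / 2 <= iter n ternary_shift x) @^-1` [set true]).
  by apply: measurable_preimage => //; exact: measurable_fun_ler.
by apply/seteqP; split.
Qed.

Lemma measurable_ternary d (T : measurableType d) (b : nat -> set T) :
  (forall n, measurable (b n)) ->
  measurable_fun setT (fun x => ternary (fun n => x \in b n)).
Proof.
move=> mb; apply: (@measurable_fun_cvg _ _ _ _ (fun n x => ternary_sum n (fun n => x \in b n))).
  move=> n; elim: n b mb => [|n IH] b mb; first exact: measurable_cst.
  apply: measurable_funM => //; apply: measurable_funD.
    apply: measurable_funM => //.
    rewrite [X in measurable_fun _ X](_ : _ = \1_(b 0%N))//.
  exact: (IH (b \o S) (fun n => mb n.+1)).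
move=> x _; exact: ternary_cvg.
Qed.
End Ternary.

Lemma measurable_countable_base (T : ptopologicalType) (U : nat -> set T)
    d (D : measurableType d) (f : D -> T) : countable_base U ->
  (forall n, measurable (f @^-1` U n)) ->
  measurable_fun setT (f : D -> borel T).
Proof.
move=> [oU bU] mf.
apply: (@measurability _ _ _ (borel T) _ _ (@open T)) => // _ [W oW <-].
rewrite setTI (_ : W = \bigcup_(n in [set n | U n `<=` W]) U n).
  by rewrite preimage_bigcup bigcup_mkcond; apply: bigcupT_measurable => n; case: ifP.
apply/seteqP; split => x; last by move=> [n nW /nW].
by move=> /(bU _ _ oW)[n [Ux UW]]; exists n.
Qed.

(** * Polish spaces as measurable retracts of the real line *)

Section Standard.
Variable R : realType.

(* [T] is a measurable retract of the real line. *)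
Definition standard (T : ptopologicalType) :=
  exists (s : borel T -> R) (psi : R -> borel T),
    [/\ measurable_fun setT s,
        (forall x, ternary R (fun n => ternary_digit n (s x)) = s x),
        measurable_fun setT psi & forall x, psi (s x) = x].

Section MetricStandard.
Context (T : ptopologicalType) (e : T -> T -> R) (ce : complete_metric e).
Context (q : nat -> T) (qd : forall x r, 0 < r -> exists n, e x (q n) < r).

Let e0 x y : 0 <= e x y. Proof. by case: ce => -[]. Qed.
Let e_eq x y : e x y = 0 -> x = y. Proof. by case: ce => -[_ h _ _] _ _ /h. Qed.
Let eC x y : e x y = e y x. Proof. by case: ce => -[]. Qed.
Let eD x y z : e x z <= e x y + e y z. Proof. by case: ce => -[]. Qed.

Let rad (m : nat) : R := m.+1%:R^-1.
Let rad_gt0 m : 0 < rad m. Proof. by rewrite invr_gt0. Qed.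
Let rad_le m n : (m <= n)%N -> rad n <= rad m.
Proof. by move=> mn; rewrite lef_pV2 ?posrE// ler_nat. Qed.
Let rad_lt r : 0 < r -> exists m, rad m < r.
Proof.
move=> r0; have /cvgrPdist_lt/(_ _ r0)[m _ /(_ m (leqnn m))] := @cvg_harmonic R.
by rewrite /= sub0r normrN ger0_norm ?invr_ge0//; exists m.
Qed.

(* The digit of index [(k, m)] tells whether the point is within [rad m] of [q k]. *)
Let near (n : nat) : set (borel T) :=
  if (unpickle n : option (nat * nat)) is Some (k, m)
  then [set x | e x (q k) < rad m] else set0.

Let dig (x : R) (k m : nat) := ternary_digit (pickle (k, m)) x.
(** The first dense point that the code [x] places within [rad m], with default 0; [psi] sends the
    code to the limit of these points as m grows. *)
Let idx (x : R) m : nat :=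
  if pselect (exists k, dig x k m) is left h then ex_minn h else 0%N.
(** True of the code of a point, where the approximations at scales m and n are within
    [rad m + rad n] of each other. Other reals are sent to the default point. *)
Let cauchy (x : R) := forall m n, (m <= n)%N -> e (q (idx x m)) (q (idx x n)) <= 2 * rad m.
Let psi (x : R) : T :=
  if pselect (cauchy x) is left _ then
    xget point [set l | forall m, e (q (idx x m)) l <= 2 * rad m] else point.

Let psiP x : cauchy x -> forall m, e (q (idx x m)) (psi x) <= 2 * rad m.
Proof.
move=> cx; rewrite /psi; case: pselect => // _.
case: xgetP => [l -> //|]; case: ce => _ nb comp.
have [|l ul] := comp (fun m => q (idx x m)).
  move=> r r0; have [N Nr] := rad_lt (divr_gt0 r0 (ltr0n R 4)).
  exists N => m n Nm Nn; apply: le_lt_trans (eD _ (q (idx x N)) _) _.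
  rewrite eC; have := cx _ _ Nm; have := cx _ _ Nn; move: Nr.
  by rewrite ltr_pdivlMr//; lra.
move=> /(_ l); case => m; apply/ler_addgt0Pr => r r0.
have nl : nbhs l [set y | e l y < r] by rewrite nb; exists r.
have [N _ hN] := ul _ nl.
have := cx m (maxn m N) (leq_maxl _ _).
have /= := hN (maxn m N) (leq_maxr _ _).
have := eD (q (idx x m)) (q (idx x (maxn m N))) l.
by rewrite [e l _]eC; lra.
Qed.

Let measurable_dig k m : measurable [set x | dig x k m].
Proof. exact: measurable_ternary_digit. Qed.

Let idxE x m k : idx x m = k <->
  (dig x k m /\ forall j, (j < k)%N -> ~ dig x j m) \/ (k = 0%N /\ forall j, ~ dig x j m).
Proof.
rewrite /idx; case: pselect => [h|h].
  case: ex_minnP => j dj jmin; split.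
    move=> <-; left; split => // i ij di; have := jmin _ di.
    by rewrite leqNgt ij.
  move=> [[dk kmin]|[_ nd]]; last by case: (nd _ dj).
  apply/eqP; rewrite eqn_leq jmin//= leqNgt; apply/negP => jk.
  exact: kmin dj.
split.
  by move=> <-; right; split => // j dj; apply: h; exists j.
move=> [[dk _]|[-> //]]; by case: h; exists k.
Qed.

Let measurable_idx m k : measurable [set x | idx x m = k].
Proof.
have mn j : measurable [set x | ~ dig x j m] by exact: measurableC (measurable_dig _ _).
rewrite (_ : [set _ | _] = ([set x | dig x k m] `&` \bigcap_j [set x | (j < k)%N -> ~ dig x j m])
   `|` ((if k == 0%N then setT else set0) `&` \bigcap_j [set x | ~ dig x j m])).
  apply: measurableU; apply: measurableI => //.
  - apply: bigcapT_measurable => j; case: (ltnP j k) => jk.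
      by rewrite (_ : [set _ | _] = [set x | ~ dig x j m]) //;
        apply/seteqP; split => x /= h; [exact: h|move=> _].
    by rewrite (_ : [set _ | _] = setT)//; apply/seteqP; split.
  - by case: ifP.
  - exact: bigcapT_measurable.
apply/seteqP; split => x.
  move=> /idxE[[dk kmin]|[-> nd]]; first by left; split => // j _ /=; exact: kmin.
  by right; split => // j _; exact: nd.
move=> /= [[dk kmin]|[k0 nd]]; apply/idxE; [left; split => // j; exact: kmin|right].
by move: k0; case: eqP => // -> _; split => // j; exact: nd.
Qed.

Let measurable_idx_set m (A : set nat) : measurable [set x | A (idx x m)].
Proof.
rewrite (_ : [set _ | _] = \bigcup_(k in A) [set x | idx x m = k]).
  exact: bigcup_measurable.
by apply/seteqP; split => x /= => [Ax|[k Ak ->//]]; exists (idx x m).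
Qed.

Let measurable_cauchy : measurable [set x | cauchy x].
Proof.
rewrite (_ : [set _ | _] = \bigcap_m \bigcap_n \bigcup_k
   ([set x | idx x m = k] `&` [set x | (m <= n)%N -> e (q k) (q (idx x n)) <= 2 * rad m])).
  apply: bigcapT_measurable => m; apply: bigcapT_measurable => n.
  apply: bigcupT_measurable => k; apply: measurableI => //.
  exact: (measurable_idx_set n [set j | (m <= n)%N -> e (q k) (q j) <= 2 * rad m]).
apply/seteqP; split => x /= cx.
  by move=> m _ n _; exists (idx x m) => //; split => //= mn; exact: cx.
move=> m n mn; have [k _ [/= <-]] := cx m I n I; exact.
Qed.

(** On Cauchy codes, membership in the ball is certified by some approximation whose distance to [y]
    plus the error [2 * rad m] is below [r], a condition on one index only. *)
Let measurable_psi_ball y r : measurable (psi @^-1` [set z | e y z < r]).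
Proof.
rewrite (_ : _ @^-1` _ =
   ([set x | cauchy x] `&` \bigcup_m [set x | e y (q (idx x m)) + 2 * rad m < r])
   `|` (~` [set x | cauchy x] `&` (if e y point < r then setT else set0))).
  apply: measurableU; apply: measurableI => //.
  - apply: bigcupT_measurable => m.
    exact: (measurable_idx_set m [set j | e y (q j) + 2 * rad m < r]).
  - exact: measurableC.
  - by case: ifP.
apply/seteqP; split => x /=.
  have [cx|ncx] := pselect (cauchy x).
    move=> yr; left; split => //.
    (* A quarter of the gap, as the error [2 * rad m] is paid twice. *)
    have [m mr] := rad_lt (divr_gt0 (ltac:(by rewrite subr_gt0) : 0 < r - e y (psi x)) (ltr0n R 4)).
    exists m => //=; have := eD y (psi x) (q (idx x m)).
    rewrite [e (psi x) _]eC; have := psiP cx m; move: mr.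
    by rewrite ltr_pdivlMr//; lra.
  by move=> yr; right; split => //; move: yr; rewrite /psi; case: pselect => // _ ->.
move=> [[cx [m _ /= h]]|[ncx]].
  have := eD y (q (idx x m)) (psi x); have := psiP cx m; lra.
by rewrite /psi; case: pselect => // _; case: ifP.
Qed.

Let code (z : borel T) : R := ternary R (fun n => z \in near n).

Let dig_code z k m : dig (code z) k m = (e z (q k) < rad m).
Proof. by rewrite /dig /code ternary_digitK /near pickleK; apply/idP/idP; rewrite inE. Qed.

Let idx_code z m : e z (q (idx (code z) m)) < rad m.
Proof.
have [k zk] := qd z (rad_gt0 m).
have := erefl (idx (code z) m); move=> /idxE[[]|[_ /(_ k)]].
  by rewrite dig_code.
by rewrite dig_code zk.
Qed.

(** The code of z records all comparisons of the distance from z to [q k] with [rad m]; the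
    approximations read off from it lie within [rad m] of z, so their limit is z. *)
Lemma metric_standard : standard T.
Proof.
exists code, psi; split.
- apply: measurable_ternary => n; rewrite /near; case: unpickle => [[k m]|] //.
  apply: sub_sigma_algebra.
  rewrite (_ : [set _ | _] = [set x | e (q k) x < rad m]); first exact: open_metric_ball.
  by apply/seteqP; split => x /=; rewrite eC.
- by move=> x; congr ternary; apply/funext => n; rewrite /code ternary_digitK.
- apply: (measurable_countable_base (metric_countable_base ce qd)) => n.
  rewrite /metric_base; case: unpickle => [[k m]|]; first exact: measurable_psi_ball.
  by rewrite preimage_set0.
- move=> z.
  have cz : cauchy (code z).
    move=> m n mn; have := eD (q (idx (code z) m)) z (q (idx (code z) n)).
    rewrite [e _ z]eC; have := idx_code z m; have := idx_code z n; have := rad_le mn; lra.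
  apply/esym/e_eq/eqP; rewrite eq_le e0 andbT; apply/ler_addgt0Pr => r r0; rewrite add0r.
  have [m mr] := rad_lt (divr_gt0 r0 (ltr0n R 4)).
  have := eD z (q (idx (code z) m)) (psi (code z)).
  have := psiP cz m; have := idx_code z m; move: mr; rewrite ltr_pdivlMr//; lra.
Qed.

End MetricStandard.

Lemma polish_standard (T : ptopologicalType) : polish R T -> standard T.
Proof.
move=> [[D cD dD] [e ce]]; have [q qd] := dense_seq ce cD dD.
exact: metric_standard qd.
Qed.

(** The ternary digits of the coordinates are interleaved; decoding is possible because each
    coordinate code is determined by its digits. *)
Lemma standard_prod (I : finType) (S : I -> ptopologicalType) :
  (forall i, exists U : nat -> set (S i), countable_base U) ->
  (forall i, standard (S i)) -> standard (prod_space S).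
Proof.
move=> US St.
pose s i := sval (cid (St i)); pose psi i := sval (cid (svalP (cid (St i)))).
have sP i : [/\ measurable_fun setT (s i),
    (forall x, ternary R (fun n => ternary_digit n (s i x)) = s i x),
    measurable_fun setT (psi i) & forall x, psi i (s i x) = x].
  exact: svalP (cid (svalP (cid (St i)))).
pose bit (n : nat) : set (borel (prod_space S)) :=
  if (unpickle n : option (I * nat)) is Some (i, k)
  then [set x | ternary_digit k (s i (x i))] else set0.
exists (fun x => ternary R (fun n => x \in bit n)).
exists (fun t i => psi i (ternary R (fun k => ternary_digit (pickle (i, k)) t))).
split.
- apply: measurable_ternary => n; rewrite /bit; case: unpickle => [[i k]|] //.
  have [ms _ _ _] := sP i.
  have mm : measurable_fun setT (s i \o (fun x : borel (prod_space S) => x i)).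
    by apply: measurableT_comp => //; exact: measurable_coord.
  by apply: (measurable_preimage mm (A := [set y | ternary_digit k y])); exact: measurable_ternary_digit.
- by move=> x; congr ternary; apply/funext => n; rewrite ternary_digitK.
- apply: measurable_to_prod => // i; have [_ _ mpsi _] := sP i.
  apply: (measurableT_comp mpsi).
  rewrite [X in measurable_fun _ X](_ : _ = fun t => ternary R (fun k =>
      t \in [set t | ternary_digit (pickle (i, k)) t])).
    by apply: measurable_ternary => k; exact: measurable_ternary_digit.
  apply/funext => t; congr ternary; apply/funext => k.
  by apply/idP/idP; rewrite inE.
- move=> x; apply: functional_extensionality_dep => i.
  have [_ sT _ psiK] := sP i.
  rewrite -[RHS]psiK -sT; congr psi; congr ternary; apply/funext => k.
  by rewrite ternary_digitK /bit pickleK; apply/idP/idP; rewrite inE.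
Qed.

End Standard.

(** * Kernels driven by a uniform noise *)

Section Noise.
Context d (Om : measurableType d) (R : realType) (P : probability Om R).
Context (Z : ptopologicalType) (sZ : standard R Z).
Local Open Scope ereal_scope.

Lemma noise_standard d' (W : measurableType d') (w : Om -> W) (z : Om -> borel Z) :
  measurable_fun setT w -> measurable_fun setT z ->
  exists T : W * R -> borel Z, measurable_fun setT T /\
  forall D C, measurable D -> measurable C ->
  P (w @^-1` D `&` z @^-1` C) =
    \int[P]_(o in w @^-1` D) unif R [set u | C (T (w o, u))].
Proof.
move=> mw mz; have [s [psi [ms sT mpsi psiK]]] := sZ.
have [|T [mT TP]] := @noise_real _ _ _ _ _ P w (s \o z) mw (measurableT_comp ms mz).
  by move=> o /=; rewrite -sT; exact: ternary01.
exists (psi \o T); split; first exact: measurableT_comp.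
move=> D C mD mC; have mC' := measurable_preimage mpsi mC.
rewrite -(TP D (psi @^-1` C))//; congr (P _); congr setI.
by apply/seteqP; split => o /=; rewrite psiK.
Qed.

(* [T] is a kernel: the law of [T (o, u)] for a uniform [u]. *)
Definition kern (T : Om * R -> borel Z) (C : set (borel Z)) (o : Om) : R :=
  fine (unif R [set u | C (T (o, u))]).

(** Joint measurability with [F] on the first factor: the kernel uses no more of the point than the
    information in [F]. *)
Definition sub_noise F (T : Om * R -> borel Z) :=
  measurable_fun (setT : set (g_sigma_algebraType F * R)%type) (T : g_sigma_algebraType F * R -> borel Z).

Lemma noise_sub F (z : Om -> borel Z) : sub_alg F -> measurable_fun setT z ->
  exists T : Om * R -> borel Z, sub_noise F T /\
  forall D C, F D -> measurable C ->
    P (D `&` z @^-1` C) = \int[P]_(o in D) (kern T C o)%:E.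
Proof.
move=> sF mz; have [T [mT TP]] := noise_standard (sub_alg_id sF) mz.
exists T; split => // D C FD mC.
have := TP D C; rewrite (measurable_sub_alg sF) preimage_id => -> //.
apply: eq_integral => o _; rewrite /kern fineK// fin_num_measure//.
rewrite (_ : [set u | _] = xsection (T @^-1` C) o).
  by apply: measurable_xsection; exact: measurable_preimage.
by apply/seteqP; split => u /=; rewrite /xsection/= inE.
Qed.

End Noise.

Section Kernels.
Context d (Om : measurableType d) (R : realType).
Context (Z : ptopologicalType).
Implicit Types (P : probability Om R) (F G : set (set Om)) (T : Om * R -> borel Z).
Local Open Scope ereal_scope.

Lemma sub_noise_kern F T C : sub_alg F -> sub_noise F T -> measurable C ->
  sig_fun F (kern T C) /\ forall o, measurable [set u | C (T (o, u))].
Proof.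
move=> sF mT mC.
have mTC : measurable (T @^-1` C : set (g_sigma_algebraType F * R)) by exact: measurable_preimage.
have E o : [set u | C (T (o, u))] = xsection (T @^-1` C) o.
  by apply/seteqP; split => u /=; rewrite /xsection/= inE.
split; last by move=> o; rewrite E; exact: (@measurable_xsection _ _ (g_sigma_algebraType F) _ _ _ mTC).
apply/(measurable_fun_sub_alg _ sF).
apply: measurableT_comp => //.
rewrite [X in measurable_fun _ X](_ : _ = (unif R \o xsection (T @^-1` C))).
  exact: (@measurable_fun_xsection _ _ (g_sigma_algebraType F) R R (unif R) _ mTC).
by apply/funext => o; rewrite /= E.
Qed.

Lemma kern_ge0 T C o : (0 <= kern T C o)%R.
Proof. exact: fine_ge0. Qed.

Lemma kernE F T C o : sub_alg F -> sub_noise F T -> measurable C ->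
  (kern T C o)%:E = unif R [set u | C (T (o, u))].
Proof.
by move=> sF mT mC; rewrite /kern fineK// fin_num_measure//; have [_] := sub_noise_kern sF mT mC.
Qed.

Lemma sub_noise_measurable F T : sub_alg F -> sub_noise F T -> measurable_fun setT T.
Proof.
move=> sF mT.
have mid : measurable_fun setT ((fun z => (z.1, z.2)) : Om * R -> g_sigma_algebraType F * R).
  apply/measurable_fun_pairP; split => //=.
  by apply: (measurableT_comp (sub_alg_id sF)).
have := measurableT_comp mT mid; congr measurable_fun.
by apply/funext => -[].
Qed.

(** The sets that do not separate two points form a sigma-algebra, and it contains the
    generators. *)
Lemma coords_agree I (S : I -> ptopologicalType) (X : forall i, Om -> S i) A D o o' :
  coords X A D -> (forall i, A i -> X i o = X i o') -> D o -> D o'.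
Proof.
move=> cD Xoo'; suff [] : D o <-> D o' by [].
move: D cD; apply: (@smallest_sub _ _ _ [set D | D o <-> D o']).
  split; first by [].
    move=> D; rewrite /mkset => h; split => -[_ nD]; split => // Do; apply: nD.
      exact/h. exact/h.
  by move=> D h; split => -[n _ Dn]; exists n => //; apply/h.
by move=> _ [i [B [Ai mB ->]]]; rewrite /mkset /preimage/= Xoo'.
Qed.

(** Real singletons are measurable, so the fibres of s composed with T at fixed noise belong to
    [coords X A] and cannot separate the two points; the retraction then removes s. *)
Lemma sub_noise_agree I (S : I -> ptopologicalType) (X : forall i, Om -> S i) A T o o' u :
  (forall i, measurable_fun setT (X i : Om -> borel (S i))) ->
  standard R Z -> sub_noise (coords X A) T ->
  (forall i, A i -> X i o = X i o') -> T (o, u) = T (o', u).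
Proof.
move=> mX [s [psi [ms _ _ psiK]]] mT Xoo'.
rewrite -[LHS]psiK -[RHS]psiK; congr psi.
have sA := coords_sub_alg mX A.
have := @coords_agree _ S X A [set o2 | s (T (o2, u)) = s (T (o, u))] o o'.
move=> /(_ _ Xoo' erefl) -> //.
have msT : measurable_fun setT (s \o T : g_sigma_algebraType (coords X A) * R -> R).
  exact: measurableT_comp.
have := measurable_preimage (measurable_fun_pair1 u msT) (measurable_set1 (s (T (o, u)))).
by rewrite (measurable_sub_alg sA).
Qed.

Lemma integral_eq_sub P1 P2 F (f : Om -> R) D : sub_alg F -> sig_fun F f ->
  (forall o, 0 <= f o)%R -> F D -> (forall E, F E -> P1 E = P2 E) ->
  \int[P1]_(o in D) (f o)%:E = \int[P2]_(o in D) (f o)%:E.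
Proof.
move=> sF mf f0 FD P12.
have mid := sub_alg_id sF.
have mD : measurable (D : set (g_sigma_algebraType F)) by rewrite (measurable_sub_alg sF).
have mef : measurable_fun (D : set (g_sigma_algebraType F)) (EFin \o f).
  by apply: measurable_funTS; apply/measurable_EFinP/measurable_fun_sub_alg.
have e0 o : 0 <= (f o)%:E by rewrite lee_fin.
have := ge0_integral_law P1 mid mD mef e0.
have := ge0_integral_law P2 mid mD mef e0.
rewrite !preimage_id /= => <- <-.
apply: eq_measure_integral => A; rewrite (measurable_sub_alg sF) => FA _.
exact: P12.
Qed.

Lemma prob_join_unique P1 P2 F G : sub_alg F -> sub_alg G ->
  (forall A B, F A -> G B -> P1 (A `&` B) = P2 (A `&` B)) ->
  forall D, join F G D -> P1 D = P2 D.
Proof.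
move=> sF sG h D jD.
pose K := [set C | exists A B, [/\ F A, G B & C = A `&` B]].
apply: (g_sigma_algebra_measure_unique K _ (fun=> setT)) => //.
- move=> _ [A [B [FA GB ->]]]; apply: measurableI; [exact: sF.2|exact: sG.2].
- by move=> _; exists setT, setT; rewrite setIT; split => //; exact: sub_algT.
- by apply/seteqP; split => // x _; exists 0%N.
- move=> _ _ [A [B [FA GB ->]]] [A' [B' [FA' GB' ->]]].
  by exists (A `&` A'), (B `&` B'); rewrite setIACA; split => //; exact: sub_algI.
- by move=> _ [A [B [FA GB ->]]]; exact: h.
- by move=> _; apply: (@le_lt_trans _ _ 1); [exact: probability_le1|exact: ltry].
- move: D jD; apply: smallest_sub; first exact: smallest_sigma_algebra.
  move=> A [FA|GA]; apply: sub_sigma_algebra.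
    by exists A, setT; rewrite setIT; split => //; exact: sub_algT.
  by exists setT, A; rewrite setTI; split => //; exact: sub_algT.
Qed.

(** The version supplied by the prediction from [G] is [F]-measurable, hence almost surely the
    kernel, by uniqueness over [F]. *)
Lemma kern_extend P F G (z : Om -> borel Z) T : sub_alg F -> sub_alg G -> F `<=` G ->
  measurable_fun setT z -> sub_noise F T ->
  predicts P (g_sigma_algebra_preimage z) G F ->
  (forall D C, F D -> measurable C -> P (D `&` z @^-1` C) = \int[P]_(o in D) (kern T C o)%:E) ->
  forall D C, G D -> measurable C -> P (D `&` z @^-1` C) = \int[P]_(o in D) (kern T C o)%:E.
Proof.
move=> sF sG FG mz mT pr TP D C GD mC.
have mzC : measurable (z @^-1` C) by exact: measurable_preimage.
have [f [mf f0 fE]] : exists f : Om -> R, [/\ sig_fun F f, (forall o, 0 <= f o)%R &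
   forall D, G D -> P (z @^-1` C `&` D) = \int[P]_(o in D) (f o)%:E].
  by apply: pr; exists C => //; rewrite setTI.
have [mk _] := sub_noise_kern sF mT mC.
rewrite setIC fE//; apply: ae_eq_integral_real.
- exact: sG.2.
- exact: sig_fun_measurable sF mf.
- exact: sig_fun_measurable sF mk.
- apply: (condprob_unique sF mzC) => //.
  + by move=> o; exact: kern_ge0.
  + by move=> D' FD'; apply: fE; exact: FG.
  + by move=> D' FD'; rewrite setIC TP.
Qed.

End Kernels.

Arguments law : simpl never.

(** * One sampling step *)

Section Step.
Context (R : realType) (I : finType) (S : I -> ptopologicalType).
Hypothesis US : forall i, exists U : nat -> set (S i), countable_base U.
Hypothesis St : forall i, standard R (S i).
Local Open Scope ereal_scope.

Local Notation M := (borel (prod_space S)).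
Definition crd (i : I) (x : M) : S i := x i.
Arguments crd : clear implicits.

Let mcoord i : measurable_fun setT (crd i : M -> borel (S i)).
Proof. exact: measurable_coord. Qed.

Let scoords A : sub_alg (coords crd A).
Proof. exact: coords_sub_alg. Qed.

(* The conditional law of the coordinate [a] given the coordinates in [A] is [T]. *)
Definition condlaw (Q : probability M R) A a (T : M * R -> borel (S a)) :=
  forall D (C : set (borel (S a))), coords crd A D -> measurable C ->
    Q (D `&` crd a @^-1` C) = \int[Q]_(x in D) (kern T C x)%:E.

(** The inductive step for the uniqueness of a law with prescribed successive kernels. *)
Lemma condlaw_unique Q1 Q2 A B a T : B `<=` A -> sub_noise (coords crd B) T ->
  condlaw Q1 A T -> @condlaw Q2 A a T ->
  (forall D, coords crd A D -> Q1 D = Q2 D) ->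
  forall D, coords crd (A `|` [set a]) D -> Q1 D = Q2 D.
Proof.
move=> BA mT c1 c2 Q12; rewrite coordsU; apply: prob_join_unique => //.
move=> D E AD; rewrite coords1 => -[C mC <-]; rewrite setTI.
rewrite c1// c2//; apply: integral_eq_sub (scoords A) _ _ _ _ => //.
- have [h _] := sub_noise_kern (scoords B) mT mC.
  by apply: sig_fun_sub h; exact: coords_mono.
- by move=> o; exact: kern_ge0.
Qed.

Section OneStep.
Context d (Om : measurableType d) (P : probability Om R) (m : Om -> M).
Hypothesis mm : measurable_fun setT m.
Variables (A B : set I) (a : I) (T : M * R -> borel (S a)).
Hypotheses (BA : B `<=` A) (Aa : ~ A a) (mT : sub_noise (coords crd B) T).

Definition step (z : Om * R) : M := eqtype.dfwith (m z.1) (T (m z.1, z.2)).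

Lemma step_in z : step z a = T (m z.1, z.2).
Proof. exact: dfwith_in. Qed.

Lemma step_out z j : j <> a -> step z j = m z.1 j.
Proof. by move=> /eqP ja; rewrite /step dfwith_out// eq_sym. Qed.

Lemma measurable_step : measurable_fun setT step.
Proof.
apply: measurable_to_prod => // j; have [ja|ja] := pselect (j = a).
  subst j; rewrite [X in measurable_fun _ X](_ : _ = T \o (fun z => (m z.1, z.2))).
    apply: measurableT_comp; first exact: sub_noise_measurable mT.
    apply/measurable_fun_pairP; split; last exact: measurable_snd.
    exact: (measurableT_comp mm measurable_fst).
  by apply/funext => z; exact: step_in.
rewrite [X in measurable_fun _ X](_ : _ = crd j \o (m \o fst)).
  by apply: measurableT_comp => //; exact: measurableT_comp.
by apply/funext => z; exact: step_out.
Qed.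

Lemma step_coords D z : coords crd A D -> D (step z) <-> D (m z.1).
Proof.
move=> AD; split; apply: (coords_agree AD) => i Ai; rewrite /crd step_out//;
  by move=> ia; rewrite ia in Ai.
Qed.

Lemma step_coordsE D : coords crd A D -> step @^-1` D = (m @^-1` D) `*` setT.
Proof.
move=> AD; apply/seteqP; split => z /=.
  by move=> /(step_coords _ AD) Dz; split.
by move=> [Dz _]; apply/(step_coords _ AD).
Qed.

Lemma law_step D : coords crd A D ->
  law (P \x unif R) measurable_step D = law P mm D.
Proof.
move=> AD; have mD : measurable (m @^-1` D).
  by apply: measurable_preimage => //; exact: (scoords A).2.
rewrite -[LHS]/((P \x unif R) (step @^-1` D)) step_coordsE//.
rewrite (product_measure1E P (unif R) mD measurableT).
transitivity (P (m @^-1` D) * 1); last by rewrite mule1.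
congr (_ * _); exact: (probability_setT (unif R)).
Qed.

(** Overwriting the coordinate [a] leaves those in [A] unchanged, so the kernel reads the same
    values before and after the step; Fubini does the rest. *)
Lemma condlaw_step : condlaw (law (P \x unif R) measurable_step) A T.
Proof.
move=> D C AD mC.
have mD : measurable D by exact: (scoords A).2.
have [sk mu] := sub_noise_kern (scoords B) mT mC.
have sk' : sig_fun (coords crd A) (kern T C).
  by apply: sig_fun_sub sk; exact: coords_mono.
rewrite (integral_eq_sub (scoords A) sk' _ AD law_step); last by move=> o; exact: kern_ge0.
rewrite integral_law_real//; last 2 first.
- exact: sig_fun_measurable (scoords A) sk'.
- by move=> o; exact: kern_ge0.
rewrite -[LHS]/(\int[P]_o (unif R (xsection (step @^-1` (D `&` crd a @^-1` C)) o))).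
have mmD : measurable (m @^-1` D) by exact: measurable_preimage.
rewrite [RHS]integral_mkcond; apply: eq_integral => o _.
rewrite patchE; case: ifPn => [|/negP]; rewrite inE => mDo.
  rewrite (kernE (m o) (scoords B) mT mC) /=; congr (unif R _).
  apply/seteqP; split => u; rewrite /xsection/= inE/= ?/crd step_in//=.
    by move=> [].
  by split => //; apply/(step_coords _ AD).
rewrite (_ : xsection _ _ = set0) ?measure0//.
apply/seteqP; split => // u; rewrite /xsection/= inE => -[/= + _].
by move=> /(step_coords _ AD).
Qed.

End OneStep.
End Step.

(** * Sequential sampling *)

Section Rearrange.
Context d1 d2 d3 (T1 : measurableType d1) (T2 : measurableType d2) (T3 : measurableType d3).
Context (R : realType) (P1 : probability T1 R) (P2 : probability T2 R) (P3 : probability T3 R).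
Local Open Scope ereal_scope.

Let rho1 (z : T1 * (T2 * T3)) : (T1 * T2) * T3 := ((z.1, z.2.1), z.2.2).
Let rho2 (z : (T1 * T3) * T2) : (T1 * T2) * T3 := ((z.1.1, z.2), z.1.2).

Let measurable_rho1 : measurable_fun setT rho1.
Proof.
apply/measurable_fun_pairP; split.
  apply/measurable_fun_pairP; split; first exact: measurable_fst.
  exact: (measurableT_comp measurable_fst measurable_snd).
exact: (measurableT_comp measurable_snd measurable_snd).
Qed.

Let measurable_rho2 : measurable_fun setT rho2.
Proof.
apply/measurable_fun_pairP; split.
  apply/measurable_fun_pairP; split; last exact: measurable_snd.
  exact: (measurableT_comp measurable_fst measurable_fst).
exact: (measurableT_comp measurable_snd measurable_fst).
Qed.

Let int_section (A : set (T1 * T2)) (B : set T3) : measurable A -> measurable B ->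
  \int[P1]_x (P2 (xsection A x) * P3 B) = (P1 \x P2) A * P3 B.
Proof.
move=> mA mB; rewrite ge0_integralZr//.
exact: (measurable_fun_xsection P2 mA).
Qed.

(** Each sampling step appends a noise to the pair of noise spaces; here it joins the second one. *)
Lemma product_assoc A : measurable A ->
  (P1 \x (P2 \x P3)) (rho1 @^-1` A) = ((P1 \x P2) \x P3) A.
Proof.
move=> mA; apply/esym.
pose L : {measure set ((T1 * T2) * T3) -> \bar R} := law (P1 \x (P2 \x P3)) measurable_rho1.
pose P12 : probability (T1 * T2)%type R := (P1 \x P2)%E.
have h := @product_measure_unique _ _ _ _ R P12 P3 L.
apply: (h _ A mA) => B C mB mC {h}.
rewrite -int_section//.
rewrite -[LHS]/(\int[P1]_x (P2 \x P3) (xsection (rho1 @^-1` (B `*` C)) x)).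
apply: eq_integral => x _.
rewrite -(product_measure1E P2 P3)//; last exact: measurable_xsection.
congr (_ _); apply/seteqP; split => z; rewrite /xsection/= !inE/=.
  by move=> [].
by move=> [].
Qed.

(** Here the appended noise joins the first space, the one to be frozen. *)
Lemma product_exchange A : measurable A ->
  ((P1 \x P3) \x P2) (rho2 @^-1` A) = ((P1 \x P2) \x P3) A.
Proof.
move=> mA; apply/esym.
pose L : {measure set ((T1 * T2) * T3) -> \bar R} := law ((P1 \x P3) \x P2) measurable_rho2.
pose P12 : probability (T1 * T2)%type R := (P1 \x P2)%E.
have h := @product_measure_unique _ _ _ _ R P12 P3 L.
apply: (h _ A mA) => B C mB mC {h}.
rewrite -int_section//.
rewrite -[LHS]/(\int[P1 \x P3]_z P2 (xsection (rho2 @^-1` (B `*` C)) z)).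
pose f z := P2 (xsection B z.1) * (\1_C z.2)%:E.
transitivity (\int[P1 \x P3]_z f z).
  apply: eq_integral => -[x t] _; rewrite /f/= indicE.
  have [tC|tC] := pselect (C t).
    rewrite mem_set// mule1; congr (P2 _); apply/seteqP; split => z;
      rewrite /xsection/= !inE/=.
      by move=> [].
    by split.
  rewrite memNset// mule0 (_ : xsection _ _ = set0) ?measure0//.
  by apply/seteqP; split => // z; rewrite /xsection/= inE => -[].
have mf : measurable_fun setT f.
  apply: emeasurable_funM.
    exact: (measurableT_comp (measurable_fun_xsection P2 mB) measurable_fst).
  apply/measurable_EFinP; apply: measurableT_comp => //.
have f0 z : 0 <= f z by rewrite /f mule_ge0// lee_fin.
rewrite fubini_tonelli1//.
apply: eq_integral => x _; rewrite /fubini_F /f/= ge0_integralZl//.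
- by rewrite integral_indic// setIT.
- by apply/measurable_EFinP.
Qed.

End Rearrange.

Section Process.
Context (R : realType) (I : finType) (S : I -> ptopologicalType).
Hypothesis US : forall i, exists U : nat -> set (S i), countable_base U.
Hypothesis St : forall i, standard R (S i).
Local Open Scope ereal_scope.

Local Notation M := (borel (prod_space S)).
Local Notation crd := (@crd I S).

Let mcoord i : measurable_fun setT (crd i : M -> borel (S i)).
Proof. exact: measurable_coord. Qed.

Let scoords A : sub_alg (coords crd A).
Proof. exact: coords_sub_alg. Qed.

Variables (r : I -> nat) (rinj : injective r) (IU : set I) (B : I -> set I).
Hypothesis Br : forall a b, B a b -> (r b < r a)%N.
Variables (Q : probability M R) (T : forall a, M * R -> borel (S a)).
Hypothesis mT : forall a, sub_noise (coords crd (B a)) (T a).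
Hypothesis QT : forall a, condlaw Q [set b | (r b < r a)%N] (T a).

Let bef n : set I := [set b | (r b < n)%N].

Let befS n a : r a = n -> bef n.+1 = bef n `|` [set a].
Proof.
move=> ran; apply/seteqP; split => b; rewrite /bef/=.
  by rewrite ltnS leq_eqVlt => /orP[/eqP rbn|]; [right; apply: rinj; rewrite ran|left].
by move=> [/leqW//|->]; rewrite ran.
Qed.

Let coords_agree_law n (Q1 Q2 : probability M R) a :
  (r a < n)%N -> (forall D, coords crd (bef n) D -> Q1 D = Q2 D) ->
  condlaw Q1 (bef (r a)) (T a) -> condlaw Q2 (bef (r a)) (T a).
Proof.
move=> an Q12 c1 D C AD mC.
have sub : bef (r a) `<=` bef n by move=> b /ltn_trans; apply.
have [sk _] := sub_noise_kern (scoords (B a)) (@mT a) mC.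
rewrite -Q12; last first.
  apply: (sub_algI (scoords (bef n))); first exact: coords_mono AD.
  exact: (coords_coord (X := crd) (i := a)).
rewrite c1//; apply: (integral_eq_sub (scoords (bef n))) => //.
- by apply: sig_fun_sub sk; apply: coords_mono => b /Br /ltn_trans; apply.
- by move=> o; exact: kern_ge0.
- exact: coords_mono AD.
Qed.

(* The coordinates are sampled one after the other, each one by its conditional law given
   its predecessors; the coordinates in [IU] use noise from the first space. *)
Lemma exists_process n :
  exists dU (OU : measurableType dU) (PU : probability OU R)
    dX (OX : measurableType dX) (PX : probability OX R)
    (m : OU * OX -> M) (mm : measurable_fun setT m),
  (forall D, coords crd (bef n) D -> law (PU \x PX) mm D = Q D) /\
  forall u, exists mu : measurable_fun setT (fun xi => m (u, xi)),
    (forall a, bef n a -> IU a -> exists t, forall xi, m (u, xi) a = T a (m (u, xi), t)) /\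
    (forall a, bef n a -> ~ IU a -> condlaw (law PX mu) (bef (r a)) (T a)).
Proof.
elim: n => [|n [dU [OU [PU [dX [OX [PX [m [mm [mlaw mcond]]]]]]]]]].
  (* Before any sampling the noise spaces are placeholders and the process is constant: only trivial
     events have to be compared. *)
  exists _, R, (unif R), _, R, (unif R), (cst point).
  have mm : measurable_fun setT (cst point : R * R -> M) by exact: measurable_cst.
  exists mm; split => [D|u].
    have cond0 (E : set M) : coords crd (bef 0) E -> E = set0 \/ E = setT.
      move: E; apply: (@smallest_sub _ _ _ [set E : set M | E = set0 \/ E = setT]).
        split; first by left.
          by move=> E [->|->]; [right; rewrite setD0|left; rewrite setDv].
        move=> E hE; have [[k Ek]|nE] := pselect (exists k, E k = setT).
          by right; apply/seteqP; split => // x _; exists k; rewrite ?Ek.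
        left; apply/seteqP; split => // x [k _ Ekx].
        by have [E0|E1] := hE k; [rewrite E0 in Ekx|case: nE; exists k].
      by move=> _ [i [C [//]]].
    by move=> /cond0[->|->]; rewrite ?measure0// !probability_setT.
  have mu : measurable_fun setT (fun xi : R => (cst point : R * R -> M) (u, xi)).
    exact: measurable_cst.
  by exists mu; split.
have [[a ran]|noa] := pselect (exists a, r a = n); last first.
  have befn : bef n.+1 = bef n.
    apply/seteqP; split => b; last exact: leqW.
    rewrite /bef/= ltnS leq_eqVlt => /orP[/eqP rb|//].
    by case: noa; exists b.
  by exists _, OU, PU, _, OX, PX, m, mm; rewrite befn.
have Ba : B a `<=` bef n by move=> b /Br; rewrite ran.
have nbef : ~ bef n a by rewrite /bef/= ran ltnn.
have cQ : condlaw Q (bef n) (T a) by have := @QT a; rewrite ran.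
pose m' : (OU * OX) * R -> M := step m (T a).
have mm' : measurable_fun setT m' by exact: (measurable_step US mm (@mT a)).
have law' D : coords crd (bef n.+1) D -> law ((PU \x PX) \x unif R) mm' D = Q D.
  rewrite (befS ran).
  have cs := condlaw_step US (PU \x PX) mm Ba nbef (@mT a).
  apply: (condlaw_unique _ (@mT a) _ cQ) => //.
  move=> E AE; apply: etrans (mlaw E AE).
  exact: (law_step US (PU \x PX) mm nbef (@mT a)).
have neq_a b i : bef n.+1 b -> B b i -> i <> a.
  rewrite /bef/= ltnS => rb /Br ri ia; rewrite ia ran in ri.
  by move: (leq_trans ri rb); rewrite ltnn.
(* The kernels in use read only coordinates of rank below n, which the step at [a] does not
   touch. *)
have agree b z t : bef n.+1 b -> T b (m' z, t) = T b (m z.1, t).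
  move=> nb; apply: (@sub_noise_agree _ M R (S b) I S crd (B b)) => // i Bi.
  by rewrite /crd /m' step_out//; exact: neq_a Bi.
(* For [a] in [IU] the new noise t is frozen together with u and makes the coordinate a function of
   the others. Otherwise it stays random, and the coordinate keeps its kernel under every frozen
   u. *)
have [IUa|nIUa] := pselect (IU a).
  pose m2 (z : (OU * R) * OX) : M := m' ((z.1.1, z.2), z.1.2).
  have mm2 : measurable_fun setT m2.
    apply: (measurableT_comp mm'); apply/measurable_fun_pairP; split.
      apply/measurable_fun_pairP; split; last exact: measurable_snd.
      exact: (measurableT_comp measurable_fst measurable_fst).
    exact: (measurableT_comp measurable_snd measurable_fst).
  exists _, _, (PU \x unif R), _, OX, PX, m2, mm2; split => [D nD|[u t]].
    have mD : measurable D by exact: (scoords _).2 _ nD.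
    rewrite -law'//; exact: (product_exchange PU PX (unif R) (measurable_preimage mm' mD)).
  have [mu [mu1 mu2]] := mcond u.
  have mu' : measurable_fun setT (fun xi => m2 ((u, t), xi)).
    exact: (measurableT_comp mm2 (pair1_measurable (u, t))).
  exists mu'; split => b nb.
    move=> IUb; have [rbn|rbn] := ltnP (r b) n.
      have [t' tE] := mu1 _ rbn IUb; exists t' => xi.
      rewrite agree//= -tE /m2 /m' step_out// => ba.
      by rewrite ba ran ltnn in rbn.
    have ba : b = a.
      by apply: rinj; rewrite ran; apply/eqP; rewrite eqn_leq rbn andbT -ltnS.
    subst b; exists t => xi; rewrite agree//= /m2 /m'; exact: step_in.
  move=> nIUb; have [rbn|rbn] := ltnP (r b) n; last first.
    have ba : b = a.
      by apply: rinj; rewrite ran; apply/eqP; rewrite eqn_leq rbn andbT -ltnS.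
    by subst b.
  apply: coords_agree_law rbn _ (mu2 _ rbn nIUb) => D nD.
  rewrite -[LHS]/(PX _) -[RHS]/(PX _); congr (PX _); apply/seteqP.
  by split => xi /=; have h := step_coords m (T a) nbef ((u, xi), t) nD; [exact: h.2|exact: h.1].
pose m2 (z : OU * (OX * R)) : M := m' ((z.1, z.2.1), z.2.2).
have mm2 : measurable_fun setT m2.
  apply: (measurableT_comp mm'); apply/measurable_fun_pairP; split.
    apply/measurable_fun_pairP; split; first exact: measurable_fst.
    exact: (measurableT_comp measurable_fst measurable_snd).
  exact: (measurableT_comp measurable_snd measurable_snd).
exists _, OU, PU, _, _, (PX \x unif R), m2, mm2; split => [D nD|u].
  have mD : measurable D by exact: (scoords _).2 _ nD.
  rewrite -law'//; exact: (product_assoc PU PX (unif R) (measurable_preimage mm' mD)).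
have [mu [mu1 mu2]] := mcond u.
exists (measurable_step US mu (@mT a)); split => b nb.
  move=> IUb; have rbn : (r b < n)%N.
    rewrite ltn_neqAle -ltnS nb andbT; apply/eqP => rbn.
    by apply: nIUa; rewrite (_ : a = b)//; apply: rinj; rewrite ran.
  have [t' tE] := mu1 _ rbn IUb; exists t' => -[xi t].
  rewrite agree//= -tE /m2 /m' step_out// => ba.
  by rewrite ba ran ltnn in rbn.
move=> nIUb; have [rbn|rbn] := ltnP (r b) n; last first.
  have ba : b = a.
    by apply: rinj; rewrite ran; apply/eqP; rewrite eqn_leq rbn andbT -ltnS.
  subst b; rewrite ran; exact: (condlaw_step US PX mu Ba nbef (@mT a)).
apply: coords_agree_law rbn _ (mu2 _ rbn nIUb) => D nD.
exact/esym/(law_step US PX mu nbef (@mT a)).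
Qed.

End Process.

(** * Derandomization *)

Section Choice.
Context d (Om : measurableType d) (R : realType) (P : probability Om R).
Local Open Scope ereal_scope.

(** Otherwise g minus its mean would be positive everywhere with integral zero. *)
Lemma exists_le_integral (g : Om -> \bar R) : measurable_fun setT g -> (forall o, 0 <= g o) ->
  exists o, g o <= \int[P]_o g o.
Proof.
move=> mg g0; apply: contrapT => /forallNP h.
have lt o : \int[P]_o g o < g o by rewrite ltNge; exact/negP/h.
have c0 : 0 <= \int[P]_o g o by exact: integral_ge0.
have cfin : \int[P]_o g o \is a fin_num.
  by rewrite ge0_fin_numE//; apply: lt_le_trans (lt point) _; exact: leey.
pose c := fine (\int[P]_o g o); have cE : \int[P]_o g o = c%:E by rewrite fineK.
have c0' : (0 <= c)%R by rewrite fine_ge0.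
pose k o := g o - c%:E.
have k0 o : 0 < k o by rewrite /k sube_gt0 -cE.
have mk : measurable_fun setT k by apply: emeasurable_funB => //.
have : \int[P]_o k o = 0.
  have : \int[P]_o (c%:E + k o) = c%:E.
    by rewrite -[RHS]cE; apply: eq_integral => o _; rewrite /k addeC subeK.
  rewrite ge0_integralD//; last by move=> o _; exact: ltW.
  have i1 : \int[P]_o cst c%:E o = c%:E by rewrite integral_cst// -[RHS]mule1; congr (_ * _); exact: (probability_setT P).
  rewrite -[X in X + _]/(\int[P]_o cst c%:E o) i1.
  move=> /(congr1 (fun x => x - c%:E)); rewrite addeAC subee// add0e; exact.
have -> : \int[P]_o k o = \int[P]_o `|k o|.
  by apply: eq_integral => o _; rewrite gee0_abs//; exact: ltW.
move=> /(ae_eq_integral_abs P measurableT mk).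
move=> /(@filterS _ _ (ae_filter_ringOfSetsType P) _ (fun=> False)) [].
  by move=> o /(_ Logic.I) ko; have := k0 o; rewrite ko ltxx.
move=> A [mA PA] sA.
have : P setT <= P A by apply: le_measure; rewrite ?inE// => o _; exact: sA.
by rewrite PA probability_setT lee_fin ler10.
Qed.

End Choice.

Section KernelUnique.
Context d (Om : measurableType d) (R : realType) (Z : ptopologicalType).
Context (P : probability Om R) (G : set (set Om)) (z : Om -> borel Z).
Hypothesis (UZ : exists U : nat -> set Z, countable_base U).
Hypotheses (sG : sub_alg G) (mz : measurable_fun setT z).
Local Open Scope ereal_scope.

(** One null set must serve all [C]: the kernels are compared on finite intersections of base sets,
    which are countably many, and off that null set the pi-lambda theorem extends the equality to
    every Borel set. *)
Lemma kern_unique (T1 T2 : Om * R -> borel Z) :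
  sub_noise G T1 -> sub_noise G T2 ->
  (forall D C, G D -> measurable C -> P (D `&` z @^-1` C) = \int[P]_(o in D) (kern T1 C o)%:E) ->
  (forall D C, G D -> measurable C -> P (D `&` z @^-1` C) = \int[P]_(o in D) (kern T2 C o)%:E) ->
  exists N, [/\ measurable N, P N = 0 &
    forall o, ~ N o -> forall C, measurable C -> kern T1 C o = kern T2 C o].
Proof.
move=> mT1 mT2 h1 h2; have [U [oU bU]] := UZ.
have mU n : measurable (U n : set (borel Z)) by apply: sub_sigma_algebra; exact: oU.
pose K (s : seq nat) : set (borel Z) := \bigcap_(n in [set` s]) U n.
have mK s : measurable (K s) by apply: bigcap_measurableType => // n _; exact: mU.
have k1 C : measurable C -> sig_fun G (kern T1 C) by move=> mC; have [] := sub_noise_kern sG mT1 mC.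
have k2 C : measurable C -> sig_fun G (kern T2 C) by move=> mC; have [] := sub_noise_kern sG mT2 mC.
pose N (s : seq nat) : set Om := [set o | kern T1 (K s) o <> kern T2 (K s) o].
have mN s : measurable (N s).
  rewrite (_ : N s = (kern T1 (K s) \- kern T2 (K s))%R @^-1` [set~ 0%R]).
    apply: measurable_preimage; last exact: measurableC.
    by apply: measurable_funB; apply: sig_fun_measurable sG _; [exact: k1|exact: k2].
  apply/seteqP; split => o /=; first by move=> n /subr0_eq.
  by move=> n e; apply: n; rewrite /= e subrr.
have N0 s : P (N s) = 0.
  have mzK : measurable (z @^-1` K s) by exact: measurable_preimage.
  apply: measure_negligible => //.
  have /= := @condprob_unique _ _ _ P G (z @^-1` K s) (kern T1 (K s)) (kern T2 (K s)) sG mzK (k1 _ (mK s)) (k2 _ (mK s)) (kern_ge0 _ _) (kern_ge0 _ _).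
  apply.
    by move=> D GD; rewrite setIC h1.
  by move=> D GD; rewrite setIC h2.
have mN' n : measurable (oapp N set0 (unpickle n)) by case: unpickle => [s|] /=; [exact: mN|exact: measurable0].
exists (\bigcup_n oapp N set0 (unpickle n)); split.
- exact: bigcupT_measurable.
- apply: measure_negligible.
    exact: bigcupT_measurable.
  apply: negligible_bigcup => n; case: unpickle => [s|]; last exact: negligible_set0.
  by apply/negligibleP; [exact: mN|exact: N0].
move=> o nNo C mC.
have mT (T : Om * R -> borel Z) : sub_noise G T -> measurable_fun setT (fun u => T (o, u)).
  by move=> nT _ B mB; rewrite setTI; exact: (sub_noise_kern sG nT mB).2.
rewrite /kern -[unif R [set u | C (T1 (o, u))]]/(law (unif R) (mT _ mT1) C).
rewrite -[unif R [set u | C (T2 (o, u))]]/(law (unif R) (mT _ mT2) C); congr fine.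
apply: (g_sigma_algebra_measure_unique (range K) _ (fun=> setT)) => //.
- by move=> _ [s _ <-].
- by move=> _; exists [::] => //; rewrite /K; apply/seteqP; split => // x _ n.
- by apply/seteqP; split => // x _; exists 0%N.
- move=> _ _ [s _ <-] [t _ <-]; exists (s ++ t) => //; apply/seteqP; split => x.
    by move=> h; split => n ns; apply: h; rewrite /= mem_cat ns ?orbT.
  by move=> [hs ht] n /=; rewrite mem_cat => /orP[]; [exact: hs|exact: ht].
- move=> _ [s _ <-]; apply: contrapT => ne; apply: nNo; exists (pickle s) => //.
  rewrite pickleK /= => e; apply: ne.
  rewrite -[LHS]/(unif R [set u | K s (T1 (o, u))]) -[RHS]/(unif R [set u | K s (T2 (o, u))]).
  by rewrite -(kernE o sG mT1 (mK s)) -(kernE o sG mT2 (mK s)) e.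
- by move=> _; apply: (@le_lt_trans _ _ 1); [exact: probability_le1|exact: ltry].
- move: C mC; apply: smallest_sub; first exact: smallest_sigma_algebra.
  move=> A oA; rewrite (_ : A = \bigcup_n (if `[< U n `<=` A >] then U n else set0)).
    have sK : sigma_algebra setT <<s range K >> by exact: smallest_sigma_algebra.
    have [s0 _ sU] := sK; apply: sU => n; case: asboolP => // UA.
    apply: sub_sigma_algebra; exists [:: n] => //; apply/seteqP; split => x.
      by apply; rewrite /= inE.
    by move=> Ux k /=; rewrite inE => /eqP ->.
  apply/seteqP; split => x.
    by move=> /(bU _ _ oA) [n [Ux UA]]; exists n => //; rewrite asboolT.
  by move=> [n _]; case: asboolP => // h /h.
Qed.

End KernelUnique.

Section Chain.
Context (R : realType) (I : finType) (S : I -> ptopologicalType).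
Hypothesis US : forall i, exists U : nat -> set (S i), countable_base U.
Local Notation M := (borel (prod_space S)).
Variables (r : I -> nat) (rinj : injective r).

Lemma beforeS n a : r a = n -> before r n.+1 = before r n `|` [set a].
Proof.
move=> ran; apply/seteqP; split => b; rewrite /before/=.
  by rewrite ltnS leq_eqVlt => /orP[/eqP rbn|]; [right; apply: rinj; rewrite ran|left].
by move=> [/leqW//|->]; rewrite ran.
Qed.

Lemma before_skip n : (forall a, r a <> n) -> before r n.+1 = before r n.
Proof.
move=> h; apply/seteqP; split => b; last exact: leqW.
by rewrite /before/= ltnS leq_eqVlt => /orP[/eqP /h|].
Qed.

Lemma exists_rank_bound : exists n, before r n = setT.
Proof.
exists (\max_(a : I) r a).+1; apply/seteqP; split => // a _.
by rewrite /before/= ltnS; exact: leq_bigmax.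
Qed.

Lemma condlaw_all_unique (Q1 Q2 : probability M R) (T : forall a, M * R -> borel (S a)) :
  (forall a, sub_noise (coords (@crd I S) (before r (r a))) (T a)) ->
  (forall a, condlaw Q1 (before r (r a)) (T a)) ->
  (forall a, condlaw Q2 (before r (r a)) (T a)) ->
  forall D, measurable D -> Q1 D = Q2 D.
Proof.
move=> mT c1 c2.
have h n D : coords (@crd I S) (before r n) D -> Q1 D = Q2 D.
  elim: n D => [|n IHn].
    have -> : before r 0 = set0 by apply/seteqP; split.
    move=> D; move=> cD.
    have sT := coords_sub_alg (fun i => @measurable_coord I S i) set0.
    have [->|->] : D = set0 \/ D = setT; last 2 first.
    - by rewrite !measure0.
    - by rewrite !probability_setT.
    have [[x Dx]|nD] := pselect (exists x, D x); last first.
      by left; apply/seteqP; split => // x Dx; apply: nD; exists x.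
    by right; apply/seteqP; split => // y _; apply: coords_agree cD _ Dx.
  have [[a ran]|noa] := pselect (exists a, r a = n); last first.
    by rewrite before_skip// => a ran; apply: noa; exists a.
  rewrite (beforeS ran) -ran; apply: (condlaw_unique (T := T a) _ (@mT a)) => //.
  by rewrite ran.
have [n rn] := exists_rank_bound => D mD; apply: (h n).
by rewrite rn; move: mD; rewrite borel_prodE.
Qed.

Lemma condlaw_predicts (Q : probability M R) A B a (T : M * R -> borel (S a)) :
  sub_noise (coords (@crd I S) B) T -> condlaw Q A T ->
  predicts Q (coords (@crd I S) [set a]) (coords (@crd I S) A) (coords (@crd I S) B).
Proof.
move=> mT cT E; rewrite coords1 => -[C mC <-]; rewrite setTI.
have sB := coords_sub_alg (fun i => @measurable_coord I S i) B.
exists (kern T C); split.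
- exact: (sub_noise_kern sB mT mC).1.
- by move=> o; exact: kern_ge0.
- by move=> D AD; rewrite setIC cT.
Qed.

End Chain.

(** Weak union for the left-hand side, by symmetry. *)
Lemma ci_weak_union d (Om : measurableType d) I (S : I -> ptopologicalType)
    (X : forall i, Om -> S i) (R : realType) (P : probability Om R) (A B C D : set I) :
  (forall i, measurable_fun setT (X i : Om -> borel (S i))) ->
  ci X P (A `|` D) B C -> ci X P A (B `|` D) (D `|` C).
Proof.
move=> mX /(ci_sym mX) h.
have : ci X P B A (D `|` C).
  by apply: (ci_weaken h) => // i; rewrite /setU/=; tauto.
by move=> /(ci_sym mX) h'; apply: (ci_weaken h') => // i; rewrite /setU/=; tauto.
Qed.

Lemma sub_noise_comp d d' (Om : measurableType d) (Om' : measurableType d') (R : realType)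
    (Z : ptopologicalType) (g : Om -> Om') F F' (T : Om' * R -> borel Z) :
  sub_alg F -> sub_alg F' -> (forall A, F' A -> F (g @^-1` A)) -> sub_noise F' T ->
  sub_noise F (fun z => T (g z.1, z.2)).
Proof.
move=> sF sF' gF mT.
have mg : measurable_fun (setT : set (g_sigma_algebraType F * R))
    (fun z => (g z.1, z.2) : g_sigma_algebraType F' * R).
  apply/measurable_fun_pairP; split => /=; last exact: measurable_snd.
  apply: (@measurableT_comp _ _ _ _ _ _ (g : g_sigma_algebraType F -> g_sigma_algebraType F')).
    by move=> _ A; rewrite setTI (measurable_sub_alg sF) (measurable_sub_alg sF'); exact: gF.
  exact: measurable_fst.
exact: (measurableT_comp mT mg).
Qed.

Lemma sub_noise_mono d (Om : measurableType d) (R : realType)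
    (Z : ptopologicalType) F F' (T : Om * R -> borel Z) :
  sub_alg F -> sub_alg F' -> F' `<=` F -> sub_noise F' T -> sub_noise F T.
Proof.
move=> sF sF' FF' mT; have := sub_noise_comp (g := id) sF sF' FF' mT.
by congr sub_noise; apply/funext => -[].
Qed.

Lemma countable_base_prod (I : finType) (S : I -> ptopologicalType) :
  (forall i, exists U : nat -> set (S i), countable_base U) ->
  exists U : nat -> set (prod_space S), countable_base U.
Proof.
move=> US; pose U i := sval (cid (US i)).
have Ub i : countable_base (U i) := svalP (cid (US i)).
pose box (f : {ffun I -> nat}) := [set x : prod_space S | forall i, U i (f i) (x i)].
exists (fun n => oapp box set0 (unpickle n)); split => [n|O x oO Ox].
  case: unpickle => [f|] /=; last exact: open0.
  rewrite openE => x xf.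
  apply: (@filter_forall _ I (fun i => [set y : prod_space S | U i (f i) (y i)]) (nbhs x)) => i.
  apply: (@proj_continuous _ S i x); apply: open_nbhs_nbhs; split; last exact: xf.
  exact: (Ub i).1.
have /nbhs_prod_box[V [nV VO]] : nbhs x O by exact: open_nbhs_nbhs.
have /choice[n nP] : forall i, exists n, U i n (x i) /\ U i n `<=` V i.
  move=> i; have := nV i; rewrite nbhsE => -[W [oW Wx] WV].
  have [n [Ux UW]] := (Ub i).2 W _ oW Wx.
  by exists n; split => //; exact: subset_trans WV.
exists (pickle (finfun n : {ffun I -> nat})); rewrite pickleK /=; split.
  by move=> i; rewrite ffunE; exact: (nP i).1.
by move=> y /= yb; apply: VO => i; apply: (nP i).2; have := yb i; rewrite ffunE.
Qed.

Lemma sig_fun_to_prod (I : finType) (S : I -> ptopologicalType) :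
  (forall i, exists U : nat -> set (S i), countable_base U) ->
  forall d (Om : measurableType d) F (f : Om -> prod_space S), sub_alg F ->
  (forall i, sig_fun F ((fun o => f o i) : Om -> borel (S i))) ->
  sig_fun F (f : Om -> borel (prod_space S)).
Proof.
move=> US d Om F f sF h.
apply/(measurable_fun_sub_alg _ sF)/measurable_to_prod => // i.
exact/(measurable_fun_sub_alg _ sF).
Qed.

Lemma sub_noise_section d (Om : measurableType d) (R : realType) (Z : ptopologicalType)
    F (T : Om * R -> borel Z) C t :
  sub_alg F -> sub_noise F T -> measurable C -> F [set m | C (T (m, t))].
Proof.
move=> sF mT mC; have := measurable_fun_pair1 t mT measurableT mC.
by rewrite setTI (measurable_sub_alg sF).
Qed.

(** * Freezing the noise of the middle process *)

Section Derandomize.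
Context (R : realType) (V : finType) (X : V -> ptopologicalType).
Hypothesis UX : forall v, exists U : nat -> set (X v), countable_base U.
Hypothesis StX : forall v, standard R (X v).
Variables (G : digraph V) (r : V -> nat) (rk : topological_rank G r).
Hypothesis tc : transitively_closed G.

Local Notation PX := (borel (prod_space X)).

(* The vertex [inl v] carries the pair (x_v, z_v) and [inr v] carries y_v. *)
Definition block (a : V + V) : ptopologicalType :=
  match a with inl v => prod_space (fun _ : bool => X v) | inr v => X v end.

Local Notation M := (borel (prod_space block)).
Local Notation crdB := (@crd _ block).
Local Notation crdX := (@crd V X).

(** [true] selects x and [false] selects z. *)
Definition side (b : bool) (m : M) : PX := fun v => m (inl v) b.

(** The pair (x, z) or (z, x) according to [b], so that causality and anticausality are treated at
    once. *)
Definition sides (b : bool) (a : V + V) : M -> pair_space X X a :=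
  @pair_coord V X X a \o (fun m => (side b m, side (~~ b) m)).

Let Ublock a : exists U : nat -> set (block a), countable_base U.
Proof. by case: a => v; [exact: (@countable_base_prod bool (fun=> X v) (fun=> UX v))|exact: UX]. Qed.

Let Stblock a : standard R (block a).
Proof. by case: a => v; [exact: (@standard_prod R bool (fun=> X v) (fun=> UX v) (fun=> StX v))|exact: StX]. Qed.

Let mcrd a : measurable_fun setT (crdB a : M -> borel (block a)).
Proof. exact: measurable_coord. Qed.

Let mcrdX v : measurable_fun setT (crdX v : PX -> borel (X v)).
Proof. exact: measurable_coord. Qed.

Let mside_coord b v : measurable_fun setT ((fun m => side b m v) : M -> borel (X v)).
Proof.
move=> _ C mC; rewrite setTI.
have mC' := measurable_preimage (@measurable_coord _ (fun _ : bool => X v) b) mC.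
exact: (@measurable_preimage _ _ M (borel (block (inl v))) _ (@mcrd (inl v)) _ mC').
Qed.

Lemma measurable_side b : measurable_fun setT (side b).
Proof. exact: measurable_to_prod. Qed.

Lemma measurable_sides b a : measurable_fun setT (sides b a : M -> borel (pair_space X X a)).
Proof. by case: a => v; exact: mside_coord. Qed.

Let scrd A : sub_alg (coords crdB A). Proof. exact: coords_sub_alg. Qed.
Let scrdX A : sub_alg (coords crdX A). Proof. exact: coords_sub_alg. Qed.
Let ssides b A : sub_alg (coords (sides b) A).
Proof. by apply: coords_sub_alg; exact: measurable_sides. Qed.

Let sig_side b v A : A v -> sig_fun (coords crdB (two A set0)) ((fun m => side b m v) : M -> borel (X v)).
Proof.
move=> Av C mC; have mC' := measurable_preimage (@measurable_coord _ (fun _ : bool => X v) b) mC.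
exact: (@coords_coord _ _ _ _ crdB (two A set0) (inl v) Av _ mC').
Qed.

Lemma coords_sides b A : coords (sides b) (two A A) = coords crdB (two A set0).
Proof.
apply/seteqP; split.
  by apply: coords_min => // -[] v Av; [exact: (@sig_side b)|exact: (@sig_side (~~ b))].
apply: coords_min => // -[v Av|//].
have sF := ssides b (two A A).
apply: (@sig_fun_to_prod bool (fun=> X v) (fun=> UX v) _ M _ (crdB (inl v)) sF) => b'.
have [->|nb] := eqVneq b' b; first exact: (@coords_coord _ _ _ _ (sides b) (two A A) (inl v) Av).
have -> : b' = ~~ b by case: b b' nb {sF} => -[].
exact: (@coords_coord _ _ _ _ (sides b) (two A A) (inr v) Av).
Qed.

Lemma coords_side b A : coords (sides b) (two A set0) = pre (side b) (coords crdX A).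
Proof.
rewrite -coords_comp (_ : two A set0 = inl @` A).
  by rewrite -(coords_reindex (sides b) (@inl V V)).
apply/seteqP; split => [[v Av|//]|_ [v Av <-]//].
by exists v.
Qed.

Let rinj : injective r := rk.1.

(** The coordinates that each kernel may read. That of y_v also reads the pair at [v], which is
    drawn just before. *)
Definition sources (a : V + V) : set (V + V) :=
  match a with
  | inl v => two [set` pa G v] [set` pa G v]
  | inr v => two (v |` [set` pa G v]) [set` pa G v]
  end.

Lemma before_inl v : before (causal_rank r) (causal_rank r (inl v)) =
  two (before r (r v)) (before r (r v)).
Proof.
by apply/seteqP; split => -[] w; rewrite /before/= ?ltn_double ?ltn_Sdouble.
Qed.

Lemma before_inr v : before (causal_rank r) (causal_rank r (inr v)) =
  two (v |` before r (r v)) (before r (r v)).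
Proof.
apply/seteqP; split => -[] w; rewrite /before/= ?ltnS ?leq_double ?ltn_double//.
  by rewrite leq_eqVlt => /orP[/eqP/rinj|]; [left|right].
by move=> [->//|/ltnW].
Qed.

Lemma sources_rank a b : sources a b -> (causal_rank r b < causal_rank r a)%N.
Proof.
case: a b => v [] w /=.
- by move=> /(pa_rank rk) h; rewrite ltn_double.
- by move=> /(pa_rank rk) h; rewrite ltn_Sdouble.
- by rewrite ltnS leq_double => -[->//|/(pa_rank rk)/ltnW].
- by move=> /(pa_rank rk) h; rewrite ltnS ltn_double.
Qed.

(* Transitive closure makes y_v a function of the blocks at v and its parents, once the
   noise is fixed. *)
Lemma determined (T : forall a, M * R -> borel (block a)) d (Om : measurableType d) (pm : Om -> M) :
  (forall a, sub_noise (coords crdB (sources a)) (T a)) -> measurable_fun setT pm ->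
  (forall v, exists t, forall o, pm o (inr v) = T (inr v) (pm o, t)) ->
  forall v, coords (fun a => crdB a \o pm) [set inr v] `<=`
    coords (fun a => crdB a \o pm) (two (v |` [set` pa G v]) set0).
Proof.
move=> mT mpm pmT v; have [n] := ubnP (r v); elim: n v => // n IHn v; rewrite ltnS => rvn.
have mcp a : measurable_fun setT (crdB a \o pm : Om -> borel (block a)).
  exact: (measurableT_comp (@mcrd a) mpm).
have [t tE] := pmT v.
apply: coords_min; first exact: (@coords_sub_alg _ _ _ _ _ mcp).
move=> a -> C mC.
have ms : coords crdB (sources (inr v)) [set m | C (T (inr v) (m, t))].
  exact: (sub_noise_section t (scrd _) (@mT (inr v)) mC).
have sub : coords (fun a => crdB a \o pm) (sources (inr v)) `<=`
    coords (fun a => crdB a \o pm) (two (v |` [set` pa G v]) set0).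
  apply: coords_min; first exact: (@coords_sub_alg _ _ _ _ _ mcp).
  move=> [] w; first exact: (@coords_coord _ _ _ _ (fun a => crdB a \o pm) (two (v |` [set` pa G v]) set0) (inl w)).
  move=> wv D mD.
  have : coords (fun a => crdB a \o pm) (two (w |` [set` pa G w]) set0) ((crdB (inr w) \o pm) @^-1` D).
    apply: (IHn w); first by rewrite (leq_trans _ rvn)//; exact: (pa_rank rk wv).
    exact: (@coords_coord _ _ _ _ (fun a => crdB a \o pm) [set inr w] (inr w)).
  apply: coords_mono => -[u|//] [->|uw]; first by right.
  by right; exact: (tc uw wv).
apply: sub; rewrite coords_comp; exists [set m | C (T (inr v) (m, t))] => //.
by rewrite setTI; apply/seteqP; split => o /=; rewrite /crd tE.
Qed.

Let side_pre b A D : coords crdX A D -> coords (sides b) (two A set0) (side b @^-1` D).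
Proof. by move=> AD; rewrite coords_side; exists D => //; rewrite setTI. Qed.

Let sides_crd b A B : coords (sides b) (two A set0) `<=` coords crdB (two A B).
Proof.
apply: (@subset_trans _ (coords (sides b) (two A A))); first by apply: coords_mono => -[].
by rewrite coords_sides; apply: coords_mono => -[].
Qed.

Local Open Scope ereal_scope.

(** The conditioning is on the whole past of (x, y, z), not on the past of one side. *)
Definition side_condlaw (Q : probability M R) b v (T : M * R -> borel (X v)) :=
  forall D (C : set (borel (X v))),
    coords crdB (two (before r (r v)) (before r (r v))) D -> measurable C ->
    Q (D `&` sides b (inl v) @^-1` C) = \int[Q]_(m in D) (kern T C m)%:E.

Lemma condlaw_side (Q : probability M R) b v (T : PX * R -> borel (X v)) :
  sub_noise (coords crdX [set` pa G v]) T ->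
  side_condlaw Q b (fun z => T (side b z.1, z.2)) ->
  condlaw (law Q (measurable_side b)) (before r (r v)) T.
Proof.
move=> mT h D C bD mC.
rewrite integral_law_real; last 3 first.
- exact: (scrdX _).2 _ bD.
- have [sk _] := sub_noise_kern (scrdX _) mT mC.
  exact: (sig_fun_measurable (scrdX _) sk).
- by move=> o; exact: kern_ge0.
apply: (h (side b @^-1` D) C) => //.
by apply: sides_crd; exact: side_pre.
Qed.

Lemma side_condlaw_predicts (Q : probability M R) b v (T : PX * R -> borel (X v)) :
  sub_noise (coords crdX [set` pa G v]) T ->
  side_condlaw Q b (fun z => T (side b z.1, z.2)) ->
  predicts Q (coords (sides b) [set inl v])
    (coords crdB (two (before r (r v)) (before r (r v))))
    (coords (sides b) (two [set` pa G v] set0)).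
Proof.
move=> mT h E; rewrite coords1 => -[C mC <-]; rewrite setTI.
have [sk _] := sub_noise_kern (scrdX _) mT mC.
exists (kern (fun z => T (side b z.1, z.2)) C); split.
- by move=> B mB; exact: (@side_pre b _ _ (sk B mB)).
- by move=> o; exact: kern_ge0.
- by move=> D AD; rewrite setIC h.
Qed.

Let sources_before a : sources a `<=` before (causal_rank r) (causal_rank r a).
Proof. by move=> b; exact: sources_rank. Qed.

Section Kernels.
Variable Q : probability M R.
Hypothesis Q_block : forall v, ci crdB Q [set a | a = inl v \/ a = inr v]
  (two (before r (r v)) (before r (r v))) (two [set` pa G v] [set` pa G v]).
Hypothesis Q_side : forall b v, predicts Q (coords (sides b) [set inl v])
  (coords crdB (two (before r (r v)) (before r (r v))))
  (coords (sides b) (two [set` pa G v] set0)).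

(** For y_v, weak union moves the pair at v to the conditioning side. *)
Lemma ci_sources a : ci crdB Q [set a] (before (causal_rank r) (causal_rank r a)) (sources a).
Proof.
case: a => v.
  by rewrite before_inl; apply: (ci_weaken (@Q_block v)) => // _ ->; left.
rewrite before_inr.
have h : ci crdB Q ([set inr v] `|` [set inl v])
    (two (before r (r v)) (before r (r v))) (two [set` pa G v] [set` pa G v]).
  by apply: (ci_weaken (@Q_block v)) => // a [->|->]; [right|left].
have := ci_weak_union (@mcrd) h.
move=> {}h; apply: (ci_weaken h) => //.
- move=> [] w /=; last by left; left.
  by move=> [->|wv]; [left; right|left; left].
- by move=> a [->|]; [left|case: a => w //=; right].
- by move=> [] w /=; [move=> [->|wv]; right; [left|right]|move=> wv; right; right].
Qed.

Lemma exists_kernels : exists T : forall a, M * R -> borel (block a),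
  (forall a, sub_noise (coords crdB (sources a)) (T a)) /\
  forall a, condlaw Q (before (causal_rank r) (causal_rank r a)) (T a).
Proof.
have h a : exists T : M * R -> borel (block a), sub_noise (coords crdB (sources a)) T /\
    condlaw Q (before (causal_rank r) (causal_rank r a)) T.
  have [T [mT TQ]] := noise_sub Q (Stblock a) (scrd (sources a)) (@mcrd a).
  exists T; split => // D C; apply: (kern_extend (scrd _) (scrd _) _ (@mcrd a) mT _ TQ).
    by apply: coords_mono; exact: (@sources_before a).
  rewrite -coords1; have := @ci_sources a.
  rewrite /ci (_ : _ `|` sources a = before (causal_rank r) (causal_rank r a))//.
  by apply/setUidPl; exact: (@sources_before a).
exists (fun a => sval (cid (h a))).
by split => a; [exact: (svalP (cid (h a))).1|exact: (svalP (cid (h a))).2].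
Qed.

(** The kernel is built from the law of one side alone; [Q_side] makes it the conditional law given
    the past of all three. *)
Lemma exists_side_kernel b v : exists T : PX * R -> borel (X v),
  sub_noise (coords crdX [set` pa G v]) T /\ side_condlaw Q b (fun z => T (side b z.1, z.2)).
Proof.
have [T [mT TQ]] := noise_sub (law Q (measurable_side b)) (StX v) (scrdX [set` pa G v]) (@mcrdX v).
exists T; split => // D C.
apply: (@kern_extend _ M R (X v) Q (coords (sides b) (two [set` pa G v] set0)) _ (sides b (inl v))).
- exact: ssides.
- exact: scrd.
- apply: subset_trans (@sides_crd b _ [set` pa G v]) _.
  by apply: coords_mono => -[] w; exact: (pa_rank rk).
- exact: (@measurable_sides b (inl v)).
- apply: sub_noise_comp mT; [exact: ssides|exact: scrdX|exact: side_pre].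
- by rewrite -coords1; exact: Q_side.
move=> D0 C0 + mC; rewrite coords_side => -[D' D'p <-]; rewrite setTI.
have := TQ D' C0 D'p mC; rewrite integral_law_real//.
- exact: (scrdX _).2 _ D'p.
- have [sk _] := sub_noise_kern (scrdX _) mT mC.
  exact: (sig_fun_measurable (scrdX _) sk).
- by move=> o; exact: kern_ge0.
Qed.

Lemma side_condlaw_block b v (T : M * R -> borel (block (inl v))) (Q' : probability M R) :
  condlaw Q' (before (causal_rank r) (causal_rank r (inl v))) T ->
  side_condlaw Q' b (fun z => T z b).
Proof.
rewrite before_inl => h D C bD mC.
have mC' := measurable_preimage (@measurable_coord _ (fun _ : bool => X v) b) mC.
exact: (h D _ bD mC').
Qed.

(** Both laws of a side are generated by the same kernels, which read that side only. *)
Let Q_marginal (Q' : probability M R) (T : bool -> forall v, PX * R -> borel (X v)) :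
  (forall b v, sub_noise (coords crdX [set` pa G v]) (T b v)) ->
  (forall b v, side_condlaw Q b (fun z => T b v (side b z.1, z.2))) ->
  (forall b v, side_condlaw Q' b (fun z => T b v (side b z.1, z.2))) ->
  forall b D, measurable D -> law Q' (measurable_side b) D = law Q (measurable_side b) D.
Proof.
move=> mT c1 c2 b; apply: (condlaw_all_unique UX rinj (T := T b)).
- move=> v; apply: (sub_noise_mono (scrdX _) (scrdX _) _ (mT b v)).
  by apply: coords_mono => w; exact: (pa_rank rk).
- by move=> v; exact: condlaw_side.
- by move=> v; exact: condlaw_side.
Qed.

(** [Q'] is the law of the process for one frozen u. The pairs keep their kernels; the side
    components of these give the marginals, and the functional dependence of y on the pairs gives
    the Markov properties. *)
Lemma derandomize (c : PX * PX -> \bar R) : measurable_fun setT c -> (forall z, 0 <= c z) ->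
  \int[Q]_m c (side true m, side false m) < +oo ->
  exists Q' : probability M R, [/\
    forall b D, measurable D -> law Q' (measurable_side b) D = law Q (measurable_side b) D,
    forall b v, ci (sides b) Q' [set inl v]
      (two (before r (r v)) (before r (r v))) (two [set` pa G v] set0),
    forall b v, ci (sides b) Q' [set inr v]
      (two (before r (r v)) (before r (r v))) (two (v |` [set` pa G v]) [set` pa G v]) &
    \int[Q']_m c (side true m, side false m) <= \int[Q]_m c (side true m, side false m)].
Proof.
move=> mc c0 cfin.
have [T [mT TQ]] := exists_kernels.
pose Tx b v := sval (cid (exists_side_kernel b v)).
have mTx b v : sub_noise (coords crdX [set` pa G v]) (Tx b v).
  exact: (svalP (cid (exists_side_kernel b v))).1.
have TxQ b v : side_condlaw Q b (fun z => Tx b v (side b z.1, z.2)).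
  exact: (svalP (cid (exists_side_kernel b v))).2.
pose bef v := two (before r (r v)) (before r (r v)).
(* Two kernels for the same coordinate, the component of the pair kernel and the one that reads a
   single side, are both conditional laws given the past, hence equal off a null set. *)
have hN b v : exists N, [/\ measurable N, Q N = 0 &
    forall m, ~ N m -> forall C : set (borel (X v)), measurable C ->
      kern (fun z => (T (inl v) z : prod_space (fun _ : bool => X v)) b) C m =
      kern (fun z => Tx b v (side b z.1, z.2)) C m].
  apply: (@kern_unique _ M R (X v) Q (coords crdB (bef v)) (sides b (inl v))) => //.
  - exact: (@measurable_sides b (inl v)).
  - have mTv : sub_noise (coords crdB (bef v)) (T (inl v)).
      apply: (sub_noise_mono (scrd _) (scrd _) _ (@mT (inl v))).
      by apply: coords_mono; rewrite /bef -before_inl; exact: (@sources_before (inl v)).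
    exact: (measurableT_comp (@measurable_coord _ (fun _ : bool => X v) b) mTv).
  - apply: (sub_noise_comp (scrd _) (scrdX _) _ (mTx b v)) => D pD.
    apply: coords_mono (@sides_crd b _ [set` pa G v] _ (side_pre pD)) => -[] w;
      exact: (pa_rank rk).
  - exact: (@side_condlaw_block b v _ Q (@TQ (inl v))).
  - exact: TxQ.
pose Nbv (bv : bool * V) := sval (cid (hN bv.1 bv.2)).
have NbvP bv := svalP (cid (hN bv.1 bv.2)).
pose Nn n := oapp Nbv set0 (unpickle n).
have mNn n : measurable (Nn n).
  by rewrite /Nn; case: unpickle => [bv|] /=; [have [] := NbvP bv|exact: measurable0].
pose N := \bigcup_n Nn n.
have mN : measurable N by exact: bigcupT_measurable.
have QN : Q N = 0.
  apply: measure_negligible => //; apply: negligible_bigcup => n; rewrite /Nn.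
  case: unpickle => [bv|] /=; last exact: negligible_set0.
  by have [mNbv Nbv0 _] := NbvP bv; exact/negligibleP.
have NE b v m : ~ N m -> forall C : set (borel (X v)), measurable C ->
      kern (fun z => (T (inl v) z : prod_space (fun _ : bool => X v)) b) C m =
      kern (fun z => Tx b v (side b z.1, z.2)) C m.
  move=> nN; have [_ _] := NbvP (b, v); apply => Nm; apply: nN.
  by exists (pickle (b, v)) => //; rewrite /Nn pickleK.
have mcm : measurable_fun setT (fun m => c (side true m, side false m)).
  apply: (measurableT_comp mc); apply/measurable_fun_pairP.
  by split; exact: measurable_side.
(* The penalty does not change the mean, as [N] is null for [Q]; but a u with cost at most this
   finite mean has a law that does not charge [N]. *)
pose c' m := c (side true m, side false m) + +oo * (\1_N m)%:E.
have mN' : measurable_fun setT (fun m => +oo * (\1_N m)%:E : \bar R).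
  by apply: measurable_funeM; apply/measurable_EFinP.
have N0 m : 0 <= +oo * (\1_N m)%:E :> \bar R by rewrite mule_ge0// lee_fin.
have mc' : measurable_fun setT c' by exact: emeasurable_funD.
have c'0 m : 0 <= c' m by rewrite adde_ge0.
have c'E (Q' : probability M R) : \int[Q']_m c' m =
    \int[Q']_m c (side true m, side false m) + +oo * Q' N.
  rewrite ge0_integralD//; congr (_ + _); rewrite ge0_integralZl//.
  - by rewrite integral_indic// setIT.
  - by apply/measurable_EFinP.
have [n bn] := exists_rank_bound (causal_rank r).
have rkc := causal_rankP rk.
have [dU [OU [PU [dO [OX [PO [pm [mpm [lawpm pmP]]]]]]]]] :=
  exists_process Ublock Stblock rkc.1 (range inr) sources_rank mT TQ n.
have lawQ D : measurable D -> law (PU \x PO) mpm D = Q D.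
  move=> mD; apply: lawpm; rewrite -[[set b | _]]/(before (causal_rank r) n) bn.
  by move: mD; rewrite (borel_prodE Ublock).
have intE : \int[PU]_u \int[PO]_o c' (pm (u, o)) = \int[Q]_m c (side true m, side false m).
  transitivity (\int[Q]_m c' m); last by rewrite c'E QN mule0 adde0.
  transitivity (\int[law (PU \x PO) mpm]_m c' m).
    rewrite ge0_integral_law// preimage_setT.
    exact/esym/(@fubini_tonelli1 _ _ _ _ R PU PO (c' \o pm) (measurableT_comp mc' mpm) (fun z => c'0 (pm z))).
  by apply: eq_measure_integral => D mD _; exact: lawQ.
have [u cu] : exists u, \int[PO]_o c' (pm (u, o)) <= \int[Q]_m c (side true m, side false m).
  rewrite -intE; apply: (@exists_le_integral _ _ _ PU (fun u => \int[PO]_o c' (pm (u, o)))).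
    exact: (@measurable_fun_fubini_tonelli_F _ _ _ _ R PO (c' \o pm) (measurableT_comp mc' mpm) (fun z => c'0 (pm z))).
  by move=> u; exact: integral_ge0.
have [mu [pmT pmC]] := pmP u.
pose Q' := law PO mu.
have Q'c : \int[Q']_m c' m <= \int[Q]_m c (side true m, side false m).
  by rewrite ge0_integral_law// preimage_setT.
have Q'N : Q' N = 0.
  apply: contrapT => /eqP nz; move: Q'c; rewrite c'E.
  rewrite gt0_mulye; last by rewrite lt0e nz measure_ge0.
  rewrite addey; last by rewrite -ltNye; apply: lt_le_trans (integral_ge0 _ _).
  by rewrite leNgt cfin.
have bnd a : before (causal_rank r) n a by rewrite bn.
have Q'T v : condlaw Q' (before (causal_rank r) (causal_rank r (inl v))) (T (inl v)).
  by apply: pmC; [exact: bnd|move=> -[]].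
have Q'Tx b v : side_condlaw Q' b (fun z => Tx b v (side b z.1, z.2)).
  move=> D C bD mC; apply: etrans (@side_condlaw_block b v _ Q' (@Q'T v) D C bD mC) _.
  apply: ae_eq_integral_real.
  - exact: (scrd _).2 _ bD.
  - have mTb : sub_noise (coords crdB (sources (inl v)))
        (fun z => (T (inl v) z : prod_space (fun _ : bool => X v)) b).
      exact: (measurableT_comp (@measurable_coord _ (fun _ : bool => X v) b) (@mT (inl v))).
    exact: (sig_fun_measurable (scrd _) (sub_noise_kern (scrd _) mTb mC).1).
  - have mTs := sub_noise_comp (ssides b _) (scrdX _) (fun A => @side_pre b _ A) (mTx b v).
    exact: (sig_fun_measurable (ssides b _) (sub_noise_kern (ssides b _) mTs mC).1).
  - by exists N; split => // m /= h; apply: contrapT => nN; apply: h; exact: (NE b v m nN C mC).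
exists Q'; split.
- exact: (Q_marginal mTx TxQ Q'Tx).
- move=> b v; have := side_condlaw_predicts (mTx b v) (@Q'Tx b v).
  apply: predicts_weaken => //.
  apply: (@subset_trans _ (coords (sides b) (two (before r (r v)) (before r (r v))))).
    by apply: coords_mono => -[] w; [move=> [//|]; exact: (pa_rank rk)|move=> []].
  by rewrite coords_sides; apply: coords_mono => -[].
- move=> b v; have [_ pull] := @ci_pullback _ _ OX M (V + V)%type (pair_space X X) (sides b) R PO _ mu
    [set inr v] (two (before r (r v)) (before r (r v))) (two (v |` [set` pa G v]) [set` pa G v])
    (@measurable_sides b).
  apply: pull.
  pose g o := pm (u, o).
  have sg A : coords (fun a => sides b a \o g) (two A A) = coords (fun a => crdB a \o g) (two A set0).
    by rewrite (coords_comp (sides b) g) (coords_comp crdB g) coords_sides.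
  have mcg a : measurable_fun setT (crdB a \o g : OX -> borel (block a)).
    exact: (measurableT_comp (@mcrd a) mu).
  have msg a : measurable_fun setT (sides b a \o g : OX -> borel (pair_space X X a)).
    exact: (measurableT_comp (@measurable_sides b a) mu).
  have det w : coords (fun a => crdB a \o g) [set inr w] `<=`
      coords (fun a => crdB a \o g) (two (w |` [set` pa G w]) set0).
    apply: (determined mT mu) => {}w; apply: pmT; first exact: bnd.
    by exists w.
  (* The kernel of the pair at [v] also reads y at the parents w of [v]. By [det] these are
     functions of the pairs at w and the parents of w, all parents of [v] by transitivity. *)
  have blk : ci (fun a => sides b a \o g) PO ([set inr v] `|` [set inl v])
      (two (before r (r v)) (before r (r v))) (two [set` pa G v] [set` pa G v]).
    have := condlaw_predicts (@mT (inl v)) (@Q'T v).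
    rewrite before_inl predicts_pullback//; last first.
      by apply: coords_mono; rewrite -before_inl; exact: (@sources_before (inl v)).
    apply: predicts_weaken; rewrite -!coords_comp.
    - apply: (@subset_trans _ (coords (fun a => sides b a \o g) (two [set v] [set v]))).
        by apply: coords_mono => a [->|->].
      by rewrite sg; apply: coords_mono => -[w ->|].
    - apply: (@subset_trans _ (coords (fun a => sides b a \o g)
          (two (before r (r v)) (before r (r v))))).
        by apply: coords_mono => -[] w [//|]; exact: (pa_rank rk).
      by rewrite sg; apply: coords_mono => -[].
    - rewrite sg; apply: coords_min; first exact: (coords_sub_alg mcg).
      move=> [] w wv C mC.
        exact: (@coords_coord _ _ _ _ (fun a => crdB a \o g) (two [set` pa G v] set0) (inl w)).
      have : coords (fun a => crdB a \o g) (two (w |` [set` pa G w]) set0) ((crdB (inr w) \o g) @^-1` C).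
        by apply: det; exact: (@coords_coord _ _ _ _ (fun a => crdB a \o g) [set inr w] (inr w)).
      by apply: coords_mono => -[w' [->//|w'w]|//]; exact: tc w'w wv.
  have {}blk := ci_weak_union msg blk.
  apply: (ci_weaken blk) => //.
  - by move=> a av; left; left.
  - by move=> a [->|]; [left|case: a => w //=; right].
  - by move=> [] w /=; [move=> [->|wv]; right; [left|right]|move=> wv; right; right].
- by apply: le_trans Q'c; rewrite c'E leeDl// mule_ge0.
Qed.

End Kernels.

End Derandomize.

(** * Gluing *)

Section Triple.
Context d (Om : measurableType d) (R : realType) (P : probability Om R).
Context (V : finType) (G : digraph V) (r : V -> nat) (rk : topological_rank G r).

(* Indices of a triple (x, y, z) of random vectors: [inl (true, v)] is x_v, [inr v] is y_v
   and [inl (false, v)] is z_v. *)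
Definition tri (b : bool) (A B C : set V) (a : (bool * V) + V) : Prop :=
  match a with
  | inl (b', v) => if b' == b then A v else C v
  | inr v => B v
  end.

Lemma tri_swap b A B C : tri (~~ b) A B C = tri b C B A.
Proof. by apply/seteqP; split=> -[[b' w]|w] //=; case: b' b => -[]. Qed.

Context (S : (bool * V) + V -> ptopologicalType) (W : forall a, Om -> S a).
Hypothesis mW : forall a, measurable_fun setT (W a : Om -> borel (S a)).

Local Notation bef v := (before r (r v)).
Local Notation par v := [set` pa G v].
Local Notation ciW := (ci W P).

Hypothesis own : forall b v, ciW (tri b [set v] set0 set0) (tri b (bef v) (bef v) set0)
  (tri b (par v) set0 set0).
Hypothesis causal : forall b v, ciW (tri b [set v] set0 set0) (tri b (bef v) setT set0)
  (tri b (par v) (v |` par v) set0).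
Hypothesis middle : forall b v, ciW (tri b set0 [set v] set0) (tri b (bef v) (bef v) set0)
  (tri b set0 (par v) set0).
Hypothesis glued : forall b, ciW (tri b setT set0 set0) (tri b set0 set0 setT) (tri b set0 setT set0).

Let pab v w : w \in pa G v -> bef v w. Proof. exact: (pa_rank rk). Qed.

Local Ltac tri_sub0 := let b := fresh "b" in let w := fresh "w" in
  move=> [[b w]|w]; rewrite ?/tri ?/setU ?/set1 ?/setT ?/set0 ?/mkset;
  try (case: (b == _)); rewrite ?/before ?/mkset; tauto.

Local Ltac tri_sub v := let b := fresh "b" in let w := fresh "w" in
  move=> [[b w]|w]; rewrite ?/tri ?/setU ?/set1 ?/setT ?/set0 ?/mkset;
  try (case: (b == _)); have := @pab v w; rewrite ?/before ?/mkset; tauto.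

(** The past of x learns nothing from the future of y. By the chain rule each new x_v only calls for
    [causal], which allows all of y on the other side. *)
Lemma ci_future b n : ciW (tri b (before r n) set0 set0) (tri b set0 setT set0)
  (tri b set0 (before r n) set0).
Proof.
elim: n => [|n IHn].
  apply: ci_incl => //.
  by have -> : before r 0 = set0 by apply/seteqP; split.
have [[v rvn]|noa] := pselect (exists v, r v = n); last first.
  by rewrite before_skip// => v rv; apply: noa; exists v.
rewrite (beforeS rk.1 rvn) -rvn.
have -> : tri b (bef v `|` [set v]) set0 set0 =
    tri b [set v] set0 set0 `|` tri b (bef v) set0 set0.
  by apply/seteqP; split; tri_sub v.
apply: ci_Ul => //.
  by apply: (ci_weaken (@causal b v)); tri_sub v.
by rewrite rvn; apply: (ci_weaken IHn); tri_sub v.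
Qed.

Lemma ci_future_all b n : ciW (tri b (before r n) set0 set0) (tri b set0 setT setT)
  (tri b set0 (before r n) set0).
Proof.
have h : ciW (tri b (before r n) set0 set0) (tri b set0 set0 setT) (tri b set0 setT set0).
  by apply: (ci_weaken (@glued b)); tri_sub0.
by apply: (ci_trans mW (@ci_future b n) h); tri_sub0.
Qed.

Lemma ci_causal_all b v : ciW (tri b [set v] set0 set0) (tri b (bef v) setT setT)
  (tri b (par v) (v |` par v) set0).
Proof.
have h : ciW (tri b [set v] set0 set0 `|` tri b (bef v) set0 set0)
    (tri b set0 set0 setT) (tri b set0 setT set0).
  by apply: (ci_weaken (@glued b)); tri_sub v.
by apply: (ci_trans mW (@causal b v) (ci_weak_union mW h)); tri_sub v.
Qed.

(** The past of z depends on x only through the past of y, by [ci_future_all] for the other side;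
    hence it adds nothing on x_v to the past of (x, y), and [own] reduces that past to x at the
    parents. *)
Lemma ci_side b v : ciW (tri b [set v] set0 set0) (tri b (bef v) (bef v) (bef v))
  (tri b (par v) set0 set0).
Proof.
have := ci_sym mW (@ci_future_all (~~ b) (r v)); rewrite !tri_swap.
move=> h.
have h' : ciW (tri b [set v] set0 set0 `|` tri b (bef v) set0 set0)
    (tri b set0 set0 (bef v)) (tri b set0 (bef v) set0).
  by apply: (ci_weaken h); tri_sub v.
by apply: (ci_trans mW (@own b v) (ci_weak_union mW h')); tri_sub v.
Qed.

Lemma ci_middle b v : ciW (tri b set0 [set v] set0) (tri b (bef v) (bef v) (bef v))
  (tri b set0 (par v) set0).
Proof.
have := ci_sym mW (@ci_future_all (~~ b) (r v)); rewrite !tri_swap.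
move=> h.
have h' : ciW (tri b set0 [set v] set0 `|` tri b (bef v) set0 set0)
    (tri b set0 set0 (bef v)) (tri b set0 (bef v) set0).
  by apply: (ci_weaken h); tri_sub v.
by apply: (ci_trans mW (@middle b v) (ci_weak_union mW h')); tri_sub v.
Qed.

(** The chain rule in the order y_v, z_v, x_v: the last two are predicted with y_v known, and x_v is
    then insensitive to z_v by the gluing. *)
Lemma ci_triple b v : ciW (tri b [set v] [set v] [set v]) (tri b (bef v) (bef v) (bef v))
  (tri b (par v) (par v) (par v)).
Proof.
have -> : tri b [set v] [set v] [set v] =
    tri b [set v] set0 set0 `|` (tri b set0 set0 [set v] `|` tri b set0 [set v] set0).
  by apply/seteqP; split; tri_sub v.
apply: ci_Ul => //.
  by apply: (ci_weaken (@ci_causal_all b v)); tri_sub v.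
apply: ci_Ul => //.
  have := @ci_causal_all (~~ b) v; rewrite !tri_swap.
  by move=> h; apply: (ci_weaken h); tri_sub v.
by apply: (ci_weaken (@ci_middle b v)); tri_sub v.
Qed.

End Triple.

Section ProdUnique.
Context d1 d2 (T1 : measurableType d1) (T2 : measurableType d2) (R : realType).

Lemma prob_prod_unique (P1 P2 : probability (T1 * T2)%type R) :
  (forall A B, measurable A -> measurable B -> P1 (A `*` B) = P2 (A `*` B)) ->
  forall D, measurable D -> P1 D = P2 D.
Proof.
move=> h D mD.
apply: (measure_unique [set C | exists2 A, measurable A & exists2 B, measurable B & A `*` B = C] (fun=> setT)) => //.
- by rewrite measurable_prod_measurableType.
- move=> _ _ [A mA [B mB <-]] [A' mA' [B' mB' <-]].
  by exists (A `&` A'); [exact: measurableI|exists (B `&` B'); [exact: measurableI|rewrite setXI]].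
- by move=> _; exists setT => //; exists setT => //; rewrite setXTT.
- by apply/seteqP; split => // x _; exists 0%N.
- by move=> _ [A mA [B mB <-]]; exact: h.
- by move=> _; apply: (@le_lt_trans _ _ 1%E); [exact: probability_le1|exact: ltry].
Qed.

End ProdUnique.

(** * Gluing two couplings along their common marginal *)

Section Glue.
Context d1 d2 (A : measurableType d1) (B : measurableType d2) (R : realType).
Context (Z : ptopologicalType) (sZ : standard R Z).
Context (pi1 : probability (A * B)%type R) (pi2 : probability (B * borel Z)%type R).
Local Open Scope ereal_scope.
Hypothesis marg : forall D, measurable D -> pi1 (snd @^-1` D) = pi2 (fst @^-1` D).

(** On the space of [pi1] with an extra uniform noise, z is drawn from the kernel of [pi2] at y. The
    noise being independent of (x, y), the pair informs on z through y alone. *)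
Lemma exists_glue : exists d (Om : measurableType d) (P : probability Om R)
    (x : Om -> A) (y : Om -> B) (z : Om -> borel Z),
  [/\ measurable_fun setT x, measurable_fun setT y, measurable_fun setT z &
  [/\ forall C, measurable C -> P ((fun o => (x o, y o)) @^-1` C) = pi1 C,
      forall C, measurable C -> P ((fun o => (y o, z o)) @^-1` C) = pi2 C &
      predicts P (g_sigma_algebra_preimage z)
        (g_sigma_algebra_preimage (fun o => (x o, y o))) (g_sigma_algebra_preimage y)]].
Proof.
have [T [mT TP]] := noise_standard pi2 sZ measurable_fst measurable_snd.
have sM : sub_alg (@measurable _ B).
  split => //; split; [exact: measurable0|by move=> D; rewrite setTD; exact: measurableC|].
  by move=> F; exact: bigcupT_measurable.
have nT : sub_noise (@measurable _ B) T.
  have m2 : measurable_fun (setT : set (g_sigma_algebraType (@measurable _ B) * R))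
      (fun z => (z.1, z.2) : B * R).
    apply/measurable_fun_pairP; split => /=; last exact: measurable_snd.
    apply: (@measurableT_comp _ _ _ _ _ _ (id : g_sigma_algebraType (@measurable _ B) -> B)).
      by move=> _ D mD; rewrite setTI (measurable_sub_alg sM).
    exact: measurable_fst.
  have := measurableT_comp mT m2; rewrite /sub_noise; congr measurable_fun.
  by apply/funext => -[].
pose P : probability _ R := pi1 \x unif R.
pose x (o : (A * B) * R) := o.1.1.
pose y (o : (A * B) * R) := o.1.2.
pose z (o : (A * B) * R) := T (y o, o.2).
have mx : measurable_fun setT x by exact: (measurableT_comp measurable_fst measurable_fst).
have my : measurable_fun setT y by exact: (measurableT_comp measurable_snd measurable_fst).
have mz : measurable_fun setT z.
  by apply: (measurableT_comp mT); apply/measurable_fun_pairP; split => //; exact: measurable_snd.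
have PE D C : measurable D -> measurable C ->
    P (z @^-1` C `&` (fun o => (x o, y o)) @^-1` D) = \int[pi1]_(w in D) (kern T C w.2)%:E.
  move=> mD mC; rewrite -[LHS]/(\int[pi1]_w unif R (xsection _ w)).
  rewrite [RHS]integral_mkcond; apply: eq_integral => w _.
  rewrite patchE; case: ifPn => [|/negP]; rewrite inE => Dw.
    rewrite (kernE w.2 sM nT mC); congr (unif R _).
    apply/seteqP; split => u; rewrite /xsection/= inE/=; first by move=> [].
    by split => //; rewrite -surjective_pairing.
  rewrite (_ : xsection _ _ = set0) ?measure0//.
  by apply/seteqP; split => // u; rewrite /xsection/= inE/= -surjective_pairing => -[].
have kS C : measurable C -> measurable_fun setT (kern T C).
  by move=> mC; exact: (sig_fun_measurable sM (sub_noise_kern sM nT mC).1).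
have P1 C : measurable C -> P ((fun o => (x o, y o)) @^-1` C) = pi1 C.
  move=> mC; have -> : (fun o => (x o, y o)) @^-1` C = C `*` setT :> set (A * B * R).
    by apply/seteqP; split => -[[a b] u]//= [].
  rewrite -[LHS]/((pi1 \x unif R) (C `*` setT)) product_measure1E//.
  by rewrite -[RHS]mule1; congr (_ * _); exact: (probability_setT (unif R)).
exists _, _, P, x, y, z; split => //; split => //.
  have myz : measurable_fun setT (fun o => (y o, z o)) by exact/measurable_fun_pairP.
  move=> C mC; apply: (@prob_prod_unique _ _ _ _ R (law P myz) pi2 _ C mC) => {C mC} D C mD mC.
  have DC : P (z @^-1` C `&` (fun o => (x o, y o)) @^-1` (setT `*` D)) =
      \int[pi1]_(w in setT `*` D) (kern T C w.2)%:E.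
    by apply: PE => //; exact: measurableX.
  transitivity (P (z @^-1` C `&` (fun o => (x o, y o)) @^-1` (setT `*` D))).
    rewrite -[LHS]/(P _); congr (P _); by apply/seteqP; split => o /=; [move=> [? ?]|move=> [? []]].
  rewrite DC; transitivity (pi2 (fst @^-1` D `&` snd @^-1` C)); last first.
    by congr (pi2 _); apply/seteqP; split => -[].
  rewrite TP//; transitivity (\int[law pi1 measurable_snd]_(b in D) (kern T C b)%:E).
    rewrite integral_law_real//; last 2 first.
    - exact: kS.
    - by move=> b; exact: kern_ge0.
    by congr integral; apply/seteqP; split => -[]//= a b [].
  transitivity (\int[law pi2 measurable_fst]_(b in D) (kern T C b)%:E).
    by apply: eq_measure_integral => E mE _; exact: marg.
  rewrite integral_law_real//; last 2 first.
  - exact: kS.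
  - by move=> b; exact: kern_ge0.
  by apply: eq_integral => w _; rewrite (kernE w.1 sM nT mC).
move=> _ [C mC <-]; exists (kern T C \o y); split.
- move=> C' mC'; exists (kern T C @^-1` C'); last by rewrite setTI.
  exact: measurable_preimage (kS C mC) _ mC'.
- by move=> o; exact: kern_ge0.
move=> _ [D mD <-]; rewrite !setTI PE//.
have mxy : measurable_fun setT (fun o => (x o, y o)) by exact/measurable_fun_pairP.
transitivity (\int[law P mxy]_(w in D) (kern T C w.2)%:E).
  by apply: eq_measure_integral => E mE _; exact/esym/P1.
rewrite integral_law_real//.
- exact: (measurableT_comp (kS C mC) measurable_snd).
- by move=> o; exact: kern_ge0.
Qed.

End Glue.

Section EqMeasure.
Context d (Om : measurableType d) (R : realType) (P1 P2 : probability Om R).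
Hypothesis P12 : forall A, measurable A -> P1 A = P2 A.

Lemma predicts_eq_measure F G H : F `<=` measurable -> G `<=` measurable ->
  predicts P1 F G H -> predicts P2 F G H.
Proof.
move=> mF mG pr E FE; have [f [mf f0 fE]] := pr E FE.
exists f; split => // D GD; rewrite -P12; last first.
  by apply: measurableI; [exact: mF|exact: mG].
by rewrite fE//; apply: eq_measure_integral => A mA _; exact: P12.
Qed.

Lemma ci_eq_measure I (S : I -> ptopologicalType) (X : forall i, Om -> S i) A B C :
  (forall i, measurable_fun setT (X i : Om -> borel (S i))) ->
  ci X P1 A B C -> ci X P2 A B C.
Proof. by move=> mX; apply: predicts_eq_measure; exact: (coords_sub_alg mX _).2. Qed.

Lemma compatible_eq_measure (V : finType) (S : V -> ptopologicalType)
    (X : forall v, Om -> S v) (G : digraph V) :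
  (forall v, measurable_fun setT (X v : Om -> borel (S v))) ->
  (forall v, exists U : nat -> set (S v), countable_base U) ->
  compatible P1 X G -> compatible P2 X G.
Proof.
move=> mX US /(compatibleP P1 mX US) h; apply/(compatibleP P2 mX US) => i.
exact: ci_eq_measure.
Qed.

End EqMeasure.

Section GlueBicausal.
Context (R : realType) (V : finType) (X : V -> ptopologicalType).
Hypothesis UX : forall v, exists U : nat -> set (X v), countable_base U.
Hypothesis StX : forall v, standard R (X v).
Variables (G : digraph V) (r : V -> nat) (rk : topological_rank G r).
Hypothesis tc : transitively_closed G.

Local Notation PX := (borel (prod_space X)).
Local Notation M := (borel (prod_space (block X))).

Lemma measurable_pair_coord a : measurable_fun setT
  (@pair_coord V X X a : PX * PX -> borel (pair_space X X a)).
Proof.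
case: a => v.
  exact: (measurableT_comp (@measurable_coord V X v) measurable_fst).
exact: (measurableT_comp (@measurable_coord V X v) measurable_snd).
Qed.

Lemma pair_space_countable_base a :
  exists U : nat -> set (pair_space X X a), countable_base U.
Proof. by case: a => v; exact: UX. Qed.

Definition idx (a : (bool * V) + V) : V := match a with inl (_, v) => v | inr v => v end.

Section Coords.
Context d (Om : measurableType d) (P : probability Om R).
Variables (xz : bool -> Om -> PX) (y : Om -> PX).
Hypotheses (mxz : forall b, measurable_fun setT (xz b)) (my : measurable_fun setT y).

Definition triple (a : (bool * V) + V) (o : Om) : X (idx a) :=
  match a with inl (b, _) => xz b o | inr _ => y o end (idx a).

Let W := triple.

Lemma measurable_triple a : measurable_fun setT (W a : Om -> borel (X (idx a))).
Proof.
case: a => [[b v]|v].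
  exact: (measurableT_comp (@measurable_coord V X v) (@mxz b)).
exact: (measurableT_comp (@measurable_coord V X v) my).
Qed.

Let sW A : sub_alg (coords W A). Proof. exact: (coords_sub_alg measurable_triple). Qed.

Definition front b (o : Om) : PX * PX := (xz b o, y o).
Definition back b (o : Om) : PX * PX := (y o, xz b o).

Lemma measurable_front b : measurable_fun setT (front b).
Proof. by apply/measurable_fun_pairP; split; [exact: (@mxz b)|exact: my]. Qed.

Lemma measurable_back b : measurable_fun setT (back b).
Proof. by apply/measurable_fun_pairP; split; [exact: my|exact: (@mxz b)]. Qed.

Let mpc (f : Om -> PX * PX) (mf : measurable_fun setT f) a :
  measurable_fun setT (@pair_coord V X X a \o f : Om -> borel (pair_space X X a)).
Proof. exact: (measurableT_comp (@measurable_pair_coord a) mf). Qed.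

Lemma coords_front b A B : coords (fun a => @pair_coord V X X a \o front b) (two A B) =
  coords W (tri b A B set0).
Proof.
apply/seteqP; split; apply: coords_min => //.
- move=> [] v vA.
    by apply: (@coords_coord _ _ _ _ W (tri b A B set0) (inl (b, v))); rewrite /tri eqxx.
  exact: (@coords_coord _ _ _ _ W (tri b A B set0) (inr v)).
- exact: (coords_sub_alg (mpc (measurable_front b))).
- move=> [[b' v]|v]; rewrite /tri.
    case: eqP => // -> vA.
    exact: (@coords_coord _ _ _ _ (fun a => @pair_coord V X X a \o front b) (two A B) (inl v)).
  exact: (@coords_coord _ _ _ _ (fun a => @pair_coord V X X a \o front b) (two A B) (inr v)).
Qed.

Lemma coords_back b A B : coords (fun a => @pair_coord V X X a \o back b) (two A B) =
  coords W (tri b B A set0).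
Proof.
apply/seteqP; split; apply: coords_min => //.
- move=> [] v vA.
    exact: (@coords_coord _ _ _ _ W (tri b B A set0) (inr v)).
  by apply: (@coords_coord _ _ _ _ W (tri b B A set0) (inl (b, v))); rewrite /tri eqxx.
- exact: (coords_sub_alg (mpc (measurable_back b))).
- move=> [[b' v]|v]; rewrite /tri.
    case: eqP => // -> vA.
    exact: (@coords_coord _ _ _ _ (fun a => @pair_coord V X X a \o back b) (two A B) (inr v)).
  exact: (@coords_coord _ _ _ _ (fun a => @pair_coord V X X a \o back b) (two A B) (inl v)).
Qed.

Definition merge (o : Om) : M :=
  fun a => match a with inl v => fun b => xz b o v | inr v => y o v end.

Let crd_merge a : measurable_fun setT ((fun o => merge o a) : Om -> borel (block X a)).
Proof.
case: a => v; last exact: (@measurable_triple (inr v)).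
by apply: (measurable_to_prod (fun=> UX v)) => b; exact: (@measurable_triple (inl (b, v))).
Qed.

Let UB a : exists U : nat -> set (block X a), countable_base U.
Proof. by case: a => v; [exact: (@countable_base_prod bool (fun=> X v) (fun=> UX v))|exact: UX]. Qed.

Lemma measurable_merge : measurable_fun setT merge.
Proof. exact: (measurable_to_prod UB). Qed.

Lemma coords_merge A B : coords (fun a => @crd _ (block X) a \o merge) (two A B) =
  coords W (tri true A B A).
Proof.
apply/seteqP; split; apply: coords_min => //.
- move=> [] v vA; last exact: (@coords_coord _ _ _ _ W (tri true A B A) (inr v)).
  apply: (@sig_fun_to_prod bool (fun=> X v) (fun=> UX v) _ Om _ _ (sW _)) => b.
  by apply: (@coords_coord _ _ _ _ W (tri true A B A) (inl (b, v))); rewrite /tri; case: ifP.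
- exact: (coords_sub_alg (crd_merge)).
- move=> [[b v]|v]; rewrite /tri; last first.
    exact: (@coords_coord _ _ _ _ (fun a => @crd _ (block X) a \o merge) (two A B) (inr v)).
  rewrite if_same => vA C mC.
  have mC' := measurable_preimage (@measurable_coord _ (fun _ : bool => X v) b) mC.
  exact: (@coords_coord _ _ _ _ (fun a => @crd _ (block X) a \o merge) (two A B) (inl v) vA _ mC').
Qed.

Let msm b a : measurable_fun setT (@sides V X b a \o merge : Om -> borel (pair_space X X a)).
Proof. exact: (measurableT_comp (@measurable_sides V X b a) measurable_merge). Qed.

Lemma coords_merge_side b A : coords (fun a => @sides V X b a \o merge) (two A set0) =
  coords W (tri b A set0 set0).
Proof.
apply/seteqP; split; apply: coords_min => //.
- move=> [] v vA //.
  by apply: (@coords_coord _ _ _ _ W (tri b A set0 set0) (inl (b, v))); rewrite /tri eqxx.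
- exact: (coords_sub_alg (msm b)).
- move=> [[b' v]|v]; rewrite /tri//; case: eqP => // -> vA.
  exact: (@coords_coord _ _ _ _ (fun a => @sides V X b a \o merge) (two A set0) (inl v)).
Qed.

Hypothesis front_compatible : forall b,
  compatible (law P (measurable_front b)) (@pair_coord V X X) (causal_graph G).
Hypothesis back_compatible : forall b,
  compatible (law P (measurable_back b)) (@pair_coord V X X) (causal_graph G).
Hypothesis glue : predicts P (g_sigma_algebra_preimage (xz false))
  (g_sigma_algebra_preimage (front true)) (g_sigma_algebra_preimage y).

Local Notation bef v := (before r (r v)).
Local Notation par v := [set` pa G v].

Let mpair a := @measurable_pair_coord a.

Let single_l (v : V) : [set inl v] = two [set v] set0 :> set (V + V).
Proof. by apply/seteqP; split => [a ->//|[w|w]//= ->]. Qed.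

Let single_r (v : V) : [set inr v] = two set0 [set v] :> set (V + V).
Proof. by apply/seteqP; split => [a ->//|[w|w]//= ->]. Qed.

Let two_setU (A B C D : set V) : two A B `|` two C D = two (A `|` C) (B `|` D).
Proof. by apply/seteqP; split => -[]. Qed.

Let tri_setU b (A B C D : set V) : tri b A B set0 `|` tri b C D set0 = tri b (A `|` C) (B `|` D) set0.
Proof.
apply/seteqP; split => -[[b' w]|w]; rewrite /tri/setU/set0/mkset//; case: (b' == b) => //; tauto.
Qed.

Let ci_front b A B A' B' A'' B'' :
  ci (@pair_coord V X X) (law P (measurable_front b)) (two A B) (two A' B') (two A'' B'') ->
  ci W P (tri b A B set0) (tri b A' B' set0) (tri b A'' B'' set0).
Proof.
have [h _] := @ci_pullback _ _ Om _ _ (pair_space X X) (@pair_coord V X X) R P _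
  (measurable_front b) (two A B) (two A' B') (two A'' B'') (@mpair).
by move=> /h; rewrite /ci two_setU tri_setU !coords_front.
Qed.

Let ci_back b A B A' B' A'' B'' :
  ci (@pair_coord V X X) (law P (measurable_back b)) (two A B) (two A' B') (two A'' B'') ->
  ci W P (tri b B A set0) (tri b B' A' set0) (tri b B'' A'' set0).
Proof.
have [h _] := @ci_pullback _ _ Om _ _ (pair_space X X) (@pair_coord V X X) R P _
  (measurable_back b) (two A B) (two A' B') (two A'' B'') (@mpair).
by move=> /h; rewrite /ci two_setU tri_setU !coords_back.
Qed.

Let triple_own b v : ci W P (tri b [set v] set0 set0) (tri b (bef v) (bef v) set0)
  (tri b (par v) set0 set0).
Proof.
have [h _] := causal_compatibleE rk (@mpair) pair_space_countable_base (@front_compatible b).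
by apply: ci_front; rewrite -single_l; exact: h.
Qed.

Let triple_causal b v : ci W P (tri b [set v] set0 set0) (tri b (bef v) setT set0)
  (tri b (par v) (v |` par v) set0).
Proof.
have [_ h] := causal_compatibleE rk (@mpair) pair_space_countable_base (@back_compatible b).
by apply: ci_back; rewrite -single_r; exact: h.
Qed.

Let triple_middle b v : ci W P (tri b set0 [set v] set0) (tri b (bef v) (bef v) set0)
  (tri b set0 (par v) set0).
Proof.
have [h _] := causal_compatibleE rk (@mpair) pair_space_countable_base (@back_compatible b).
by apply: ci_back; rewrite -single_l; exact: h.
Qed.

Let sig_alg d' (T : measurableType d') (f : Om -> T) : measurable_fun setT f ->
  sub_alg (g_sigma_algebra_preimage f).
Proof.
move=> mf; split; first exact: sigma_algebra_preimage (sigma_algebra_measurable _).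
by move=> _ [D mD <-]; exact: mf.
Qed.

Let triple_glued b : ci W P (tri b setT set0 set0) (tri b set0 set0 setT) (tri b set0 setT set0).
Proof.
have h : ci W P (tri false setT set0 set0) (tri false set0 set0 setT) (tri false set0 setT set0).
  apply: predicts_weaken glue.
  - apply: coords_min; first exact: (sig_alg (@mxz false)).
    move=> [[[] v]|v]//= _ C mC; exists (crd v @^-1` C); last by rewrite setTI.
    exact: (measurable_preimage (@measurable_coord V X v) mC).
  - apply: coords_min; first exact: (sig_alg (measurable_front true)).
    move=> [[[] v]|v]//=; rewrite /setU/=.
    + move=> _ C mC; exists ((fun z => z.1 v) @^-1` C); last by rewrite setTI.
      exact: (measurable_preimage (@measurable_pair_coord (inl v)) mC).
    + by move=> [].
    + move=> _ C mC; exists ((fun z => z.2 v) @^-1` C); last by rewrite setTI.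
      exact: (measurable_preimage (@measurable_pair_coord (inr v)) mC).
  - move=> _ [D mD <-]; rewrite setTI.
    have := @sig_fun_to_prod V X UX _ Om (coords W (tri false set0 setT set0)) y (sW _).
    apply => // v.
    exact: (@coords_coord _ _ _ _ W (tri false set0 setT set0) (inr v)).
by case: b => //; have := ci_sym measurable_triple h; rewrite -!(tri_swap false).
Qed.

Let Q := law P measurable_merge.

Lemma merge_block v : ci (@crd _ (block X)) Q [set a | a = inl v \/ a = inr v]
  (two (bef v) (bef v)) (two (par v) (par v)).
Proof.
have [_ pull] := @ci_pullback _ _ Om M _ (block X) (@crd _ (block X)) R P _ measurable_merge
  [set a | a = inl v \/ a = inr v] (two (bef v) (bef v)) (two (par v) (par v))
  (fun a => @measurable_coord _ (block X) a).
apply: pull.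
have := @ci_triple _ _ _ P V G r rk _ W measurable_triple triple_causal
  triple_middle triple_glued true v.
rewrite /ci.
have -> : [set a | a = inl v \/ a = inr v] = two [set v] [set v] :> set (V + V).
  apply/seteqP; split => [a [->|->]//|[w|w]/= ->]; by [left|right].
rewrite two_setU !coords_merge; apply: predicts_weaken => //.
by apply: coords_mono => -[[b w]|w]; rewrite /tri/setU/mkset//; case: (b == true).
Qed.

Lemma merge_side b v : predicts Q (coords (@sides V X b) [set inl v])
  (coords (@crd _ (block X)) (two (bef v) (bef v)))
  (coords (@sides V X b) (two (par v) set0)).
Proof.
have sC A : sub_alg (coords (@crd _ (block X)) A).
  exact: (coords_sub_alg (fun a => @measurable_coord _ (block X) a)).
have sS A : sub_alg (coords (@sides V X b) A) by exact: (coords_sub_alg (@measurable_sides V X b)).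
have sub : coords (@sides V X b) (two (par v) set0) `<=`
    coords (@crd _ (block X)) (two (bef v) (bef v)).
  apply: (@subset_trans _ (coords (@sides V X b) (two (bef v) (bef v)))).
    by apply: coords_mono => -[w|//]; exact: (pa_rank rk).
  by rewrite coords_sides//; apply: coords_mono => -[].
have [_ pull] := @predicts_pullback _ _ Om M R P _ measurable_merge _ _ _
  (sS [set inl v]) (sC (two (bef v) (bef v))) (sS (two (par v) set0)) sub.
apply: pull.
rewrite -(coords_comp (@sides V X b) merge) -(coords_comp (@crd _ (block X)) merge).
rewrite -(coords_comp (@sides V X b) merge) coords_merge single_l !coords_merge_side.
have := @ci_side _ _ _ P V G r rk _ W measurable_triple triple_own
  triple_causal triple_glued b v.
apply: predicts_weaken => //.
by apply: coords_mono => -[[b' w]|w]; rewrite /tri/setU/mkset; [rewrite if_same => ?; case: (b' == b)|]; left.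
Qed.

End Coords.
End GlueBicausal.

(** * The resampled bicausal coupling *)

Section Bicausal.
Context (R : realType) (V : finType) (X : V -> ptopologicalType).
Hypothesis UX : forall v, exists U : nat -> set (X v), countable_base U.
Hypothesis StX : forall v, standard R (X v).
Variables (G : digraph V) (r : V -> nat) (rk : topological_rank G r).

Local Notation PX := (borel (prod_space X)).
Local Open Scope ereal_scope.

Lemma bicausalP (mu nu : probability PX R) (pi : probability (PX * PX)%type R) :
  bicausal_couplings G mu nu pi <->
  [/\ forall D, measurable D -> pi (fst @^-1` D) = mu D,
      forall D, measurable D -> pi (snd @^-1` D) = nu D,
      compatible pi (@pair_coord V X X) (causal_graph G) &
      compatible (swap_law pi) (@pair_coord V X X) (causal_graph G)].
Proof.
split; first by move=> [[[h1 h2] c1] [_ [_ c2]]]; split.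
by move=> [h1 h2 c1 c2]; split; split => //; split.
Qed.

Let mpair a := @measurable_pair_coord V X a.

Lemma bicausal_law d (Om : measurableType d) (P : probability Om R) (x y : Om -> PX)
    (mxy : measurable_fun setT (fun o => (x o, y o))) (myx : measurable_fun setT (fun o => (y o, x o)))
    (mu nu : probability PX R) :
  (forall D, measurable D -> P (x @^-1` D) = mu D) ->
  (forall D, measurable D -> P (y @^-1` D) = nu D) ->
  compatible (law P mxy) (@pair_coord V X X) (causal_graph G) ->
  compatible (law P myx) (@pair_coord V X X) (causal_graph G) ->
  bicausal_couplings G mu nu (law P mxy).
Proof.
by move=> h1 h2 c1 c2; apply/bicausalP.
Qed.

(** The glued triple carries Minkowski's inequality; [pi3] is the law of the resampled pair,
    compared with (x, z) only through its marginals and its cost. *)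
Lemma glue_bicausal (tc : transitively_closed G) (mu nu la : probability PX R) pi1 pi2 :
  bicausal_couplings G mu nu pi1 -> bicausal_couplings G nu la pi2 ->
  exists d (Om : measurableType d) (P : probability Om R) (x y z : Om -> PX),
  [/\ measurable_fun setT x, measurable_fun setT y, measurable_fun setT z &
  [/\ forall C, measurable C -> P ((fun o => (x o, y o)) @^-1` C) = pi1 C,
      forall C, measurable C -> P ((fun o => (y o, z o)) @^-1` C) = pi2 C &
  forall c : PX * PX -> \bar R, measurable_fun setT c -> (forall w, 0 <= c w) ->
    \int[P]_o c (x o, z o) < +oo ->
    exists2 pi3, bicausal_couplings G mu la pi3 &
      \int[pi3]_w c w <= \int[P]_o c (x o, z o)]].
Proof.
move=> /bicausalP[f1 s1 c1 c1'] /bicausalP[f2 s2 c2 c2'].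
have [|d [Om [P [x [y [z [mx my mz [xyE yzE gl]]]]]]]] :=
  @exists_glue _ _ _ _ R _ (standard_prod UX StX) pi1 pi2.
  by move=> D mD; rewrite s1// f2.
exists d, Om, P, x, y, z; split => //; split => // c mc c0 cfin.
pose xz (b : bool) := if b then x else z.
have mxz b : measurable_fun setT (xz b) by case: b.
(* (x, y) has law [pi1] and (z, y) has the swapped law of [pi2]: causality of [pi1] and
   anticausality of [pi2] are used here, the two other properties for [back]. *)
have fc b : compatible (law P (measurable_front mxz my b)) (@pair_coord V X X) (causal_graph G).
  case: b.
    apply: (@compatible_eq_measure _ _ R pi1 _ _ _ _ _ _ (@mpair) (pair_space_countable_base UX) c1) => A mA.
    exact/esym/xyE.
  apply: (@compatible_eq_measure _ _ R _ _ _ _ _ _ _ (@mpair) (pair_space_countable_base UX) c2') => A mA.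
  rewrite -[LHS]/(pi2 (unstable.swap @^-1` A)) -yzE//.
  by rewrite -[_ @^-1` _]setTI; exact: measurable_swap.
have bc b : compatible (law P (measurable_back mxz my b)) (@pair_coord V X X) (causal_graph G).
  case: b; last first.
    apply: (@compatible_eq_measure _ _ R pi2 _ _ _ _ _ _ (@mpair) (pair_space_countable_base UX) c2) => A mA.
    exact/esym/yzE.
  apply: (@compatible_eq_measure _ _ R _ _ _ _ _ _ _ (@mpair) (pair_space_countable_base UX) c1') => A mA.
  rewrite -[LHS]/(pi1 (unstable.swap @^-1` A)) -xyE//.
  by rewrite -[_ @^-1` _]setTI; exact: measurable_swap.
have mm := measurable_merge UX mxz my.
have Qb := merge_block UX rk bc gl.
have Qs := merge_side UX rk fc bc gl.
have mcs : measurable_fun setT (fun m => c (@side V X true m, side false m)).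
  apply: (measurableT_comp mc); apply/measurable_fun_pairP.
  by split; exact: (measurable_side UX).
have Qc : \int[law P mm]_m c (side true m, side false m) = \int[P]_o c (x o, z o).
  by rewrite ge0_integral_law.
have [|Q' [QE Q1 Q2 Q3]] := derandomize UX StX rk tc Qb Qs mc c0; first by rewrite Qc.
pose f (m : borel (prod_space (block X))) := (side true m, side false m).
pose f' (m : borel (prod_space (block X))) := (side false m, side true m).
have mf : measurable_fun setT f.
  by apply/measurable_fun_pairP; split; exact: (measurable_side UX).
have mf' : measurable_fun setT f'.
  by apply/measurable_fun_pairP; split; exact: (measurable_side UX).
have Q'c b (mg : measurable_fun setT (fun m => (side b m, side (~~ b) m))) :
    compatible (law Q' mg) (@pair_coord V X X) (causal_graph G).
  apply: (causal_compatibleI rk (@mpair) (pair_space_countable_base UX)) => v.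
    have [_ pull] := @ci_pullback _ _ _ _ _ (pair_space X X) (@pair_coord V X X) R Q' _ mg
      [set inl v] (two (before r (r v)) (before r (r v))) (two [set` pa G v] set0) (@mpair).
    exact/pull/Q1.
  have [_ pull] := @ci_pullback _ _ _ _ _ (pair_space X X) (@pair_coord V X X) R Q' _ mg
    [set inr v] (two (before r (r v)) (before r (r v))) (two (v |` [set` pa G v]) [set` pa G v]) (@mpair).
  exact/pull/Q2.
exists (law Q' mf).
  apply: (@bicausal_law _ _ Q' (side true) (side false) mf mf' mu la).
  - move=> D mD; have /= := QE true D mD.
    rewrite -[LHS]/(Q' (side true @^-1` D)) => ->.
    rewrite -[LHS]/(P (x @^-1` D)) -f1// -xyE//.
    by rewrite -[_ @^-1` _]setTI; exact: measurable_fst.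
  - move=> D mD; have /= := QE false D mD.
    rewrite -[LHS]/(Q' (side false @^-1` D)) => ->.
    rewrite -[LHS]/(P (z @^-1` D)) -s2// -yzE//.
    by rewrite -[_ @^-1` _]setTI; exact: measurable_snd.
  - exact: (Q'c true).
  - exact: (Q'c false).
by rewrite ge0_integral_law// preimage_setT -Qc.
Qed.

End Bicausal.

(** * The metric axioms *)

Section MetricMeasurable.
Context (R : realType) (T : ptopologicalType) (e : T -> T -> R) (ce : complete_metric e).
Hypothesis UT : exists U : nat -> set T, countable_base U.

Let e0 x y : 0 <= e x y. Proof. by case: ce => -[]. Qed.
Let eC x y : e x y = e y x. Proof. by case: ce => -[]. Qed.
Let eD x y z : e x z <= e x y + e y z. Proof. by case: ce => -[]. Qed.

Lemma metric_dense_seq : exists q : nat -> T, forall x r, 0 < r -> exists n, e x (q n) < r.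
Proof.
have [U [oU bU]] := UT.
pose q n := if pselect (U n !=set0) is left h then sval (cid h) else point.
exists q => x r r0.
have [|n [Ux UA]] := bU _ x (open_metric_ball ce x r); first by rewrite /= (metric_xx ce).
exists n; apply: UA; rewrite /q; case: pselect => [h|]; last by case; exists x.
exact: (svalP (cid h)).
Qed.

Lemma measurable_ball x r : measurable ([set y | e x y < r] : set (borel T)).
Proof. by apply: sub_sigma_algebra; exact: open_metric_ball. Qed.

(** The distance is below a exactly when, for some dense point and some rational s, the two
    arguments lie within s and a - s of that point: a countable union of products of balls. *)
Lemma measurable_metric : measurable_fun setT ((fun z => e z.1 z.2) : borel T * borel T -> R).
Proof.
have [q qd] := metric_dense_seq.
apply: (measurability (@RGenInftyO.G R)); first exact: RGenInftyO.measurableE.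
move=> _ [_ [a ->] <-]; rewrite setTI.
pose F (nr : nat * rat) : set (borel T * borel T) :=
  [set y | e (q nr.1) y < ratr nr.2] `*` [set y | e (q nr.1) y < a - ratr nr.2].
have -> : (fun z => e z.1 z.2) @^-1` `]-oo, a[ = \bigcup_n (if unpickle n is Some nr then F nr else set0).
  apply/seteqP; split => [[x y]|[x y] [n _]]/=; last first.
    case: unpickle => [[k s]|//] /= [xs ys]; rewrite in_itv/=.
    move: xs ys; rewrite /= => xs ys; have := eD x (q k) y; rewrite (eC x (q k)) => h; lra.
  rewrite in_itv/= => xya.
  have [k xk] := qd x ((a - e x y) / 4) ltac:(lra).
  have [s sI] : exists s : rat, ratr s \in `](e x (q k)), (a - e (q k) y)[.
    apply: rat_in_itvoo; have := eD (q k) x y; rewrite (eC (q k) x); lra.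
  move: sI; rewrite in_itv/= => /andP[s1 s2].
  by exists (pickle (k, s)) => //; rewrite pickleK; split => /=; rewrite ?(eC _ x)//; lra.
apply: bigcupT_measurable => n; case: unpickle => [nr|] /=; last exact: measurable0.
by apply: measurableX; exact: measurable_ball.
Qed.

End MetricMeasurable.

Section InfPower.
Context (R : realType) (p : R) (p1 : 1 <= p).
Local Open Scope ereal_scope.

Let p0 : (0 < p)%R. Proof. exact: lt_le_trans p1. Qed.

Lemma poweRK (x : \bar R) : 0 <= x -> (x `^ p) `^ p^-1 = x.
Proof. by move=> x0; rewrite -poweRrM mulfV ?gt_eqF// poweRe1. Qed.

Lemma poweRVK (x : \bar R) : 0 <= x -> (x `^ p^-1) `^ p = x.
Proof. by move=> x0; rewrite -poweRrM mulVf ?gt_eqF// poweRe1. Qed.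

Lemma le_poweR (x y : \bar R) q : (0 <= q)%R -> 0 <= x -> x <= y -> x `^ q <= y `^ q.
Proof.
move=> q0 x0 xy; apply: gt0_ler_poweR => //; rewrite in_itv/= ?x0 leey//.
by rewrite (le_trans x0).
Qed.

Lemma le_ereal_inf_poweR (A : set (\bar R)) t :
  (forall a, A a -> 0 <= a /\ t <= a `^ p^-1) -> t <= ereal_inf A `^ p^-1.
Proof.
move=> h; have [t0|t0] := leP t 0; first by rewrite (le_trans t0)// poweR_ge0.
rewrite -(poweRK (ltW t0)); apply: le_poweR.
- by rewrite invr_ge0 ltW.
- exact: poweR_ge0.
apply: le_ereal_inf_tmp => a /h[a0 ta].
by rewrite -(poweRVK a0); apply: le_poweR => //; exact: ltW.
Qed.

(** The infima are taken one after the other; infinite terms are set apart because each passage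
    subtracts the other term. *)
Lemma le_ereal_inf_poweRD (A B : set (\bar R)) t :
  (forall a, A a -> 0 <= a) -> (forall b, B b -> 0 <= b) ->
  (forall a b, A a -> B b -> t <= a `^ p^-1 + b `^ p^-1) ->
  t <= ereal_inf A `^ p^-1 + ereal_inf B `^ p^-1.
Proof.
move=> A0 B0 h.
have fin x : 0 <= x -> x != +oo -> x \is a @fin_num R.
  by move=> x0 xoo; rewrite ge0_fin_numE// ltey.
have hA a : A a -> t <= a `^ p^-1 + ereal_inf B `^ p^-1.
  move=> Aa; have [->|ao] := eqVneq (a `^ p^-1) +oo.
    by rewrite addye ?leey// -ltNye (lt_le_trans _ (poweR_ge0 _ _)).
  rewrite -leeBlDl ?fin ?poweR_ge0//; apply: le_ereal_inf_poweR => b Bb.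
  by split; [exact: B0|rewrite leeBlDl ?fin ?poweR_ge0//; exact: h].
have [->|bo] := eqVneq (ereal_inf B `^ p^-1) +oo.
  by rewrite addey ?leey// -ltNye (lt_le_trans _ (poweR_ge0 _ _)).
rewrite -leeBlDr ?fin ?poweR_ge0//; apply: le_ereal_inf_poweR => a Aa.
by split; [exact: A0|rewrite leeBlDr ?fin ?poweR_ge0//; exact: hA].
Qed.

End InfPower.

(** * Product and diagonal couplings *)

Section Couplings.
Context (R : realType) (V : finType) (X : V -> ptopologicalType).
Hypothesis UX : forall v, exists U : nat -> set (X v), countable_base U.
Variables (G : digraph V) (r : V -> nat) (rk : topological_rank G r).

Local Notation M := (borel (prod_space X)).
Local Notation crd := (@crd V X).
Local Notation bef v := (before r (r v)).
Local Notation par v := [set` pa G v].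
Local Open Scope ereal_scope.

Let mcrd v : measurable_fun setT (crd v : M -> borel (X v)).
Proof. exact: measurable_coord. Qed.

Lemma PG_ci (mu : probability M R) : PG G mu -> forall i, ci crd mu [set i] (bef i) (par i).
Proof.
move=> /(compatibleP mu (@mcrd) UX) h i; apply: (ci_weaken (h i)) => // j ji.
by left; exact: (nd_rank rk).
Qed.

Section Pair.
Context d (Om : measurableType d) (P : probability Om R) (x y : Om -> M).
Hypotheses (mx : measurable_fun setT x) (my : measurable_fun setT y).
Hypothesis mxy : measurable_fun setT (fun o => (x o, y o)).

Let xy o := (x o, y o).
Let F a := @pair_coord V X X a \o xy.

Let mF a : measurable_fun setT (F a : Om -> borel (pair_space X X a)).
Proof. exact: (measurableT_comp (@measurable_pair_coord V X a) mxy). Qed.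

Let sF A : sub_alg (coords F A). Proof. exact: (coords_sub_alg mF). Qed.

Lemma law_compatible :
  (forall i, ci F P (two [set i] set0) (two (bef i) (bef i)) (two (par i) set0)) ->
  (forall i, ci F P (two set0 [set i]) (two (bef i) (bef i)) (two (i |` par i) (par i))) ->
  compatible (law P mxy) (@pair_coord V X X) (causal_graph G).
Proof.
have sl (v : V) : [set inl v] = two [set v] set0 :> set (V + V).
  by apply/seteqP; split => [a ->//|[w|w]//= ->].
have sr (v : V) : [set inr v] = two set0 [set v] :> set (V + V).
  by apply/seteqP; split => [a ->//|[w|w]//= ->].
move=> hl hr; apply: (causal_compatibleI rk (@measurable_pair_coord V X) (pair_space_countable_base UX)) => v.
  have [_ pull] := @ci_pullback _ _ _ _ _ (pair_space X X) (@pair_coord V X X) R P _ mxy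
    [set inl v] (two (bef v) (bef v)) (two (par v) set0) (@measurable_pair_coord V X).
  by apply: pull; rewrite sl; exact: hl.
have [_ pull] := @ci_pullback _ _ _ _ _ (pair_space X X) (@pair_coord V X X) R P _ mxy
  [set inr v] (two (bef v) (bef v)) (two (v |` par v) (par v)) (@measurable_pair_coord V X).
by apply: pull; rewrite sr; exact: hr.
Qed.

Lemma coords_fst A : coords F (two A set0) = coords (fun v => crd v \o x) A.
Proof.
rewrite (_ : two A set0 = inl @` A); first by rewrite -(coords_reindex F (@inl V V)).
by apply/seteqP; split => [[v Av|//]|_ [v Av <-]//]; exists v.
Qed.

Lemma coords_snd A : coords F (two set0 A) = coords (fun v => crd v \o y) A.
Proof.
rewrite (_ : two set0 A = inr @` A); first by rewrite -(coords_reindex F (@inr V V)).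
by apply/seteqP; split => [[//|v Av]|_ [v Av <-]//]; exists v.
Qed.

Let two_setU (A B C D : set V) : two A B `|` two C D = two (A `|` C) (B `|` D).
Proof. by apply/seteqP; split => -[]. Qed.

Let pab i j : j \in pa G i -> bef i j. Proof. exact: (pa_rank rk). Qed.

Local Ltac two_sub i := let v := fresh "v" in
  move=> [v|v]; rewrite ?/two ?/setU ?/set1 ?/setT ?/set0 ?/mkset;
  have := @pab i v; rewrite ?/before ?/mkset; tauto.

(** Independence of x and y, by weak union and contraction, lets the other process join the past
    without changing the conditioning set. *)
Lemma independent_compatible :
  (forall i, ci (fun v => crd v \o x) P [set i] (bef i) (par i)) ->
  (forall i, ci (fun v => crd v \o y) P [set i] (bef i) (par i)) ->
  (forall A B, measurable A -> measurable B ->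
    P (x @^-1` A `&` y @^-1` B) = P (x @^-1` A) * P (y @^-1` B)) ->
  compatible (law P mxy) (@pair_coord V X X) (causal_graph G).
Proof.
move=> hx hy ind.
have hx' i : ci F P (two [set i] set0) (two (bef i) set0) (two (par i) set0).
  by rewrite /ci two_setU setU0 !coords_fst; exact: hx.
have hy' i : ci F P (two set0 [set i]) (two set0 (bef i)) (two set0 (par i)).
  by rewrite /ci two_setU setU0 !coords_snd; exact: hy.
have pre_meas (f : Om -> M) A : measurable_fun setT f ->
    coords (fun v => crd v \o f) A `<=` pre f (@measurable _ M).
  by move=> mf; rewrite coords_comp => _ [D AD <-]; exists D => //; exact: (coords_sub_alg (@mcrd) A).2.
have hxy : ci F P (two setT set0) (two set0 setT) set0.
  rewrite /ci setU0 coords_fst coords_snd => _ /(pre_meas _ _ mx)[A mA <-]; rewrite setTI.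
  exists (cst (fine (P (x @^-1` A)))); split.
  - move=> B mB; rewrite preimage_cst; case: ifP => _; first exact: sub_algT.
    by have [h _ _] := (sF set0).1.
  - by move=> o; exact: fine_ge0.
  move=> _ /(pre_meas _ _ my)[B mB <-]; rewrite setTI ind//.
  transitivity (\int[P]_(o in y @^-1` B) cst (P (x @^-1` A)) o).
    by rewrite integral_cst//; exact: measurable_preimage.
  apply: eq_integral => o _ /=; rewrite fineK// fin_num_measure//.
  exact: measurable_preimage.
have hyx := ci_sym mF hxy.
apply: law_compatible => i.
  have h : ci F P (two [set i] set0 `|` two (bef i) set0) (two set0 (bef i)) set0.
    by apply: (ci_weaken hxy); two_sub i.
  by apply: (ci_trans mF (@hx' i) (ci_weak_union mF h)); two_sub i.
have h : ci F P (two set0 [set i] `|` two set0 (bef i)) (two setT set0) set0.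
  by apply: (ci_weaken hyx); two_sub i.
have h' : ci F P (two set0 [set i]) (two setT (bef i)) (two set0 (par i)).
  by apply: (ci_trans mF (@hy' i) (ci_weak_union mF h)); two_sub i.
by apply: (ci_weaken h'); two_sub i.
Qed.

End Pair.

Let two_setU (A B C D : set V) : two A B `|` two C D = two (A `|` C) (B `|` D).
Proof. by apply/seteqP; split => -[]. Qed.

(** Shows that the infimum defining [WG] is over a nonempty set, whence its finiteness. *)
Lemma bicausal_product (mu nu : probability M R) : PG G mu -> PG G nu ->
  exists pi : probability (M * M)%type R, bicausal_couplings G mu nu pi.
Proof.
move=> Gmu Gnu; pose P : probability (M * M)%type R := mu \x nu.
have mxy : measurable_fun setT (fun o : M * M => (o.1, o.2)).
  by apply/measurable_fun_pairP; split; [exact: measurable_fst|exact: measurable_snd].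
have myx : measurable_fun setT (fun o : M * M => (o.2, o.1)).
  by apply/measurable_fun_pairP; split; [exact: measurable_snd|exact: measurable_fst].
have P1 A : measurable A -> P (fst @^-1` A) = mu A.
  move=> mA; rewrite (_ : fst @^-1` A = A `*` setT); last by apply/seteqP; split => [[]//|[? ?] []].
  rewrite -[LHS]/((mu \x nu) (A `*` setT)) product_measure1E//.
  by rewrite -[RHS]mule1; congr (_ * _); exact: (probability_setT nu).
have P2 A : measurable A -> P (snd @^-1` A) = nu A.
  move=> mA; rewrite (_ : snd @^-1` A = setT `*` A); last by apply/seteqP; split => [[]//|[? ?] []].
  rewrite -[LHS]/((mu \x nu) (setT `*` A)) product_measure1E//.
  by rewrite -[RHS]mul1e; congr (_ * _); exact: (probability_setT mu).
have ind A B : measurable A -> measurable B ->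
    P (fst @^-1` A `&` snd @^-1` B) = P (fst @^-1` A) * P (snd @^-1` B).
  move=> mA mB; rewrite P1// P2// -(product_measure1E mu nu)//.
have c1 i : ci (fun v => crd v \o fst) P [set i] (bef i) (par i).
  have [h _] := @ci_pullback _ _ _ _ _ X crd R P _ measurable_fst [set i] (bef i) (par i) (@mcrd).
  apply: h; apply: (ci_eq_measure _ (@mcrd) (PG_ci Gmu (i := i))) => A mA; exact/esym/P1.
have c2 i : ci (fun v => crd v \o snd) P [set i] (bef i) (par i).
  have [h _] := @ci_pullback _ _ _ _ _ X crd R P _ measurable_snd [set i] (bef i) (par i) (@mcrd).
  apply: h; apply: (ci_eq_measure _ (@mcrd) (PG_ci Gnu (i := i))) => A mA; exact/esym/P2.
exists (law P mxy); apply: (@bicausal_law R V X G _ _ P fst snd mxy myx mu nu P1 P2).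
  exact: (independent_compatible measurable_fst measurable_snd).
apply: (independent_compatible measurable_snd measurable_fst) => // A B mA mB.
by rewrite setIC ind// muleC.
Qed.

Let mdiag : measurable_fun setT (fun o : M => (o, o)).
Proof. by apply/measurable_fun_pairP; split; exact: measurable_id. Qed.

(** On the diagonal a copy i' equals its parent i, so only the compatibility of [mu] itself is at
    stake. *)
Lemma bicausal_identity (mu nu : probability M R) : PG G mu ->
  (forall A, measurable A -> mu A = nu A) ->
  bicausal_couplings G mu nu (law mu mdiag).
Proof.
move=> Gmu munu.
suff c : compatible (law mu mdiag) (@pair_coord V X X) (causal_graph G).
  by apply: (@bicausal_law R V X G _ _ mu id id mdiag mdiag mu nu).
have E A B : coords (fun a => @pair_coord V X X a \o (fun o : M => (o, o))) (two A B) =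
    coords crd (A `|` B).
  rewrite coordsU (_ : two A B = two A set0 `|` two set0 B); last first.
    by apply/seteqP; split => -[v|v]; rewrite /two/setU/set0/mkset; tauto.
  by rewrite coordsU (coords_fst id id) (coords_snd id id).
apply: (law_compatible (x := id) (y := id)) => i; rewrite /ci.
  rewrite two_setU !E !setU0; have := PG_ci Gmu (i := i).
  by apply: predicts_weaken => //; apply: coords_mono => j [|?]; [|left].
rewrite two_setU !E set0U.
have sub : [set i] `<=` i |` par i `|` par i by move=> j ->; left; left.
apply: predicts_incl; [exact: coords_sub_alg|exact: (coords_sub_alg (@mcrd) _).2|].
exact: coords_mono.

Qed.

End Couplings.

Section Wasserstein.
Context (R : realType) (p : R) (p1 : 1 <= p) (V : finType) (G : digraph V).
Context (X : V -> ptopologicalType) (dX : prod_space X -> prod_space X -> R).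
Hypotheses (dag : is_dag G) (PX : forall v, polish R (X v)) (cd : complete_metric dX).

Local Notation M := (borel (prod_space X)).
Local Open Scope ereal_scope.

Let UX v : exists U : nat -> set (X v), countable_base U.
Proof. exact: polish_countable_base (PX v). Qed.

Let StX v : standard R (X v). Proof. exact: polish_standard. Qed.

Let p0 : (0 < p)%R. Proof. exact: lt_le_trans p1. Qed.

Let d0 x y : (0 <= dX x y)%R. Proof. by case: cd => -[]. Qed.
Let dD x y z : (dX x z <= dX x y + dX y z)%R. Proof. by case: cd => -[]. Qed.

Let md : measurable_fun setT ((fun z => dX z.1 z.2) : M * M -> R).
Proof. exact: (measurable_metric cd (countable_base_prod UX)). Qed.

Definition cost (w : M * M) : \bar R := (dX w.1 w.2 `^ p)%:E.

Lemma measurable_cost : measurable_fun setT cost.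
Proof. by apply/measurable_EFinP; exact: measurableT_comp (measurable_powR p) md. Qed.

Lemma cost_ge0 w : 0 <= cost w.
Proof. by rewrite lee_fin powR_ge0. Qed.

Let costs (mu nu : probability M R) := [set \int[pi]_w cost w | pi in bicausal_couplings G mu nu].

Let costs_ge0 mu nu a : costs mu nu a -> 0 <= a.
Proof. by move=> [pi _ <-]; apply: integral_ge0 => w _; exact: cost_ge0. Qed.

Let norm_cost d (Om : measurableType d) (P : probability Om R) (x y : Om -> M) :
  measurable_fun setT x -> measurable_fun setT y ->
  forall pi : probability (M * M)%type R,
  (forall C, measurable C -> P ((fun o => (x o, y o)) @^-1` C) = pi C) ->
  Lnorm P p%:E (EFin \o (fun o => dX (x o) (y o))) = (\int[pi]_w cost w) `^ p^-1.
Proof.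
move=> mx my pi h; have mxy : measurable_fun setT (fun o => (x o, y o)) by exact/measurable_fun_pairP.
rewrite unlock; congr (_ `^ _); transitivity (\int[law P mxy]_w cost w).
  rewrite ge0_integral_law//; last 2 first.
  - exact: measurable_cost.
  - exact: cost_ge0.
  by apply: eq_integral => o _; rewrite /cost /= ger0_norm.
by apply: eq_measure_integral => C mC _; exact: h.
Qed.

Let measurable_metric_pair d (Om : measurableType d) (f g : Om -> M) :
  measurable_fun setT f -> measurable_fun setT g ->
  measurable_fun setT (fun o => dX (f o) (g o)).
Proof.
move=> mf mg; have mfg : measurable_fun setT (fun o => (f o, g o)) by exact/measurable_fun_pairP.
exact: (measurableT_comp md mfg).
Qed.

Lemma Lnorm_metric d (Om : measurableType d) (P : probability Om R) (x y z : Om -> M) :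
  measurable_fun setT x -> measurable_fun setT y -> measurable_fun setT z ->
  Lnorm P p%:E (EFin \o (fun o => dX (x o) (z o))) <=
  Lnorm P p%:E (EFin \o (fun o => dX (x o) (y o))) +
  Lnorm P p%:E (EFin \o (fun o => dX (y o) (z o))).
Proof.
move=> mx my mz.
have mp (f : Om -> R) : measurable_fun setT f ->
    measurable_fun setT (fun o => `|(EFin \o f) o| `^ p).
  move=> mf; apply/measurable_EFinP; apply: (measurableT_comp (measurable_powR p)).
  exact: measurableT_comp.
apply: (@le_trans _ _ (Lnorm P p%:E (EFin \o ((fun o => dX (x o) (y o)) \+ (fun o => dX (y o) (z o)))%R))).
  rewrite unlock; apply: le_poweR.
  - by rewrite invr_ge0 ltW.
  - by apply: integral_ge0 => o _; exact: poweR_ge0.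
  apply: ge0_le_integral => //.
  - by move=> o _; exact: poweR_ge0.
  - exact: (mp _ (measurable_metric_pair mx mz)).
  - exact: (mp _ (measurable_funD (measurable_metric_pair mx my) (measurable_metric_pair my mz))).
  move=> o _ /=; rewrite !ger0_norm ?addr_ge0// lee_fin ge0_ler_powR// ?nnegrE ?addr_ge0//.
  exact: ltW.
by apply: minkowski_EFin => //; exact: measurable_metric_pair.
Qed.

Lemma WG_triangle (tc : transitively_closed G) (mu nu la : probability M R) :
  WG G dX p mu la <= WG G dX p mu nu + WG G dX p nu la.
Proof.
have [r rk] := exists_rank dag.
apply: (le_ereal_inf_poweRD p1 (A := costs mu nu) (B := costs nu la)) => //; try exact: costs_ge0.
move=> _ _ [pi1 b1 <-] [pi2 b2 <-].
have [d [Om [P [x [y [z [mx my mz [xyE yzE h]]]]]]]] := glue_bicausal UX StX rk tc b1 b2.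
rewrite -(norm_cost mx my xyE) -(norm_cost my mz yzE).
have := Lnorm_metric P mx my mz.
set N1 := Lnorm _ _ (_ \o (fun o => dX (x o) (y o))).
set N2 := Lnorm _ _ (_ \o (fun o => dX (y o) (z o))) => le.
have [->|N1o] := eqVneq N1 +oo.
  by rewrite addye ?leey// -ltNye (lt_le_trans _ (Lnorm_ge0 _ _ _)).
have [->|N2o] := eqVneq N2 +oo.
  by rewrite addey ?leey// -ltNye (lt_le_trans _ (Lnorm_ge0 _ _ _)).
have mxz : measurable_fun setT (fun o => (x o, z o)) by exact/measurable_fun_pairP.
move: le; rewrite (norm_cost (pi := law P mxz) mx mz)//.
rewrite (ge0_integral_law P mxz measurableT measurable_cost cost_ge0) preimage_setT => le.
(* Once infinite norms are excluded, Minkowski's inequality gives the finiteness that the resampling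
   requires. *)
have fin : \int[P]_o cost (x o, z o) < +oo.
  apply: (@lty_poweRy _ _ p^-1); first by rewrite invr_neq0// gt_eqF.
  by apply: le_lt_trans le _; rewrite lte_add_pinfty// ltey.
have [pi3 b3 c3] := h cost measurable_cost cost_ge0 fin.
apply: le_trans le; apply: le_poweR.
- by rewrite invr_ge0 ltW.
- by apply: le_ereal_inf_tmp => a; exact: costs_ge0.
by apply: le_trans c3; apply: ereal_inf_lbound; exists pi3.
Qed.

Let dC x y : dX x y = dX y x. Proof. by case: cd => -[]. Qed.

Let mpair a := @measurable_pair_coord V X a.

Let mswap : measurable_fun setT (@unstable.swap M M). Proof. exact: measurable_swap. Qed.

Let bicausal_swap (mu nu : probability M R) (pi : probability (M * M)%type R) : bicausal_couplings G mu nu pi ->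
  bicausal_couplings G nu mu (law pi mswap).
Proof.
move=> /bicausalP[h1 h2 c1 c2]; apply/bicausalP; split => //.
apply: (@compatible_eq_measure _ _ R pi _ _ _ _ _ _ (@mpair) (pair_space_countable_base UX) c1) => A mA.
rewrite -[RHS]/(pi (unstable.swap @^-1` (unstable.swap @^-1` A))); congr (pi _).
by apply/seteqP; split => -[].
Qed.

Lemma WG_sym (mu nu : probability M R) : WG G dX p mu nu = WG G dX p nu mu.
Proof.
suff le mu' nu' : ereal_inf (costs mu' nu') <= ereal_inf (costs nu' mu').
  by congr (_ `^ _); apply/eqP; rewrite eq_le; apply/andP; split; exact: le.
apply: le_ereal_inf_tmp => _ [pi b <-].
apply: ereal_inf_lbound; exists (law pi mswap); first exact: bicausal_swap.
rewrite (ge0_integral_law pi mswap measurableT measurable_cost cost_ge0).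
by apply: eq_integral => -[x y] _; rewrite /cost/= dC.
Qed.

Let costs_lb mu nu a : costs mu nu a -> WG G dX p mu nu <= a `^ p^-1.
Proof.
move=> ca; apply: le_poweR.
- by rewrite invr_ge0 ltW.
- by apply: le_ereal_inf_tmp => b; exact: costs_ge0.
- exact: ereal_inf_lbound.
Qed.

(** For the product coupling, Minkowski's inequality is applied twice through the constant maps x0
    and y0. *)
Lemma WG_lty (mu nu : probability M R) : PpG G dX p mu -> PpG G dX p nu ->
  WG G dX p mu nu < +oo.
Proof.
move=> [Gmu [x0 mux0]] [Gnu [y0 nuy0]].
have [r rk] := exists_rank dag.
have [pi bpi] := bicausal_product UX rk Gmu Gnu.
apply: (@le_lt_trans _ _ ((\int[pi]_w cost w) `^ p^-1)); first by apply: costs_lb; exists pi.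
rewrite -(norm_cost (P := pi) measurable_fst measurable_snd); last first.
  by move=> C mC; congr (pi _); apply/seteqP; split => -[].
have marg (f : M * M -> M) (mf : measurable_fun setT f) (la : probability M R) z0 :
    (forall D, measurable D -> pi (f @^-1` D) = la D) ->
    \int[la]_x (dX x z0 `^ p)%:E < +oo ->
    Lnorm pi p%:E (EFin \o (fun o => dX (f o) z0)) < +oo.
  move=> fE fin.
  have mz : measurable_fun setT (fun x : M => dX x z0).
    exact: (@measurable_metric_pair _ M id (cst z0) (@measurable_id _ M setT) (@measurable_cst _ _ M M setT z0)).
  rewrite unlock; apply: poweR_lty.
  suff -> : \int[pi]_o `|(EFin \o (fun o => dX (f o) z0)) o| `^ p = \int[la]_x (dX x z0 `^ p)%:E by [].
  transitivity (\int[law pi mf]_x (dX x z0 `^ p)%:E); last first.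
    by apply: eq_measure_integral => D mD _; exact: fE.
  rewrite ge0_integral_law//; last 2 first.
  - by apply/measurable_EFinP; exact: (measurableT_comp (measurable_powR p) mz).
  - by move=> x; rewrite lee_fin powR_ge0.
  by apply: eq_integral => o _ /=; rewrite ger0_norm.
have [f1 s1 _ _] := (bicausalP G mu nu pi).1 bpi.
have mc z : measurable_fun setT (cst z : M * M -> M) by exact: measurable_cst.
apply: (le_lt_trans (Lnorm_metric pi measurable_fst (mc x0) measurable_snd)).
apply: lte_add_pinfty; first exact: marg mux0.
apply: (le_lt_trans (Lnorm_metric pi (mc x0) (mc y0) measurable_snd)).
apply: lte_add_pinfty.
  rewrite unlock; apply: poweR_lty.
  suff -> : \int[pi]_o `|(EFin \o (fun o => dX (cst x0 o) (cst y0 o))) o| `^ p = (dX x0 y0 `^ p)%:E.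
    exact: ltry.
  transitivity (\int[pi]_o cst ((dX x0 y0 `^ p)%:E) o).
    by apply: eq_integral => o _ /=; rewrite ger0_norm.
  by rewrite integral_cst// -[RHS]mule1; congr (_ * _); exact: (probability_setT pi).
rewrite (eq_Lnorm _ _ (g := EFin \o (fun o : M * M => dX o.2 y0))); last by move=> o /=; rewrite dC.
exact: marg nuy0.
Qed.

(** [O] is exhausted by the sets [F n] of points whose ball of radius 1/(n+1) stays in [O]. A
    coupling of small cost sends [F n] into [O] up to a small probability. *)
Let WG0_open (mu nu : probability M R) (O : set (prod_space X)) :
  WG G dX p mu nu = 0 -> open O -> mu O <= nu O.
Proof.
move=> W0 oO.
have inf0 : ereal_inf (costs mu nu) = 0.
  apply: poweR_eq0_eq0 W0; apply: le_ereal_inf_tmp => b; exact: costs_ge0.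
have mO : measurable (O : set M) by exact: sub_sigma_algebra.
pose F n : set M := [set x | forall y, (dX x y < n.+1%:R^-1)%R -> O y].
have mF n : measurable (F n).
  rewrite -[F n]setCK; apply: measurableC; apply: sub_sigma_algebra.
  rewrite (_ : ~` F n = \bigcup_(y in ~` O) [set x | (dX y x < n.+1%:R^-1)%R]).
    by apply: bigcup_open => y _; exact: open_metric_ball.
  apply/seteqP; split => [x /=|x [y nOy yx] /= Fx]; last by apply/nOy/Fx; rewrite dC.
  by move=> /existsNP[y /not_implyP[xy nOy]]; exists y => //=; rewrite dC.
have FO : O = \bigcup_n F n :> set M.
  apply/seteqP; split => [x Ox|x [n _]]; last first.
    by apply; rewrite (metric_xx cd) invr_gt0 ltr0n.
  have /(metric_nbhsP cd)[e e0 eO] : nbhs x O by exact: open_nbhs_nbhs.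
  have [n ne] : exists n, (n.+1%:R^-1 < e)%R.
    exists (Num.trunc e^-1); rewrite invf_plt ?posrE ?ltr0n//.
    exact: truncnS_gt.
  by exists n => // y xy; apply: eO; exact: lt_trans ne.
have FnO n : mu (F n) <= nu O.
  apply/lee_addgt0Pr => e e0.
  (* The least cost of a pair at distance at least 1/(n+1); a total cost below [e * de] leaves
     probability at most e for such pairs, by Markov's inequality. *)
  pose de := (n.+1%:R^-1 `^ p)%R : R.
  have de0 : (0 < de)%R by rewrite powR_gt0// invr_gt0 ltr0n.
  have : ereal_inf (costs mu nu) < (e * de)%:E by rewrite inf0 lte_fin mulr_gt0.
  move=> /ereal_inf_lt[_ [pi /bicausalP[f1 s1 _ _] <-] pie].
  pose B : set (M * M) := ~` [set w | (dX w.1 w.2 < n.+1%:R^-1)%R].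
  have mB : measurable B by apply: measurableC; exact: measurable_lt_set.
  have Be : pi B <= e%:E.
    have : de%:E * pi B <= (e * de)%:E.
      apply: le_trans (ltW pie).
      have -> : de%:E * pi B = \int[pi]_w (de%:E * (\1_B w)%:E).
        rewrite ge0_integralZl//; last 2 first.
        - by apply/measurable_EFinP.
        - by rewrite lee_fin ltW.
        by rewrite integral_indic// setIT.
      apply: ge0_le_integral => //.
      - by move=> w _; rewrite mule_ge0// lee_fin// ltW.
      - by apply: measurable_funeM; apply/measurable_EFinP.
      - exact: measurable_cost.
      move=> w _; rewrite indicE; case: (boolP (w \in B)) => wB; last by rewrite mule0; exact: cost_ge0.
      have dw : (n.+1%:R^-1 <= dX w.1 w.2)%R by rewrite leNgt; apply/negP; move: wB; rewrite inE.
      rewrite mule1 lee_fin; apply: ge0_ler_powR dw; rewrite ?nnegrE ?invr_ge0//.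
      exact: ltW.
    by rewrite mulrC EFinM lee_pmul2l.
  rewrite -f1// -s1//; apply: (@le_trans _ _ (pi ((snd @^-1` O) `|` B))).
    apply: le_measure; rewrite ?inE.
    - exact: (measurable_preimage measurable_fst).
    - by apply: measurableU => //; exact: (measurable_preimage measurable_snd).
    - move=> [x y] /= Fx; have [xy|xy] := pselect (dX x y < n.+1%:R^-1)%R; [left|by right].
      exact: Fx.
  apply: le_trans (leeD2l _ Be).
  by apply: measureU2 => //; exact: (measurable_preimage measurable_snd).
have cF : mu \o F @ \oo --> mu (\bigcup_n F n).
  apply: nondecreasing_cvg_mu => //; first by rewrite -FO.
  move=> m n mn; apply/subsetPset => x Fx y xy; apply: Fx; apply: lt_le_trans xy _.
  by rewrite lef_pV2 ?posrE ?ltr0n// ler_nat ltnS.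
rewrite [X in mu X]FO -(cvg_lim _ cF)//; apply: lime_le; first by apply/cvg_ex; eexists; exact: cF.
exact: nearW.
Qed.

Lemma WG_eq0 (mu nu : probability M R) : PpG G dX p mu -> PpG G dX p nu ->
  WG G dX p mu nu = 0 <-> measure_eq mu nu.
Proof.
move=> [Gmu _] _; have [r rk] := exists_rank dag; split => [W0|E].
  move=> A mA; apply: (@g_sigma_algebra_measure_unique _ R M (@open (prod_space X)) _ (fun=> setT) _ _ mu nu _ _ _ A mA).
  - exact: sub_sigma_algebra.
  - by move=> _; exact: openT.
  - by apply/seteqP; split => // x _; exists 0%N.
  - exact: openI.
  - move=> O oO; apply/eqP; rewrite eq_le; apply/andP; split; first exact: WG0_open.
    by apply: WG0_open => //; rewrite WG_sym.
  - by move=> _; apply: (@le_lt_trans _ _ 1); [exact: probability_le1|exact: ltry].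
apply/eqP; rewrite eq_le poweR_ge0 andbT.
have := bicausal_identity UX rk Gmu E; set pi := law _ _ => bpi.
have -> : 0 = (0 : \bar R) `^ p^-1 by rewrite poweR0r// invr_neq0// gt_eqF.
apply: costs_lb; exists pi => //.
rewrite ge0_integral_law//; [|exact: measurable_cost|exact: cost_ge0].
by apply: integral0_eq => x _; rewrite /cost/= (metric_xx cd) powR0// gt_eqF.
Qed.

Lemma WG_metric (tc : transitively_closed G) : metric_on (PpG G dX p) (WG G dX p).
Proof.
split.
- by move=> mu nu Pmu Pnu; rewrite poweR_ge0/= WG_lty.
- by move=> mu nu Pmu Pnu; exact: WG_eq0.
- by move=> mu nu _ _; exact: WG_sym.
- by move=> mu nu la _ _ _; exact: WG_triangle.
Qed.

End Wasserstein.

(** * The counterexample *)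

Section FourPoints.
Variable R : realType.
Local Open Scope ereal_scope.

Let quarter_ge0 : (0 <= 4^-1 :> R)%R. Proof. by rewrite invr_ge0. Qed.

(* The uniform law on {0, 1, 2, 3}, seen as two independent fair coins: the binary digits. *)
Definition four_points : set nat -> \bar R :=
  msum (fun n : nat => mscale (NngNum quarter_ge0) (dirac n : {measure set nat -> \bar R})) 4.

HB.instance Definition _ := Measure.on four_points.

Lemma four_pointsE (A : set nat) : four_points A =
  (((0%N \in A)%:R + (1%N \in A)%:R + (2%N \in A)%:R + (3%N \in A)%:R) / 4 : R)%:E.
Proof.
rewrite -[LHS]/(\sum_(n < 4) (4^-1)%:E * (\1_A (n : nat))%:E).
rewrite !big_ord_recl big_ord0 /= /bump /= !indicE adde0.
by rewrite -!EFinM -!EFinD; congr EFin; lra.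
Qed.

Let four_pointsT : four_points setT = 1.
Proof. by rewrite four_pointsE !in_setT /=; congr EFin; lra. Qed.

HB.instance Definition _ := Measure_isProbability.Build _ _ R four_points four_pointsT.

Definition coins : probability nat R := four_points.

Lemma coinsE (A : set nat) : coins A =
  (((0%N \in A)%:R + (1%N \in A)%:R + (2%N \in A)%:R + (3%N \in A)%:R) / 4 : R)%:E.
Proof. exact: four_pointsE. Qed.

(* [E] is independent of the first coin: it has the same weight on both sides. *)
Lemma coins_indep (E D : set nat) :
  (0%N \in E = (1%N \in E)) /\ (2%N \in E = (3%N \in E)) \/
  (0%N \in E = (3%N \in E)) /\ (1%N \in E = (2%N \in E)) ->
  0%N \in D = (2%N \in D) -> 1%N \in D = (3%N \in D) ->
  coins (E `&` D) = coins E * coins D.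
Proof.
move=> hE d02 d13; rewrite !coinsE !in_setI d02 d13 -EFinM; congr EFin.
by case: hE => -[-> ->]; do ![case: (_ \in _)] => /=; lra.
Qed.

End FourPoints.

Section CoinCI.
Context (R : realType) (I : Type) (S : I -> ptopologicalType) (F : forall a, nat -> S a).
Hypothesis mS1 : forall a (x : S a), measurable ([set x] : set (borel (S a))).
Local Open Scope ereal_scope.

Lemma measurable_from_nat d (T : measurableType d) (f : nat -> T) : measurable_fun setT f.
Proof. by []. Qed.

Let sF A : sub_alg (coords F A).
Proof. by apply: coords_sub_alg => a; exact: measurable_from_nat. Qed.

Let coords_mem A E n m : coords F A E -> (forall a, A a -> F a n = F a m) -> (n \in E) = (m \in E).
Proof.
move=> AE nm; apply/idP/idP; rewrite !inE; apply: (coords_agree AE) => // a Aa.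
by rewrite nm.
Qed.

Let ci_indep A B C : (forall E D, coords F A E -> coords F (B `|` C) D ->
    coins R (E `&` D) = coins R E * coins R D) -> ci F (coins R) A B C.
Proof.
move=> h E AE; exists (cst (fine (coins R E))); split.
- move=> D mD; rewrite preimage_cst; case: ifP => _; first exact: sub_algT.
  by have [h0 _ _] := (sF C).1.
- by move=> o; exact: fine_ge0.
- move=> D AD; rewrite h//; transitivity (\int[coins R]_(o in D) cst (coins R E) o).
    by rewrite integral_cst.
  by apply: eq_integral => o _ /=; rewrite fineK// fin_num_measure.
Qed.

Lemma ci_const A B C : (forall a, A a -> forall n m, F a n = F a m) -> ci F (coins R) A B C.
Proof.
move=> cA; apply: ci_indep => E D AE _.
have [[n En]|nE] := pselect (exists n, E n); last first.
  have -> : E = set0 by apply/seteqP; split => // n En; apply: nE; exists n.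
  by rewrite set0I measure0 mul0e.
have -> : E = setT.
  apply/seteqP; split => // m _.
  by apply: (coords_agree AE) En => a Aa; exact: cA.
by rewrite setTI (probability_setT (coins R)) mul1e.
Qed.

Lemma ci_const_rest A B C : (forall a, (B `|` C) a -> forall n m, F a n = F a m) ->
  ci F (coins R) A B C.
Proof.
move=> cA; apply: ci_indep => E D _ AD.
have [[n Dn]|nD] := pselect (exists n, D n); last first.
  have -> : D = set0 by apply/seteqP; split => // n Dn; apply: nD; exists n.
  by rewrite setI0 measure0 mule0.
have -> : D = setT.
  apply/seteqP; split => // m _.
  by apply: (coords_agree AD) Dn => a Aa; exact: cA.
by rewrite setIT (probability_setT (coins R)) mule1.
Qed.

(** On the four points, the coordinates in [A] read the second coin only, or the xor of the coins
    only, while the others read the first coin, which is independent of either. *)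
Lemma ci_balanced A B C :
  (forall a, A a -> F a 0%N = F a 1%N /\ F a 2%N = F a 3%N) \/
  (forall a, A a -> F a 0%N = F a 3%N /\ F a 1%N = F a 2%N) ->
  (forall a, (B `|` C) a -> forall n m, odd n = odd m -> F a n = F a m) ->
  ci F (coins R) A B C.
Proof.
move=> hA hB; apply: ci_indep => E D AE BD; apply: coins_indep.
- case: hA => hA; [left|right].
    by split; apply: (coords_mem AE) => a /hA[].
  by split; apply: (coords_mem AE) => a /hA[].
- by apply: (coords_mem BD) => a /hB; apply.
- by apply: (coords_mem BD) => a /hB; apply.
Qed.

(** An event of [A] is a countable union of joint fibres of the coordinates [b] and [c], hence known
    from [C]. *)
Lemma ci_function A B C b c : C b -> C c ->
  (forall n m, F b n = F b m -> F c n = F c m -> forall a, A a -> F a n = F a m) ->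
  ci F (coins R) A B C.
Proof.
move=> Cb Cc h; apply: predicts_incl => // E AE.
have -> : E = \bigcup_n (if n \in E then F b @^-1` [set F b n] `&` F c @^-1` [set F c n] else set0).
  apply/seteqP; split => [n En|m [n _]].
    by exists n => //; rewrite mem_set.
  case: ifP => //; rewrite inE => En [/= bm cm].
  by apply: (coords_agree AE) En => a Aa; apply/esym/h.
have [_ _ sU] := (sF C).1; apply: sU => n; case: ifP => _; last by have [] := (sF C).1.
apply: (sub_algI (sF C)).
  exact: (@coords_coord _ _ _ _ F C b Cb _ (mS1 _)).
exact: (@coords_coord _ _ _ _ F C c Cc _ (mS1 _)).
Qed.

End CoinCI.

Section Discrete.
Context (R : realType).

Definition discrete_dist (m n : nat) : R := (m != n)%:R.

Lemma polish_nat : polish R nat.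
Proof.
split.
  exists setT; first exact: countableP.
  by move=> O [n On] _; exists n.
exists discrete_dist; split.
- rewrite /discrete_dist; split.
  + by move=> m n; rewrite ler0n.
  + move=> m n; split; last by move=> ->; rewrite eqxx.
    by case: eqP => //= _ /eqP; rewrite oner_eq0.
  + by move=> m n; rewrite eq_sym.
  + move=> m n l; rewrite -natrD ler_nat.
    by case: (eqVneq m l) => //= ml; case: (eqVneq m n) => //= mn; case: (eqVneq n l) => // nl; rewrite mn nl eqxx in ml.
- move=> n; rewrite nbhs_principalE; apply/funext => A; apply/propext.
  rewrite /nbhs_ball_ /principal_filter /filter_from/=; split.
    move=> An; exists 1 => // m /=; rewrite /discrete_dist.
    by case: eqP => [<- _|_] /=; [exact: An|rewrite ltxx].
  by move=> [e e0 eA] _ ->; apply: eA; rewrite /= /discrete_dist eqxx.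
- move=> u cu; have [N uN] := cu 1 ltr01; exists (u N) => A /=.
  rewrite nbhs_principalE => AuN; exists N => // n /= Nn.
  have := uN N n (leqnn N) Nn; rewrite /discrete_dist.
  by case: eqP => [<- _|_] /=; [exact: AuN|rewrite ltxx].
Qed.

Lemma measurable_nat1 (n : nat) : measurable ([set n] : set (borel nat)).
Proof. by apply: sub_sigma_algebra; exact: discrete_open. Qed.

End Discrete.

Section TrivialConditioning.
Context d (Om : measurableType d) (R : realType) (P : probability Om R).
Context (I : Type) (S : I -> ptopologicalType) (F : forall i, Om -> S i).
Hypothesis mF : forall i, measurable_fun setT (F i : Om -> borel (S i)).
Local Open Scope ereal_scope.

(** On [N] the coordinates in [C] are constant, so the conditional probability, being a function of
    them, is almost surely a constant. *)
Lemma ci_independent A B C N : measurable N -> P (~` N) = 0 ->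
  (forall o o', N o -> N o' -> forall i, C i -> F i o = F i o') ->
  ci F P A B C -> forall E D, coords F A E -> coords F B D ->
  P (E `&` D) = P E * P D.
Proof.
move=> mN N0 NC h E D AE BD; have [f [mf f0 fE]] := h E AE.
have sB := coords_sub_alg mF B.
have sC := coords_sub_alg mF C.
have sBC := coords_sub_alg mF (B `|` C).
have [exN|nN] := pselect (exists o, N o); last first.
  have nNT : ~` N = setT by apply/seteqP; split => // o _ No; apply: nN; exists o.
  by move: N0; rewrite nNT (probability_setT P) => -[] /eqP; rewrite oner_eq0.
case: exN => o0 No0.
have fc : {ae P, forall o, f o = f o0}.
  exists (~` N); split; [exact: measurableC|exact: N0|].
  move=> o /= ne No; apply: ne.
  have mo : coords F C (f @^-1` [set f o0]) by apply: mf; exact: measurable_set1.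
  exact: (coords_agree mo (@NC o0 o No0 No) erefl).
have intE D' : coords F (B `|` C) D' -> P (E `&` D') = (f o0)%:E * P D'.
  move=> BD'; rewrite fE//; transitivity (\int[P]_(o in D') (cst (f o0) o)%:E).
    by apply: ae_eq_integral_real => //; [exact: sBC.2|exact: sig_fun_measurable sC mf].
  rewrite -[LHS]/(\int[P]_(o in D') cst (f o0)%:E o) integral_cst//; exact: sBC.2.
rewrite intE; last by apply: coords_mono BD => i; left.
congr (_ * _); have := intE setT (sub_algT sBC).
by rewrite setIT (probability_setT P) mule1.
Qed.

End TrivialConditioning.

(** * A truncated graph distance *)

Section Hops.
Context (T : Type) (adj : T -> T -> Prop).
Hypothesis adjC : forall x y, adj x y -> adj y x.

(* The graph distance, truncated at 3. *)
Definition hops (x y : T) : nat :=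
  if `[< x = y >] then 0 else if `[< adj x y >] then 1
  else if `[< exists w, adj x w /\ adj w y >] then 2 else 3.

Lemma hops0 x y : hops x y = 0%N <-> x = y.
Proof. by rewrite /hops; split => [|->]; do ![case: asboolP => //]. Qed.

Lemma hops1 x y : hops x y = 1%N -> adj x y.
Proof. by rewrite /hops; do ![case: asboolP => //]. Qed.

Lemma hops_le3 x y : (hops x y <= 3)%N.
Proof. by rewrite /hops; do ![case: asboolP => //]. Qed.

Lemma hopsC x y : hops x y = hops y x.
Proof.
rewrite /hops.
have -> : `[< x = y >] = `[< y = x >] by apply/asboolP/asboolP.
have -> : `[< adj x y >] = `[< adj y x >] by apply/asboolP/asboolP; exact: adjC.
have -> // : `[< exists w, adj x w /\ adj w y >] = `[< exists w, adj y w /\ adj w x >].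
by apply/asboolP/asboolP => -[w [h1 h2]]; exists w; split; exact: adjC.
Qed.

(** If both distances are positive and one exceeds 1, their sum already reaches the cap 3; two
    single steps form a path of length two. *)
Lemma hops_triangle x y z : (hops x z <= hops x y + hops y z)%N.
Proof.
case xy : (hops x y) => [|[|n]].
- by move/hops0: xy => ->.
- case yz : (hops y z) => [|[|m]].
  + by move/hops0: yz => <-; rewrite xy.
  + rewrite /hops; do ![case: asboolP => //] => nex _ _; case: nex; exists y.
    by split; exact: hops1.
  + by rewrite (leq_trans (hops_le3 x z)).
- case yz : (hops y z) => [|m].
    by move/hops0: yz => <-; rewrite xy addn0.
  by rewrite (leq_trans (hops_le3 x z))// addSn addnS ltnS ltnS.
Qed.

End Hops.

Section HopsMetric.
Context (R : realType) (T : topologicalType) (adj : T -> T -> Prop).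
Hypothesis adjC : forall x y, adj x y -> adj y x.
Hypothesis discr : forall (x : T) (A : set T), A x -> nbhs x A.

Let hopsR_lt1 x y : (hops adj x y)%:R < (1 : R) -> x = y.
Proof. by rewrite ltrn1 ltnS leqn0 => /eqP/hops0. Qed.

(** Distances are integers: balls of radius 1 are points, so the topology is discrete and Cauchy
    sequences are eventually constant. *)
Lemma hops_complete_metric : complete_metric (fun x y : T => (hops adj x y)%:R : R).
Proof.
have hxx x : hops adj x x = 0%N by apply/hops0.
split.
- split.
  + by move=> x y; rewrite ler0n.
  + move=> x y; split; last by move=> ->; rewrite hxx.
    by move/eqP; rewrite pnatr_eq0 => /eqP/hops0.
  + by move=> x y; rewrite hopsC.
  + by move=> x y z; rewrite -natrD ler_nat; exact: hops_triangle.
- move=> x; apply/funext => A; apply/propext; split.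
    by move=> /nbhs_singleton Ax; exists 1; [exact: ltr01|move=> y /= /hopsR_lt1 <-].
  by move=> [e e0 eA]; apply: discr; apply: eA; rewrite /= hxx.
- move=> u cu; have [N uN] := cu 1 ltr01; exists (u N) => A /nbhs_singleton AuN.
  exists N => // n /= Nn; have /hopsR_lt1 <- // := uN N n (leqnn N) Nn.
Qed.

End HopsMetric.

(** * Three laws along a path without its shortcut *)

Section Counterexample.
Context (R : realType) (V : finType) (G : digraph V) (r : V -> nat) (rk : topological_rank G r).
Variables (i j k : V) (ij : i \in pa G j) (jk : j \in pa G k) (nik : i \notin pa G k).

Definition nats (v : V) : ptopologicalType := nat.
Local Notation M := (borel (prod_space nats)).
Local Notation bef v := (before r (r v)).
Local Notation par v := [set` pa G v].

Let Unats v : exists U : nat -> set (nats v), countable_base U.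
Proof. exact: polish_countable_base (polish_nat R). Qed.

Let rij : (r i < r j)%N. Proof. exact: (pa_rank rk ij). Qed.
Let rjk : (r j < r k)%N. Proof. exact: (pa_rank rk jk). Qed.
Let nji : (j == i) = false. Proof. by apply/eqP => ji; move: rij; rewrite ji ltnn. Qed.
Let nkj : (k == j) = false. Proof. by apply/eqP => kj; move: rjk; rewrite kj ltnn. Qed.
Let nki : (k == i) = false.
Proof. by apply/eqP => ki; move: (ltn_trans rij rjk); rewrite ki ltnn. Qed.

Definition vec (a b c : nat) : M :=
  fun v => if v == i then a else if v == j then b else if v == k then c else 0%N.

Let vec_i a b c : vec a b c i = a. Proof. by rewrite /vec eqxx. Qed.
Let vec_j a b c : vec a b c j = b. Proof. by rewrite /vec nji eqxx. Qed.
Let vec_k a b c : vec a b c k = c. Proof. by rewrite /vec nki nkj eqxx. Qed.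

Definition coin1 (n : nat) : nat := odd n.

Section Pair.
Variables (g1 g2 h1 h2 : nat -> nat).
Hypothesis g1P : (forall n m, g1 n = g1 m) \/ g1 = coin1.
Hypothesis g2P : (forall n m, g2 n = g2 m) \/ g2 = coin1.
Hypothesis h1P : (h1 0%N = h1 1%N /\ h1 2%N = h1 3%N) \/ (h1 0%N = h1 3%N /\ h1 1%N = h1 2%N).
Hypothesis h2P : (forall n m, h1 n = h1 m -> g1 n = g1 m -> h2 n = h2 m) \/
  (forall n m, h1 n = h1 m -> g2 n = g2 m -> h2 n = h2 m).

Let x n := vec (coin1 n) (g1 n) (h1 n).
Let y n := vec (coin1 n) (g2 n) (h2 n).
Let F a := @pair_coord V nats nats a \o (fun n => (x n, y n)).

Let mF1 a (z : pair_space nats nats a) : measurable ([set z] : set (borel (pair_space nats nats a))).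
Proof. by case: a z => v z; exact: measurable_nat1. Qed.

Let g_odd (g : nat -> nat) n m : (forall n m, g n = g m) \/ g = coin1 -> odd n = odd m -> g n = g m.
Proof. by move=> [//|-> nm]; rewrite /coin1 nm. Qed.

Let before_odd a n m : (two (bef k) (bef k)) a -> odd n = odd m -> F a n = F a m.
Proof.
move=> ak nm; case: a ak => v vk; rewrite /F/= /x /y /vec.
  case: (v == i); first by rewrite /coin1 nm.
  case: (v == j); first exact: g_odd.
  by case: eqP => // vk'; move: vk; rewrite vk' /two/before/mkset ltnn.
case: (v == i); first by rewrite /coin1 nm.
case: (v == j); first exact: g_odd.
by case: eqP => // vk'; move: vk; rewrite vk' /two/before/mkset ltnn.
Qed.

Let before_const a n m : (two (bef i) (bef i)) a -> F a n = F a m.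
Proof.
case: a => v vi; rewrite /F/= /x /y /vec.
  case: eqP => [vi'|_]; first by move: vi; rewrite vi' /two/before/mkset ltnn.
  case: eqP => [vj|_]; first by move: vi; rewrite vj /two/before/mkset ltnNge (ltnW rij).
  case: eqP => [vk|//]; by move: vi; rewrite vk /two/before/mkset ltnNge (ltnW (ltn_trans rij rjk)).
case: eqP => [vi'|_]; first by move: vi; rewrite vi' /two/before/mkset ltnn.
case: eqP => [vj|_]; first by move: vi; rewrite vj /two/before/mkset ltnNge (ltnW rij).
case: eqP => [vk|//]; by move: vi; rewrite vk /two/before/mkset ltnNge (ltnW (ltn_trans rij rjk)).
Qed.

Lemma pair_ci_l v : ci F (coins R) (two [set v] set0) (two (bef v) (bef v)) (two (par v) set0).
Proof.
have sub : two (bef v) (bef v) `|` two (par v) set0 `<=` two (bef v) (bef v).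
  by move=> [] w [//|]; [exact: (pa_rank rk)|].
have [vi|/eqP/negbTE vi] := pselect (v = i).
  by subst v; apply: ci_const_rest => a /sub ai n m; exact: before_const.
have [vj|/eqP/negbTE vj] := pselect (v = j).
  subst v; case: g1P => hg.
    by apply: ci_const => -[] // w -> n m; rewrite /F/= /x !vec_j.
  apply: (@ci_function R _ _ F mF1 _ _ _ (inl i) (inl i)) => // n m + _ -[] // w ->.
  by rewrite /F/= /x !vec_i !vec_j hg.
have [vk|/eqP/negbTE vk] := pselect (v = k).
  subst v; apply: ci_balanced => [|a /sub ak n m]; last exact: before_odd.
  by case: h1P => -[e1 e2]; [left|right] => -[] // w ->; rewrite /F/= /x !vec_k.
by apply: ci_const => -[] // w -> n m; rewrite /F/= /x /vec vi vj vk.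
Qed.

(** The parents of the copy of k include k itself, j and the copy of j. One entry at j carries the
    first coin when it is needed, which turns b into a xor b or back. *)
Lemma pair_ci_r v : ci F (coins R) (two set0 [set v]) (two (bef v) (bef v))
  (two (v |` par v) (par v)).
Proof.
have [vi|/eqP/negbTE vi] := pselect (v = i).
  subst v; apply: (@ci_function R _ _ F mF1 _ _ _ (inl i) (inl i)); [by left|by left|].
  by move=> n m + _ -[] // w ->; rewrite /F/= /x /y !vec_i.
have [vj|/eqP/negbTE vj] := pselect (v = j).
  subst v; case: g2P => hg.
    by apply: ci_const => -[] // w -> n m; rewrite /F/= /y !vec_j.
  apply: (@ci_function R _ _ F mF1 _ _ _ (inr i) (inr i)) => // n m + _ -[] // w ->.
  by rewrite /F/= /y !vec_i !vec_j hg.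
have [vk|/eqP/negbTE vk] := pselect (v = k).
  subst v; case: h2P => hh.
    apply: (@ci_function R _ _ F mF1 _ _ _ (inl k) (inl j)); [by left|by right|].
    by move=> n m + + -[] // w ->; rewrite /F/= /x /y !vec_k !vec_j; exact: hh.
  apply: (@ci_function R _ _ F mF1 _ _ _ (inl k) (inr j)); [by left|by []|].
  by move=> n m + + -[] // w ->; rewrite /F/= /x /y !vec_k !vec_j; exact: hh.
by apply: ci_const => -[] // w -> n m; rewrite /F/= /y /vec vi vj vk.
Qed.

Lemma pair_compatible (mxy : measurable_fun setT (fun n => (x n, y n))) :
  compatible (law (coins R) mxy) (@pair_coord V nats nats) (causal_graph G).
Proof.
apply: (law_compatible Unats rk (x := x) (y := y)) => v; [exact: (@pair_ci_l v)|exact: (@pair_ci_r v)].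
Qed.

Lemma pair_PG (mx' : measurable_fun setT x) : PG G (law (coins R) mx').
Proof.
apply/(compatibleP _ (fun v => @measurable_coord V nats v) Unats).
apply: (local_markov rk (fun v => @measurable_coord V nats v)) => v.
have [_ pull] := @ci_pullback _ _ _ _ _ nats (@crd V nats) R (coins R) _ mx'
  [set v] [set w | (r w < r v)%N] (par v) (fun v => @measurable_coord V nats v).
apply: pull; have := @pair_ci_l v; rewrite /ci.
have -> : two (bef v) (bef v) `|` two (par v) set0 = two (bef v `|` par v) (bef v).
  by apply/seteqP; split => -[] w; rewrite /two/setU/set0/mkset; tauto.
rewrite !coords_fst; apply: predicts_weaken => //.
rewrite -(coords_fst x y); apply: coords_mono => -[]//.
Qed.

End Pair.

Definition coin2 (n : nat) : nat := odd n./2.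
Definition coin12 (n : nat) : nat := odd n (+) odd n./2.

Let x n := vec (coin1 n) 2 (coin2 n).
Let y n := vec (coin1 n) (coin1 n) (coin2 n).
Let z n := vec (coin1 n) 3 (coin12 n).

(** The entry at [j] tells the three kinds of points apart: 2 for x, a coin for y, 3 for z. Hence no
    point of x is linked to a point of z, and a common neighbour must be of the kind y. *)
Definition link_xy (u w : prod_space nats) : Prop := exists a b : bool,
  [/\ u i = a :> nat, u j = 2%N, u k = b :> nat & [/\ w i = a :> nat, w j = a :> nat & w k = b :> nat]].

Definition link_yz (w u : prod_space nats) : Prop := exists a b : bool,
  [/\ w i = a :> nat, w j = a :> nat, w k = b :> nat &
      [/\ u i = a :> nat, u j = 3%N & u k = (a (+) b) :> nat]].

Definition link (u w : prod_space nats) : Prop :=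
  [\/ link_xy u w, link_xy w u, link_yz u w | link_yz w u].

Definition dist (u w : prod_space nats) : R := (hops link u w)%:R.

Let link_sym u w : link u w -> link w u.
Proof. by case=> h; [constructor 2|constructor 1|constructor 4|constructor 3]. Qed.

Let discrete_prod (u : prod_space nats) (A : set (prod_space nats)) : A u -> nbhs u A.
Proof.
move=> Au; have h : \forall w \near u, forall v, w v = u v.
  apply: (@filter_forall _ V (fun v => [set w : prod_space nats | w v = u v]) (nbhs u)) => v.
  apply: (@proj_continuous _ nats v u [set c | c = u v]).
  by rewrite nbhs_principalE => c ->.
apply: filterS h => w wu; suff -> : w = u by [].
exact: functional_extensionality_dep.
Qed.

Lemma dist_complete_metric : complete_metric dist.
Proof. exact: hops_complete_metric link_sym discrete_prod. Qed.

Let measurable_all (A : set M) : measurable A.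
Proof.
apply: sub_sigma_algebra; rewrite openE => u Au; exact: discrete_prod.
Qed.

Let Pnats v : polish R (nats v). Proof. exact: polish_nat. Qed.

Variables (p : R) (p1 : 1 <= p) (dag : is_dag G).
Let p0 : 0 < p. Proof. exact: lt_le_trans p1. Qed.
Local Open Scope ereal_scope.

Let mx : measurable_fun setT (x : nat -> M). Proof. exact: measurable_from_nat. Qed.
Let my : measurable_fun setT (y : nat -> M). Proof. exact: measurable_from_nat. Qed.
Let mz : measurable_fun setT (z : nat -> M). Proof. exact: measurable_from_nat. Qed.

Let mu := law (coins R) mx.
Let nu := law (coins R) my.
Let la := law (coins R) mz.

Let pair_bicausal (f g : nat -> M) (mf : measurable_fun setT f) (mg : measurable_fun setT g)
  (mfg : measurable_fun setT (fun n => (f n, g n))) :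
  (forall mfg : measurable_fun setT (fun n => (f n, g n)),
    compatible (law (coins R) mfg) (@pair_coord V nats nats) (causal_graph G)) ->
  (forall mgf : measurable_fun setT (fun n => (g n, f n)),
    compatible (law (coins R) mgf) (@pair_coord V nats nats) (causal_graph G)) ->
  bicausal_couplings G (law (coins R) mf) (law (coins R) mg) (law (coins R) mfg).
Proof.
move=> c1 c2; have mgf : measurable_fun setT (fun n => (g n, f n)) by exact: measurable_from_nat.
exact: (@bicausal_law R V nats G _ _ (coins R) f g mfg mgf).
Qed.

Let coin2P : (coin2 0 = coin2 1 /\ coin2 2 = coin2 3)%N \/ (coin2 0 = coin2 3 /\ coin2 1 = coin2 2)%N.
Proof. by left. Qed.

Let coin12P : (coin12 0 = coin12 1 /\ coin12 2 = coin12 3)%N \/ (coin12 0 = coin12 3 /\ coin12 1 = coin12 2)%N.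
Proof. by right. Qed.

Let nat_bool_inj (a b : bool) : a = b :> nat -> a = b. Proof. by case: a b => -[]. Qed.

Let coin12_fun n m : coin2 n = coin2 m -> coin1 n = coin1 m -> coin12 n = coin12 m.
Proof. by move=> /nat_bool_inj h1 /nat_bool_inj h2; rewrite /coin12 h1 h2. Qed.

Let coin2_fun n m : coin12 n = coin12 m -> coin1 n = coin1 m -> coin2 n = coin2 m.
Proof.
move=> /nat_bool_inj + /nat_bool_inj h; rewrite /coin2 h => /addbI -> //.
Qed.

Let mxy : measurable_fun setT (fun n => (x n, y n)). Proof. exact: measurable_from_nat. Qed.
Let myz : measurable_fun setT (fun n => (y n, z n)). Proof. exact: measurable_from_nat. Qed.

Let bicausal_xy : bicausal_couplings G mu nu (law (coins R) mxy).
Proof.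
apply: pair_bicausal => m; apply: pair_compatible => //; by [left|right|left].
Qed.

Let bicausal_yz : bicausal_couplings G nu la (law (coins R) myz).
Proof.
apply: pair_bicausal => m; apply: pair_compatible => //; try by [left|right].
Qed.

Let dist_lt (u w : prod_space nats) : (dist u w <= 3)%R.
Proof. by rewrite /dist (ler_nat R _ 3) hops_le3. Qed.

Let PpG_law (f : nat -> M) (mf : measurable_fun setT f) : PG G (law (coins R) mf) ->
  PpG G dist p (law (coins R) mf).
Proof.
move=> Gf; split => //; exists point.
have mc : measurable_fun setT (fun u : M => (dist u point `^ p)%:E).
  by move=> _ A mA; exact: measurable_all.
rewrite ge0_integral_law// ?preimage_setT; last by move=> u; rewrite lee_fin powR_ge0.
apply: (@le_lt_trans _ _ (\int[coins R]_n cst ((3 `^ p)%R)%:E n)).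
  apply: ge0_le_integral => //; first by move=> n _; rewrite lee_fin powR_ge0.
  move=> n _; rewrite /= lee_fin ge0_ler_powR// ?nnegrE ?ler0n ?dist_lt//.
  exact: ltW.
rewrite integral_cst//; apply: lte_mul_pinfty; rewrite ?lee_fin ?powR_ge0//.
by rewrite (le_lt_trans (probability_le1 _ _))// ltry.
Qed.

Let mu_PpG : PpG G dist p mu.
Proof.
apply: PpG_law; exact: (@pair_PG (fun=> 2%N) coin1 coin2 coin2 (or_introl (fun _ _ => erefl))
  (or_intror erefl) coin2P (or_introl (fun _ _ e _ => e)) mx).
Qed.

Let nu_PpG : PpG G dist p nu.
Proof.
apply: PpG_law; exact: (@pair_PG coin1 coin1 coin2 coin2 (or_intror erefl)
  (or_intror erefl) coin2P (or_introl (fun _ _ e _ => e)) my).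
Qed.

Let la_PpG : PpG G dist p la.
Proof.
apply: PpG_law; exact: (@pair_PG (fun=> 3%N) coin1 coin12 coin12 (or_introl (fun _ _ => erefl))
  (or_intror erefl) coin12P (or_introl (fun _ _ e _ => e)) mz).
Qed.

Let WG_le1 (f g : nat -> M) (mfg : measurable_fun setT (fun n => (f n, g n))) mu' nu' :
  bicausal_couplings G mu' nu' (law (coins R) mfg) -> (forall n, link (f n) (g n)) ->
  WG G dist p mu' nu' <= 1.
Proof.
move=> b l; rewrite -[X in _ <= X](poweR1r p^-1).
apply: le_poweR.
- by rewrite invr_ge0 ltW.
- by apply: le_ereal_inf_tmp => _ [pi _ <-]; apply: integral_ge0 => w _; rewrite lee_fin powR_ge0.
apply: (@le_trans _ _ (\int[law (coins R) mfg]_w cost p dist w)).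
  by apply: ereal_inf_lbound; exists (law (coins R) mfg).
rewrite ge0_integral_law//; last 2 first.
- exact: (measurable_cost p Pnats dist_complete_metric).
- by move=> w; exact: cost_ge0.
rewrite preimage_setT; apply: (@le_trans _ _ (\int[coins R]_n cst 1 n)).
  apply: ge0_le_integral => //; first by move=> n _; rewrite lee_fin powR_ge0.
  move=> n _; rewrite /cost/= lee_fin; apply: (@le_trans _ _ (1 `^ p)%R); last by rewrite powR1.
  rewrite ge0_ler_powR ?nnegrE ?ler0n//; first exact: ltW.
  rewrite /dist (ler_nat R _ 1) /hops; case: asboolP => // _.
  by case: asboolP => // nl; case: (nl (l n)).
by rewrite integral_cst// mul1e probability_le1.
Qed.

Let link_xyn n : link (x n) (y n).
Proof.
constructor 1; exists (odd n), (odd n./2).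
by rewrite /x /y !vec_i !vec_j !vec_k.
Qed.

Let link_yzn n : link (y n) (z n).
Proof.
constructor 3; exists (odd n), (odd n./2).
by rewrite /y /z !vec_i !vec_j !vec_k.
Qed.

(** * The cost of a bicausal coupling of mu and la *)

Section LowerBound.
Variable pi : probability (M * M)%type R.
Hypothesis bpi : bicausal_couplings G mu la pi.

Let F := @pair_coord V nats nats.
Let mF a : measurable_fun setT (F a : M * M -> borel (pair_space nats nats a)).
Proof. exact: measurable_pair_coord. Qed.

Let pi1 A : pi (fst @^-1` A) = mu A.
Proof. by have [h _ _ _] := (bicausalP G mu la pi).1 bpi; exact: h. Qed.

Let pi2 A : pi (snd @^-1` A) = la A.
Proof. by have [_ h _ _] := (bicausalP G mu la pi).1 bpi; exact: h. Qed.

(** All deterministic coordinates have their prescribed values; the zeros at [i] and [k] are never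
    read. The parents of [k] are among these coordinates because [i] is not a parent of [k]. *)
Let D1 : set M := [set u | forall v, v != i -> v != k -> u v = vec 0 2 0 v].
Let D2 : set M := [set u | forall v, v != i -> v != k -> u v = vec 0 3 0 v].
Let D : set (M * M) := D1 `*` D2.

Let mD : measurable D. Proof. by apply: measurableX; exact: measurable_all. Qed.

Let vec_off a b c a' c' v : v != i -> v != k -> vec a b c v = vec a' b c' v.
Proof. by rewrite /vec => /negbTE -> /negbTE ->. Qed.

Let piD : pi (~` D) = 0.
Proof.
have sub : ~` D `<=` fst @^-1` (~` D1) `|` snd @^-1` (~` D2).
  by move=> [u w] /= nD; apply: contrapT => /not_orP[/contrapT h1 /contrapT h2]; apply: nD.
have m1 : measurable (fst @^-1` (~` D1) : set (M * M)).
  by apply: (measurable_preimage measurable_fst); exact: measurable_all.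
have m2 : measurable (snd @^-1` (~` D2) : set (M * M)).
  by apply: (measurable_preimage measurable_snd); exact: measurable_all.
apply/eqP; rewrite eq_le measure_ge0 andbT.
apply: le_trans (le_measure _ _ _ sub) _; rewrite ?inE.
- exact: measurableC.
- exact: measurableU.
apply: le_trans (measureU2 _ m1 m2) _.
have le0 (q : \bar R) : q = 0 -> q <= 0 by move=> ->.
apply: (@le_trans _ _ (0 + 0)); last by rewrite adde0.
apply: leeD; apply: le0.
  apply: etrans (pi1 _) _; rewrite -[LHS]/(coins R (x @^-1` (~` D1))).
  rewrite (_ : x @^-1` _ = set0) ?measure0//.
  by apply/seteqP; split => // n /=; apply => v vi vk; exact: vec_off.
apply: etrans (pi2 _) _; rewrite -[LHS]/(coins R (z @^-1` (~` D2))).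
rewrite (_ : z @^-1` _ = set0) ?measure0//.
by apply/seteqP; split => // n /=; apply => v vi vk; exact: vec_off.
Qed.

(* The coordinates at k depend on the past only through the parents, which are
   deterministic. *)
Let ends_ci : ci F pi (two set0 [set k] `|` two [set k] set0) (two (bef k) (bef k))
  (two (par k) (par k)).
Proof.
have [_ _ c _] := (bicausalP G mu la pi).1 bpi.
have [hl hr] := causal_compatibleE rk mF (pair_space_countable_base Unats) c.
have hk1 : ci F pi (two [set k] set0) (two (bef k) (bef k)) (two (par k) set0).
  rewrite (_ : two [set k] set0 = [set inl k]); first exact: hl.
  by apply/seteqP; split => [[w|w]//= ->|a ->].
have hk2 : ci F pi (two set0 [set k]) (two setT (bef k)) (two (k |` par k) (par k)).
  rewrite (_ : two set0 [set k] = [set inr k]); first exact: hr.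
  by apply/seteqP; split => [[w|w]//= ->|a ->].
apply: (ci_Ul mF); [apply: (ci_weaken hk2)|apply: (ci_weaken hk1)]; move=> [w|w];
  rewrite ?/two ?/setU ?/set1 ?/setT ?/set0 ?/mkset;
  have := @pa_rank V G r rk k w; rewrite ?/before ?/mkset; tauto.
Qed.

Let same1 (c : bool) : set (M * M) := [set w | w.1 i = c :> nat /\ w.2 i = c :> nat].
(** The relation at [k] that a common neighbour with first coin [c] imposes; [same1 c] is the
    relation that it imposes at [i]. *)
Let twist (c : bool) : set (M * M) :=
  [set w | exists b : bool, w.1 k = b :> nat /\ w.2 k = (c (+) b) :> nat].

Let sF A : sub_alg (coords F A). Proof. exact: (coords_sub_alg mF). Qed.

Let coord_l A v (c : nat) : A (inl v) -> coords F A [set w | w.1 v = c :> nat].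
Proof. by move=> Av; exact: (@coords_coord _ _ _ _ F A (inl v) Av [set c] (measurable_nat1 c)). Qed.

Let coord_r A v (c : nat) : A (inr v) -> coords F A [set w | w.2 v = c :> nat].
Proof. by move=> Av; exact: (@coords_coord _ _ _ _ F A (inr v) Av [set c] (measurable_nat1 c)). Qed.

Let same1_coords c : coords F (two (bef k) (bef k)) (same1 c).
Proof.
have ik : bef k i by rewrite /before/mkset (ltn_trans rij).
by apply: (sub_algI (sF _)); [exact: coord_l|exact: coord_r].
Qed.

Let twist_coords c : coords F (two set0 [set k] `|` two [set k] set0) (twist c).
Proof.
set A := _ `|` _.
have tE (b : bool) : coords F A [set w | w.1 k = b :> nat /\ w.2 k = (c (+) b) :> nat].
  by apply: (sub_algI (sF _)); [apply: coord_l; right|apply: coord_r; left].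
have -> : twist c = [set w | w.1 k = true :> nat /\ w.2 k = (c (+) true) :> nat] `|`
    [set w | w.1 k = false :> nat /\ w.2 k = (c (+) false) :> nat].
  apply/seteqP; split => w; first by move=> [[] h]; [left|right].
  by move=> [h|h]; [exists true|exists false].
move: (tE true) (tE false); rewrite -(measurable_sub_alg (sF A)); exact: measurableU.
Qed.

Let mtwist c : measurable (twist c). Proof. exact: (sF _).2 _ (twist_coords c). Qed.
Let msame1 c : measurable (same1 c). Proof. exact: (sF _).2 _ (same1_coords c). Qed.

(** Almost surely the coordinates at the parents of [k] are constant, so conditional independence
    given them is plain independence. *)
Let twist_same1 c : pi (twist c `&` same1 c) = pi (twist c) * pi (same1 c).
Proof.
apply: (ci_independent mF mD piD _ ends_ci (twist_coords c) (same1_coords c)).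
have off v : v \in pa G k -> v != i /\ v != k.
  move=> vk; split; first by apply/eqP => vi; move: nik; rewrite -vi vk.
  by apply/eqP => e; move: (pa_rank rk vk); rewrite e ltnn.
move=> w w' [w1 w2] [w1' w2'] [] v /= /off [vi vk].
  by rewrite /F/= (w1 v vi vk) (w1' v vi vk).
by rewrite /F/= (w2 v vi vk) (w2' v vi vk).
Qed.

Let same1_le c : pi (same1 c) <= (2^-1)%:E.
Proof.
apply: (@le_trans _ _ (pi (fst @^-1` [set u : M | u i = c :> nat]))).
  apply: le_measure; rewrite ?inE => //.
    by apply: (measurable_preimage measurable_fst); exact: measurable_all.
  by move=> w [].
rewrite le_eqVlt; apply/orP; left; apply/eqP; apply: etrans (pi1 _) _.
rewrite -[LHS]/(coins R [set n | x n i = c :> nat]) coinsE.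
have mem n : (n \in [set n | x n i = c :> nat]) = (odd n == c).
  apply/idP/eqP; rewrite inE /= /x vec_i; first exact: nat_bool_inj.
  by rewrite /coin1 => ->.
by rewrite !mem; case: c {mem} => /=; congr EFin; lra.
Qed.

Let good := (twist true `&` same1 true) `|` (twist false `&` same1 false).

Let mgood : measurable good. Proof. by apply: measurableU; exact: measurableI. Qed.

(** The two twists are disjoint, so their probabilities add up to at most 1, and each is multiplied
    by a factor of at most 1/2. *)
Let good_le : pi good <= (2^-1)%:E.
Proof.
have h c : pi (twist c `&` same1 c) <= pi (twist c) * (2^-1)%:E.
  by rewrite twist_same1; apply: lee_wpmul2l.
apply: (@le_trans _ _ ((pi (twist true) + pi (twist false)) * (2^-1)%:E)).
  rewrite muleDl//; last by rewrite ge0_adde_def// inE measure_ge0.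
  apply: le_trans (measureU2 _ _ _) (leeD (h true) (h false)); exact: measurableI.
rewrite -measureU//; last first.
  apply/seteqP; split => // w /= [[b [b1 b2]] [b' [b1' b2']]].
  have bb : b = b' by apply: nat_bool_inj; rewrite -b1.
  by move: b2; rewrite b2' bb; case: b' {b1' b2' bb}.
rewrite -[leRHS]mul1e; apply: lee_wpmul2r; last exact: probability_le1 (measurableU _ _ (mtwist _) (mtwist _)).
by rewrite lee_fin invr_ge0.
Qed.

Let D_j w : D w -> w.1 j = 2%N :> nat /\ w.2 j = 3%N :> nat.
Proof.
have jk' : j != k by rewrite eq_sym nkj.
by move=> [d1 d2]; rewrite (d1 j) ?nji// (d2 j) ?nji// !vec_j.
Qed.

Let hops_ge2 w : D w -> (2 <= hops link w.1 w.2)%N.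
Proof.
move=> /D_j[w1 w2]; rewrite /hops; case: asboolP => [e|_].
  by move: w1; rewrite e w2.
case: asboolP => [l|_]; last by case: asboolP.
exfalso; case: l => -[a [b]].
- by move=> [_ _ _ [_ + _]]; rewrite w2; case: a.
- by move=> [_ + _ _]; rewrite w2.
- by move=> [_ + _ _]; rewrite w1; case: a.
- by move=> [_ _ _ [_ + _]]; rewrite w1.
Qed.

(** Distance 2 would need a common neighbour; its coins a and b would be those of both points,
    giving [same1 a] and [twist a]. *)
Let hops_good w : D w -> ~ good w -> hops link w.1 w.2 = 3%N.
Proof.
move=> Dw ng; have := hops_ge2 Dw; have [w1 w2] := D_j Dw.
rewrite /hops; do 2![case: asboolP => // _]; case: asboolP => // -[m [l1 l2]] _.
exfalso; apply: ng.
have [a [b [u1 _ u3 [m1 m2 m3]]]] : link_xy w.1 m.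
  case: l1 => // -[a [b]].
  - by move=> [_ _ _ [_ + _]]; rewrite w1; case: a.
  - by move=> [_ + _ _]; rewrite w1; case: a.
  - by move=> [_ _ _ [_ + _]]; rewrite w1.
have [a' [b' [m1' m2' m3' [v1 _ v3]]]] : link_yz m w.2.
  case: l2 => // -[a' [b']].
  - by move=> [_ _ _ [_ + _]]; rewrite w2; case: a'.
  - by move=> [_ + _ _]; rewrite w2.
  - by move=> [_ + _ _]; rewrite w2; case: a'.
have aa : a' = a by apply: nat_bool_inj; rewrite -m1.
have bb : b' = b by apply: nat_bool_inj; rewrite -m3.
subst a' b'; case: a u1 v1 v3 {m1 m2 m1' m2'} => u1 v1 v3; [left|right]; split=> //; by exists b.
Qed.

Lemma cost_lower_bound : ((2 `^ p + 3 `^ p) / 2)%:E <= \int[pi]_w cost p dist w.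
Proof.
have p23 : (2 `^ p <= 3 `^ p :> R)%R.
  by rewrite ge0_ler_powR ?nnegrE ?ler_nat//; exact: ltW.
have mDg : measurable (D `\` good) by exact: measurableD.
(* A minorant of the cost: on [D] it is 2^p on [good], the least possible value, and 3^p off
   [good]. *)
pose low w := (2 `^ p)%:E * (\1_D w)%:E + (3 `^ p - 2 `^ p)%:E * (\1_(D `\` good) w)%:E : \bar R.
have d0 : 0 <= (3 `^ p - 2 `^ p)%:E :> \bar R by rewrite lee_fin subr_ge0.
have t0 : 0 <= (2 `^ p)%:E :> \bar R by rewrite lee_fin powR_ge0.
have m1 : measurable_fun setT (fun w => (2 `^ p)%:E * (\1_D w)%:E : \bar R).
  by apply: measurable_funeM; apply/measurable_EFinP; exact: measurable_indic.
have m2 : measurable_fun setT (fun w => (3 `^ p - 2 `^ p)%:E * (\1_(D `\` good) w)%:E : \bar R).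
  by apply: measurable_funeM; apply/measurable_EFinP; exact: measurable_indic.
have piDT : pi D = 1 by rewrite -[D]setCK probability_setC ?piD ?sube0//; exact: measurableC.
have lowE : \int[pi]_w low w = (2 `^ p)%:E + (3 `^ p - 2 `^ p)%:E * pi (D `\` good).
  rewrite ge0_integralD//; last by move=> w _; rewrite mule_ge0.
  rewrite !ge0_integralZl//; last 2 first.
  - by apply/measurable_EFinP; exact: measurable_indic.
  - by apply/measurable_EFinP; exact: measurable_indic.
  have i1 : \int[pi]_w (\1_D w)%:E = 1 by rewrite integral_indic// setIT; exact: piDT.
  have i2 : \int[pi]_w (\1_(D `\` good) w)%:E = pi (D `\` good) by rewrite integral_indic// setIT.
  by rewrite i1 i2 mule1.
have half : (2^-1)%:E <= pi (D `\` good).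
  have : 1 <= pi (D `\` good) + pi good.
    rewrite -piDT; apply: le_trans (measureU2 _ mDg mgood); apply: le_measure; rewrite ?inE//.
      exact: measurableU.
    by move=> w Dw; have [g|g] := pselect (good w); [right|left].
  move=> h1; have := le_trans h1 (leeD2l _ good_le).
  rewrite -leeBlDr// -EFinB; apply: le_trans; rewrite lee_fin; lra.
apply: (@le_trans _ _ (\int[pi]_w low w)).
  rewrite lowE; apply: (@le_trans _ _ ((2 `^ p)%:E + (3 `^ p - 2 `^ p)%:E * (2^-1)%:E)).
    by rewrite -EFinM -EFinD lee_fin; lra.
  by apply: leeD2l; apply: lee_wpmul2l.
apply: ge0_le_integral => //.
- by move=> w _; rewrite /low adde_ge0// mule_ge0.
- exact: emeasurable_funD.
- exact: (measurable_cost p Pnats dist_complete_metric).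
move=> w _; rewrite /low !indicE /cost.
case: (boolP (w \in D)) => [|/negP]; rewrite inE => Dw; last first.
  by rewrite memNset; [rewrite !mule0 adde0 lee_fin powR_ge0|move=> []].
have [g|g] := pselect (good w).
  have -> : (w \in D `\` good) = false by apply/negbTE/negP; rewrite inE => -[].
  rewrite mule0 adde0 mule1.
  rewrite lee_fin ge0_ler_powR ?nnegrE ?ler0n//; first exact: ltW.
  by rewrite /dist (ler_nat R 2) hops_ge2.
rewrite mem_set// !mule1 -EFinD lee_fin /dist hops_good//.
by rewrite addrC subrK.
Qed.

End LowerBound.

Theorem no_triangle_inequality : ~ triangle_inequality_on (PpG G dist p) (WG G dist p).
Proof.
move=> /(_ mu nu la mu_PpG nu_PpG la_PpG) tri.
have le2 : WG G dist p mu la <= 2%:E.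
  apply: le_trans tri _; rewrite (_ : 2%:E = 1 + 1 :> \bar R); last by rewrite -EFinD.
  by apply: leeD; [exact: WG_le1 bicausal_xy link_xyn|exact: WG_le1 bicausal_yz link_yzn].
pose a : R := ((2 `^ p + 3 `^ p) / 2)%R.
have a0 : 0 <= a%:E by rewrite lee_fin divr_ge0// addr_ge0// powR_ge0.
have : a%:E `^ p^-1 <= 2%:E.
  apply: le_trans le2; apply: (le_ereal_inf_poweR p1) => _ [pi b <-].
  split; first by apply: integral_ge0 => w _; exact: cost_ge0.
  apply: le_poweR => //; first by rewrite invr_ge0 ltW.
  exact: cost_lower_bound.
move=> /(le_poweR (ltW p0) (poweR_ge0 _ _)); rewrite (poweRVK p1)//.
rewrite /a poweR_EFin lee_fin.
have : (2 `^ p < 3 `^ p :> R)%R by rewrite gt0_ltr_powR ?nnegrE// ltr_nat.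
lra.
Qed.

End Counterexample.

Theorem theorem3p2 (R : realType) (p : R) (hp : 1 <= p)
    (V : finType) (G : digraph V) (hG : is_dag G) :
  (transitively_closed G ->
   forall (X : V -> ptopologicalType)
          (dX : prod_space X -> prod_space X -> R),
     (forall v, polish R (X v)) -> complete_metric dX ->
     metric_on (PpG G dX p) (WG G dX p))
  /\
  (~ transitively_closed G ->
   exists (X : V -> ptopologicalType)
          (dX : prod_space X -> prod_space X -> R),
     [/\ forall v, polish R (X v), complete_metric dX &
         ~ triangle_inequality_on (PpG G dX p) (WG G dX p)]).
Proof.
split=> [tc X dX PX cd|ntc].
  exact: (WG_metric hp hG PX cd tc).
have [r rk] := exists_rank hG.
have [i [j [k [ij jk nik]]]] : exists i j k, [/\ i \in pa G j, j \in pa G k & i \notin pa G k].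
  apply: contrapT => h; apply: ntc => i j k ij jk; apply: contrapT => /negP nik.
  by apply: h; exists i, j, k.
exists (@nats V), (dist R i j k); split.
- by move=> v; exact: polish_nat.
- exact: dist_complete_metric.
- exact: (no_triangle_inequality rk ij jk nik hp).
Qed.
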